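(* Let $\phi_{\mathbb{D}_5}(x,y)=(\gamma(x,y),\gamma(y,x))$ be the projective flow generated by the vector field $$\Big(\frac{x^4+4x^3y-6x^2y^2-4xy^3+y^4}{x^2+y^2},\ \frac{x^4-4x^3y-6x^2y^2+4xy^3+y^4}{x^2+y^2}\Big).$$ Then $\phi_{\mathbb{D}_5}$ is an abelian flow whose orbits are the curves $\mathscr{W}(x,y)=\mathrm{const.}$, and (wherever the expression below is defined) its analytic expression is $$\phi_{\mathbb{D}_5}(x,y)=\Big(\frac{\mathbf{k}(\omega)\,\varsigma}{\mathbf{k}'(\omega)^{1/4}(\mathbf{k}(\omega)^2+1)^{1/4}},\ \frac{\varsigma}{\mathbf{k}'(\omega)^{1/4}(\mathbf{k}(\omega)^2+1)^{1/4}}\Big),\qquad \omega=\alpha\Big(\frac{x}{y}\Big)-\varsigma,\quad \varsigma=\mathscr{W}(x,y)^{1/5},$$ where the value of $\mathbf{k}'(\omega)^{1/4}(\mathbf{k}(\omega)^2+1)^{1/4}$ is the one equal to the real fifth root $\mathscr{W}(\mathbf{k}(\omega))^{1/5}$. Here the pair of functions $(\mathbf{k},\mathbf{k}')$ (the abelian function and its derivative), with $\mathbf{k}(0)=1$, parametrizes (locally) the curve $$(x^2+1)^5y^5=(x-1)^4(x^4-4x^3-14x^2-4x+1)^4,$$ which has genus $6$. The flow $\phi_{\mathbb{D}_5}$ is a projective superflow with the dihedral group $\mathbb{D}_5$ (of order $10$) as its group of symmetries.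
   Context: Projective flow: a map $\phi$ such that $\phi^{t}(\mathbf{x})=t^{-1}\phi(\mathbf{x}t)$ satisfies $\phi^{t+s}=\phi^t\circ\phi^s$ (for $s,t$ small enough) and $\lim_{t\to0}\phi^t(\mathbf{x})=\mathbf{x}$; its vector field is $\frac{d}{dt}\phi^t(\mathbf{x})|_{t=0}$ (necessarily $2$-homogeneous), so $\phi^t$ is the time-$t$ map of this vector field and $\phi=\phi^1$. The flow is local: formulas for $\phi$ at $\mathbf{x}$ are understood at points $\mathbf{x}t$ with $|t|$ small, and by continuation along the integral curve. An abelian flow is a projective flow whose orbits are algebraic curves. $\mathscr{W}(x,y)=x^5-5x^4y-10x^3y^2+10x^2y^3+5xy^4-y^5$ and $\mathscr{W}(x)=\mathscr{W}(x,1)=(x-1)(x^4-4x^3-14x^2-4x+1)$. All fifth roots are real, so $\mathscr{W}(t)^{4/5}\ge 0$. Put $$\alpha(x)=\int_1^x\frac{(t^2+1)\,dt}{\mathscr{W}(t)^{4/5}},\qquad \Omega=\frac15\int_{-\infty}^{\infty}\frac{(t^2+1)\,dt}{\mathscr{W}(t)^{4/5}};$$ $\alpha$ is considered modulo $5\Omega$, as a function on $\mathbb{R}\cup\{\infty\}$, and $\mathbf{k}$ is its inverse: $\mathbf{k}(\alpha(x))=x$, $\mathbf{k}(t+5\Omega)=\mathbf{k}(t)$. $\mathbb{D}_5\subset O(2)$ is the group generated by $\begin{pmatrix}\cos\frac{2\pi}{5}&-\sin\frac{2\pi}{5}\\ \sin\frac{2\pi}{5}&\cos\frac{2\pi}{5}\end{pmatrix}$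 and $\begin{pmatrix}0&1\\1&0\end{pmatrix}$. For a finite group $\Gamma\subset\mathrm{GL}(n,\mathbb{R})$, a projective flow with nonzero $2$-homogeneous rational vector field $\mathbf{Q}$ is the projective $\Gamma$-superflow if $\gamma^{-1}\circ\mathbf{Q}\circ\gamma=\mathbf{Q}$ for all $\gamma\in\Gamma$, and every other $2$-homogeneous rational vector field with this invariance is either a scalar multiple of $\mathbf{Q}$ or has common denominator (in reduced form) of higher degree. *)

(* Defs.v *)
From HB Require Import structures.
From mathcomp Require Import all_boot all_order all_algebra.
From mathcomp Require Import all_classical all_reals all_analysis.
From mathcomp Require Export complex.
(* The notations of mpoly clash with those of mathcomp-analysis. *)
From mathcomp Require mpoly.
Export (canonicals, coercions) mpoly.

Set Implicit Arguments.
Unset Strict Implicit.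
Unset Printing Implicit Defensive.

Import Order.TTheory GRing.Theory Num.Theory.
Import numFieldNormedType.Exports.

Local Open Scope classical_set_scope.
Local Open Scope ring_scope.

Section ProjectiveFlows.
Variables (R : realType) (n : nat).
Implicit Types (V : 'cV[R]_n -> 'cV[R]_n) (phi : 'cV[R]_n -> option 'cV[R]_n).

Definition integral_curve V (a b : R) (c : R -> 'cV[R]_n) : Prop :=
  forall t : R, a < t < b -> is_derive t (1 : R) c (V (c t)).

Definition time_one V (p q : 'cV[R]_n) : Prop :=
  exists a b : R, exists c : R -> 'cV[R]_n,
    [/\ a < 0, 1 < b, integral_curve V a b c, c 0 = p & c 1 = q].

(* The flow phi = phi^1 generated by V. It is local, hence a partial map: the
   value is None when the integral curve of p does not live up to time 1. *)
Definition generated_flow V : 'cV[R]_n -> option 'cV[R]_n := fun p =>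
  if pselect (exists q, time_one V p q) is left h then Some (projT1 (cid h))
  else None.

(* phi^t(p) = t^-1 phi(t p), extended to t = 0 by its limit *)
Definition pflow phi (t : R) (p : 'cV[R]_n) : option 'cV[R]_n :=
  if t == 0 then Some p else omap (fun q => t^-1 *: q) (phi (t *: p)).

Definition pflow_curve phi (p : 'cV[R]_n) (t : R) : 'cV[R]_n :=
  odflt 0 (pflow phi t p).

Definition projective_flow (U : set 'cV[R]_n) phi : Prop :=
  forall p, U p ->
    (exists2 e : R, 0 < e & forall s t : R, `|s| < e -> `|t| < e ->
       exists q r, [/\ pflow phi s p = Some q, pflow phi t q = Some r
                     & pflow phi (t + s) p = Some r])
    /\ pflow_curve phi p t @[t --> (0 : R)^'] --> p.

Definition has_vector_field (U : set 'cV[R]_n) phi V : Prop :=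
  forall p, U p -> is_derive (0 : R) (1 : R) (pflow_curve phi p) (V p).

Definition flow_orbit phi (p : 'cV[R]_n) : set 'cV[R]_n :=
  [set q | exists t : R, pflow phi t p = Some q].

End ProjectiveFlows.

(* n = 2: an algebraic curve is the zero set of a nonconstant polynomial. *)
Definition abelian_flow (R : realType) (U : set 'cV[R]_2)
    (phi : 'cV[R]_2 -> option 'cV[R]_2) : Prop :=
  projective_flow U phi /\
  forall p, U p -> exists2 F : mpoly.mpoly 2 R, (1 < mpoly.msize F)%N &
    forall q, flow_orbit phi p q -> mpoly.meval (fun i => q i 0) F = 0.

Section Superflows.
Variables (R : realType) (n : nat).
Implicit Types (G : set 'M[R]_n) (V : 'cV[R]_n -> 'cV[R]_n).

Definition matrix_group G : Prop :=
  [/\ (forall g, G g -> g \in unitmx), G 1%:M,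
      (forall g h, G g -> G h -> G (g *m h)) & (forall g, G g -> G (invmx g))].

Definition generated_group (S : set 'M[R]_n) : set 'M[R]_n :=
  smallest matrix_group S.

Definition symmetries V : set 'M[R]_n :=
  [set g | g \in unitmx /\ forall p, invmx g *m V (g *m p) = V p].

Record ratvf := RatVF {
  rnum : 'I_n -> mpoly.mpoly n R;
  rden : mpoly.mpoly n R;
  _ : rden != 0 }.

Definition rdom (r : ratvf) : set 'cV[R]_n :=
  [set p | mpoly.meval (fun i => p i 0) (rden r) != 0].

Definition reval (r : ratvf) (p : 'cV[R]_n) : 'cV[R]_n :=
  \col_i (mpoly.meval (fun i => p i 0) (rnum r i) /
          mpoly.meval (fun i => p i 0) (rden r)).

(* msize is the total degree plus one. *)
Definition rreduced (r : ratvf) : Prop :=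
  forall d, (exists e, rden r = d * e) -> (forall i, exists e, rnum r i = d * e) ->
    (mpoly.msize d <= 1)%N.

Definition two_homogeneous (r : ratvf) : Prop :=
  forall (t : R) p, t != 0 -> rdom r p -> rdom r (t *: p) ->
    reval r (t *: p) = t ^+ 2 *: reval r p.

Definition invariant_under G (r : ratvf) : Prop :=
  forall g p, G g -> rdom r p -> rdom r (g *m p) ->
    invmx g *m reval r (g *m p) = reval r p.

Definition scalar_multiple (r' r : ratvf) : Prop :=
  exists c : R, forall p, rdom r p -> rdom r' p -> reval r' p = c *: reval r p.

Definition superflow G (phi : 'cV[R]_n -> option 'cV[R]_n) : Prop :=
  matrix_group G /\ finite_set G /\
  exists r : ratvf,
    [/\ projective_flow (rdom r) phi, has_vector_field (rdom r) phi (reval r),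
        [/\ rreduced r, two_homogeneous r & exists2 p, rdom r p & reval r p != 0],
        invariant_under G r
      & forall r', rreduced r' -> two_homogeneous r' -> invariant_under G r' ->
          scalar_multiple r' r \/ (mpoly.msize (rden r) < mpoly.msize (rden r'))%N].

End Superflows.

(* Plane curves: in P : {poly {poly K}} the inner variable is x, the outer y. *)
Section Genus.
Variable K : closedFieldType.

Definition eval_xy (L : fieldType) (iota : K -> L) (x y : L)
    (q : {poly {poly K}}) : L :=
  (map_poly (map_poly iota) q).[y%:P].[x].

(* field of fractions of K[x, y] / (P) *)
Record function_field (P : {poly {poly K}}) := FunctionField {
  ff_car :> fieldType;
  ff_const : {rmorphism K -> ff_car};
  ff_x : ff_car;
  ff_y : ff_car;
  _ : forall q, eval_xy ff_const ff_x ff_y q = 0 <-> exists r, q = r * P;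
  _ : forall f, exists a b, eval_xy ff_const ff_x ff_y b != 0 /\
        f = eval_xy ff_const ff_x ff_y a / eval_xy ff_const ff_x ff_y b }.

Section Differentials.
Variables (P : {poly {poly K}}) (L : function_field P).

(* a place, given by its normalized valuation; v 0 is irrelevant *)
Definition is_place (v : L -> int) : Prop :=
  [/\ forall f g, f != 0 -> g != 0 -> v (f * g) = v f + v g,
      forall f g, f != 0 -> g != 0 -> f + g != 0 ->
        Num.min (v f) (v g) <= v (f + g),
      forall c : K, c != 0 -> v (ff_const L c) = 0
    & exists2 t, t != 0 & v t = 1].

Definition is_derivation (D : L -> L) : Prop :=
  [/\ forall f g, D (f + g) = D f + D g,
      forall f g, D (f * g) = D f * g + f * D g
    & forall c : K, D (ff_const L c) = 0].

(* A differential w of L/K is identified with its value f = w(D) on a fixed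
   nonzero derivation D; then h dt corresponds to h * D t. *)
Definition regular_at (D : L -> L) (v : L -> int) (f : L) : Prop :=
  exists t h : L, [/\ t != 0, v t = 1, h != 0 -> 0 <= v h & f = h * D t].

Definition regular_differential (D : L -> L) (f : L) : Prop :=
  forall v, is_place v -> regular_at D v f.

End Differentials.

(* genus of the irreducible curve P = 0: the dimension over K of the space of
   everywhere regular differentials of its function field *)
Definition has_genus (P : {poly {poly K}}) (g : nat) : Prop :=
  exists (L : function_field P) (D : L -> L) (w : 'I_g -> L),
    [/\ is_derivation D, exists f, D f != 0,
        forall f, regular_differential D f <->
          exists c : 'I_g -> K, f = \sum_i ff_const L (c i) * w i
      & forall c : 'I_g -> K, \sum_i ff_const L (c i) * w i = 0 ->
          forall i, c i = 0].

End Genus.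

(* (x^2 + 1)^5 y^5 - (x - 1)^4 (x^4 - 4 x^3 - 14 x^2 - 4 x + 1)^4 *)
Definition curveD5 (K : comNzRingType) : {poly {poly K}} :=
  (('X ^+ 2 + 1) ^+ 5)%:P * 'X ^+ 5 -
  (('X - 1) ^+ 4 *
   ('X ^+ 4 - 'X ^+ 3 *+ 4 - 'X ^+ 2 *+ 14 - 'X *+ 4 + 1) ^+ 4)%:P.

(* The curve t |-> (f t, g t) is, near s0, a continuous bijective
   parametrization of a relatively open piece of the curve C. *)
Definition local_parametrization (R : realType) (f g : R -> R)
    (C : R -> R -> Prop) (s0 : R) : Prop :=
  [/\ \forall s \near s0, C (f s) (g s),
      {for s0, continuous f} /\ {for s0, continuous g},
      exists2 e : R, 0 < e & forall s t, `|s - s0| < e -> `|t - s0| < e ->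
        f s = f t -> g s = g t -> s = t
    & forall e : R, 0 < e -> exists2 d : R, 0 < d & forall a b : R,
        C a b -> `|a - f s0| < d -> `|b - g s0| < d ->
        exists s, [/\ `|s - s0| < e, f s = a & g s = b]].

Section D5.
Variable R : realType.

Definition pt (x y : R) : 'cV[R]_2 := \col_i (if i == 0 then x else y).

Definition rotation5 : 'M[R]_2 :=
  \matrix_(i, j)
    if i == j then cos (2 * pi / 5)
    else if i == 0 then - sin (2 * pi / 5) else sin (2 * pi / 5).

Definition swap2 : 'M[R]_2 := \matrix_(i, j) (i != j)%:R.

Definition D5 : set 'M[R]_2 := generated_group [set rotation5; swap2].

(* At the origin division by zero gives the value 0, which is the continuous
   extension of this 2-homogeneous field. *)
Definition QD5 (p : 'cV[R]_2) : 'cV[R]_2 :=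
  let x := p 0 0 in let y := p 1 0 in
  pt ((x ^+ 4 + 4 * x ^+ 3 * y - 6 * x ^+ 2 * y ^+ 2 - 4 * x * y ^+ 3 + y ^+ 4)
        / (x ^+ 2 + y ^+ 2))
     ((x ^+ 4 - 4 * x ^+ 3 * y - 6 * x ^+ 2 * y ^+ 2 + 4 * x * y ^+ 3 + y ^+ 4)
        / (x ^+ 2 + y ^+ 2)).

Definition phiD5 : 'cV[R]_2 -> option 'cV[R]_2 := generated_flow QD5.

Definition W (x y : R) : R :=
  x ^+ 5 - 5 * x ^+ 4 * y - 10 * x ^+ 3 * y ^+ 2 + 10 * x ^+ 2 * y ^+ 3
  + 5 * x * y ^+ 4 - y ^+ 5.

Definition root5 (x : R) : R := Num.sg x * (`|x| `^ 5^-1).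

Definition alpha_integrand (t : R) : R := (t ^+ 2 + 1) / root5 (W t 1) ^+ 4.

Definition Omega : R :=
  5^-1 * \int[lebesgue_measure]_(t in [set: R]) alpha_integrand t.

(* R with a point at infinity is option R, with None at infinity. The value of
   alpha at infinity (and alpha itself) only matters modulo 5 Omega. *)
Definition alpha (X : option R) : R :=
  match X with
  | Some x =>
      if 1 <= x then \int[lebesgue_measure]_(t in `[1, x]) alpha_integrand t
      else - \int[lebesgue_measure]_(t in `[x, 1]) alpha_integrand t
  | None => \int[lebesgue_measure]_(t in `[1, +oo[) alpha_integrand t
  end.

Definition kfun (s : R) : option R :=
  xget None [set X | exists m : int, s = alpha X + m%:~R * (5 * Omega)].

Definition kval (s : R) : R := odflt 0 (kfun s).

Definition kder (s : R) : R := derive1 kval s.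

Definition slope (x y : R) : option R := if y == 0 then None else Some (x / y).

(* k'(s)^(1/4) (k(s)^2 + 1)^(1/4), with the sign of W(k(s), 1) *)
Definition kdenom (s : R) : R :=
  Num.sg (W (kval s) 1) * (kder s `^ 4^-1 * (kval s ^+ 2 + 1) `^ 4^-1).

End D5.

(* Main.v *)
Require Import Defs.
From HB Require Import structures.
From mathcomp Require Import all_boot all_order all_algebra all_field.
From mathcomp Require Import all_classical all_reals all_analysis.
From mathcomp Require Import measurable_realfun.
From mathcomp Require Import ring lra zify.

(** With z = x + i y, the vector field is (1 + i) conj(z)^4 / |z|^2, and
    (1 + i) z^5 = W + i V for two real quintic forms W and V.  Along an integral
    curve the derivative of (1 + i) z^5 is 5 (1 + i)^2 |z|^6, which is purely
    imaginary: W is conserved.  The other identity that carries the proof is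
    W^2 + V^2 = 2 (x^2 + y^2)^5.

    The flow.  Let u = x / y and let s be the real fifth root of W(x, y).  The
    field gives u' = - s W(u)^(4/5) / (u^2 + 1), so alpha(u) + s t is constant
    along orbits and u = k(alpha(u_0) - s t); the second coordinate is then
    s / W(u)^(1/5), because W is homogeneous of degree 5.  This is the stated
    formula.  For the formula to make sense, alpha has to be understood at the
    zeros of W, where its integrand is infinite, and at infinity.  It has an
    explicit primitive Phi: an elementary bounded part, in which
    W^2 + V^2 = 2 (t^2 + 1)^5 is used, plus the integral of a continuous function
    that is O(1 / (1 + t^2)).  As Phi is continuous, bounded and strictly
    increasing, alpha is a bijection from the projective line to a period
    interval, and its inverse k satisfies k' = W(k)^(4/5) / (k^2 + 1) everywhere,
    because a continuous function whose derivative has a limit at a point is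
    differentiable there.  The relation alpha(1 / u) = - alpha(u) modulo the period
    lets the axis y = 0 be treated by exchanging the coordinates.  At the origin
    the field is locally Lipschitz but not smooth, so uniqueness of integral curves
    comes from a Gronwall estimate.  Every point other than the
    origin has a neighbourhood in which its level set of W lies in a single orbit; a
    connectedness argument turns this into the description of the orbits as
    components of level sets.

    The genus.  The equation (x^2 + 1)^5 y^5 = W(x)^4 is solved by
    y = w^4 / (x^2 + 1) with w^5 = W(x), so the function field is that of the
    curve w^5 = W(x).  This curve is smooth because W has simple roots, and
    (x, w) -> (1 / x, - w / x) maps it to itself, since W(1, u) = - W(u, 1); thus
    two copies of one affine model cover all places (lemmas place_center and
    place_parameter).  At the smooth points the differential dx / w^4 has neither
    zero nor pole, so a differential f dx / w^4 that is regular on the affine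
    curve has f polynomial in x and w (local_global), and it is regular at
    infinity exactly when f has degree at most 2 (infinity_descent): as for every
    smooth plane quintic, the regular differentials correspond to the conics,
    which form a space of dimension 6.

    The symmetries.  A real linear map is z -> a z + b conj(z).  Commuting with the
    field is a polynomial identity, which forces a b = 0 and then a^5 = 1 or
    b^5 = i: the ten elements of the dihedral group.  For a rational field N / d
    of degree two with this symmetry and deg d <= 2, N / d is on each line the
    quotient of homogeneous parts of degrees k + 2 and k with k <= 2.  As functions
    of z / conj(z) on the unit circle these are polynomials with few coefficients;
    rotation by a primitive fifth root of unity leaves only conj(z)^4 / |z|^2
    (rotation_rigidity), and the reflection fixes the argument of the factor. *)

Set Implicit Arguments.
Unset Strict Implicit.
Unset Printing Implicit Defensive.

Import Order.TTheory GRing.Theory Num.Theory.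

Local Open Scope ring_scope.

(** The form W is needed over the reals, over the polynomial rings and over the
    function field, so it is stated over an arbitrary commutative ring. *)
Definition Wform (A : comNzRingType) (x y : A) : A :=
  x ^+ 5 - 5 * x ^+ 4 * y - 10 * x ^+ 3 * y ^+ 2 + 10 * x ^+ 2 * y ^+ 3
  + 5 * x * y ^+ 4 - y ^+ 5.

Lemma rmorph_Wform (A B : comNzRingType) (f : {rmorphism A -> B}) (x y : A) :
  f (Wform x y) = Wform (f x) (f y).
Proof. by rewrite /Wform !(rmorphXn, rmorph_nat, rmorphB, rmorphM, rmorphD). Qed.

(** * The order of vanishing at a smooth point *)

(** A is a ring of functions that generates the field L, and e evaluates them at
    a point.  The hypotheses say that the local ring of the point is a discrete
    valuation ring with uniformizer t: a function vanishing at the point is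
    divisible by t up to a unit, and no nonzero function is divisible by all
    powers of t.  The order of vanishing at the point is then a place. *)
Section PointOrder.
Variables (K L : fieldType) (A : comNzRingType).
Variables (ev : {rmorphism A -> L}) (e : {rmorphism A -> K}) (t : A).
Hypothesis ker_ev : forall q, ev q = 0 -> e q = 0.
Hypothesis frac_ev : forall f : L, exists q d, ev d != 0 /\ f = ev q / ev d.
Hypothesis e_t : e t = 0.
Hypothesis ev_t : ev t != 0.
Hypothesis div_t : forall q, e q = 0 ->
  exists u q', e u != 0 /\ ev u * ev q = ev t * ev q'.
Hypothesis bound_t : forall q, ev q != 0 -> exists M : nat,
  forall n u q', e u != 0 -> ev u * ev q = ev t ^+ n * ev q' -> (n <= M)%N.

(** f is t ^ n times a unit of the local ring. *)
Definition is_ord (f : L) (n : int) := exists q u,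
  [/\ e q != 0, e u != 0 & f * ev u = ev t ^ n * ev q].

Lemma unit_neq0 q : e q != 0 -> ev q != 0.
Proof. by apply: contra => /eqP/ker_ev ->. Qed.

Lemma ord_neq0 f n : is_ord f n -> f != 0.
Proof.
move=> [q [u [q0 u0 E]]]; apply: contra_neq (unit_neq0 q0) => f0.
by apply: (mulfI (expfz_neq0 n ev_t)); rewrite -E f0 mul0r mulr0.
Qed.

Lemma ordM f g m n : is_ord f m -> is_ord g n -> is_ord (f * g) (m + n).
Proof.
move=> [q [u [q0 u0 E]]] [q' [u' [q0' u0' E']]].
exists (q * q'), (u * u'); rewrite !rmorphM !mulf_neq0//; split=> //.
by rewrite mulrACA E E' expfzDr// mulrACA.
Qed.

Lemma ordV f n : is_ord f n -> is_ord f^-1 (- n).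
Proof.
move=> fn; have f0 := ord_neq0 fn; have [q [u [q0 u0 E]]] := fn.
exists u, q; split=> //; apply: (mulfI f0); rewrite mulVKf//.
apply: (mulfI (expfz_neq0 n ev_t)); rewrite -E mulrCA [ev t ^ n * _]mulrA.
by rewrite -expfzDr// subrr expr0z mul1r.
Qed.

Lemma ord_unit q : e q != 0 -> is_ord (ev q) 0.
Proof. by move=> q0; exists q, 1; rewrite !rmorph1 expr0z mulr1 mul1r oner_eq0. Qed.

Lemma ord_t : is_ord (ev t) 1.
Proof. by exists 1, 1; rewrite !rmorph1 oner_eq0. Qed.

(** t can be divided out of q as long as the quotient vanishes at the point; the
    bound on the exponents makes this stop. *)
Lemma ord_poly_exists q : ev q != 0 -> exists n : nat, is_ord (ev q) n.
Proof.
move=> q0; have [M PM] := bound_t q0.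
have H k : (exists n : nat, is_ord (ev q) n) \/
    exists u q', e u != 0 /\ ev u * ev q = ev t ^+ k * ev q'.
  elim: k => [|k [IH|[u [q' [u0 E]]]]]; first 2 last.
  - have [q'0|q'0] := eqVneq (e q') 0; last first.
      by left; exists k, q', u; split=> //; rewrite mulrC E.
    have [u' [q'' [u'0 E']]] := div_t q'0; right; exists (u' * u), q''.
    rewrite !rmorphM mulf_neq0//; split=> //.
    by rewrite -mulrA E mulrCA E' exprSr !mulrA.
  - by right; exists 1, q; rewrite !rmorph1 oner_eq0 expr0.
  - by left.
have [//|[u [q' [u0 /(PM _ _ _ u0)]]]] := H M.+1.
by rewrite ltnn.
Qed.

Lemma ord_exists f : f != 0 -> exists n, is_ord f n.
Proof.
have [q [d [d0 ->]]] := frac_ev f; rewrite mulf_eq0 negb_or => /andP[q0 _].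
have [m qm] := ord_poly_exists q0; have [n dn] := ord_poly_exists d0.
by exists (m%:Z - n%:Z); apply: ordM => //; exact: ordV.
Qed.

(** Two different exponents would express a unit of the local ring as a multiple of
    t, which vanishes at the point. *)
Lemma ord_unique f m n : is_ord f m -> is_ord f n -> m = n.
Proof.
have H a b : is_ord f a -> is_ord f b -> (a <= b)%R.
  move=> [q [u [q0 u0 E]]] [q' [u' [q0' u0' E']]]; rewrite leNgt; apply/negP => ba.
  have [k kE] : exists k : nat, a = b + k.+1%:Z by exists `|a - b|.-1%N; lia.
  have : ev (t ^+ k.+1 * (q * u')) = ev (q' * u).
    apply: (mulfI (expfz_neq0 b ev_t)).
    rewrite rmorphM rmorphXn mulrA exprnP -expfzDr// -kE !rmorphM mulrA -E mulrAC.
    by rewrite mulrA -E' mulrAC.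
  move/eqP; rewrite -subr_eq0 -rmorphB => /eqP/ker_ev/eqP.
  rewrite rmorphB !rmorphM rmorphXn e_t expr0n mul0r sub0r oppr_eq0 mulf_eq0.
  by rewrite (negbTE q0') (negbTE u0).
by move=> fm fn; apply: le_anti; rewrite !H.
Qed.

Definition point_ord (f : L) : int :=
  if pselect (exists n, is_ord f n) is left h then projT1 (cid h) else 0.

Lemma point_ordP f : f != 0 -> is_ord f (point_ord f).
Proof.
move=> /ord_exists h; rewrite /point_ord; case: pselect => // h'.
by case: cid.
Qed.

Lemma point_ordE f n : is_ord f n -> point_ord f = n.
Proof.
by move=> fn; apply: ord_unique (point_ordP (ord_neq0 fn)) fn.
Qed.

Lemma point_ordM f g : f != 0 -> g != 0 -> point_ord (f * g) = point_ord f + point_ord g.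
Proof. by move=> f0 g0; apply/point_ordE/ordM; exact: point_ordP. Qed.

Lemma point_ordA q : ev q != 0 -> (0 <= point_ord (ev q))%R.
Proof. by move=> /ord_poly_exists[n /point_ordE ->]. Qed.

Lemma point_ordD f g : f != 0 -> g != 0 -> f + g != 0 ->
  (Num.min (point_ord f) (point_ord g) <= point_ord (f + g))%R.
Proof.
move=> f0 g0 fg0.
wlog fg : f g f0 g0 fg0 / (point_ord f <= point_ord g)%R.
  move=> H; case/orP: (le_total (point_ord f) (point_ord g)); first exact: H.
  by rewrite addrC minC; apply: H; rewrite // addrC.
rewrite (min_idPl fg).
have [q [u [q0 u0 E]]] := point_ordP f0; have [q' [u' [q0' u0' E']]] := point_ordP g0.
move: fg E E'; move: (point_ord f) (point_ord g) => m n mn E E'.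
have [k kE] : exists k : nat, n = m + k%:Z by exists `|n - m|%N; lia.
pose r := q * u' + t ^+ k * q' * u.
have rE : (f + g) * ev (u * u') = ev t ^ m * ev r.
  rewrite rmorphM mulrDl mulrA E [ev u * _]mulrC mulrA E' kE expfzDr// /r.
  by rewrite rmorphD !rmorphM rmorphXn -exprnP; ring.
have uu : ev (u * u') != 0 by apply: unit_neq0; rewrite rmorphM mulf_neq0.
have r0 : ev r != 0.
  by apply: contraNneq fg0 => r0; move/eqP: rE; rewrite r0 mulr0 mulf_eq0 (negbTE uu) orbF.
have := point_ordM fg0 uu; rewrite rE point_ordM ?expfz_neq0//.
have -> : point_ord (ev (u * u')) = 0.
  by apply: point_ordE; apply: ord_unit; rewrite rmorphM mulf_neq0.
have -> : point_ord (ev t ^ m) = m.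
  apply: point_ordE; exists 1, 1; rewrite !rmorph1 oner_eq0; split=> //.
rewrite addr0 => <-; rewrite lerDl; exact: point_ordA.
Qed.

(** The valuation ring of the place is the local ring of the point, not only a ring
    containing it. *)
Lemma point_ord_local f : f != 0 -> (0 <= point_ord f)%R ->
  exists q u, e u != 0 /\ f * ev u = ev q.
Proof.
move=> /point_ordP[q [u [q0 u0 E]]]; case: (point_ord f) E => // n E _.
by exists (t ^+ n * q), u; split=> //; rewrite rmorphM rmorphXn.
Qed.

Section Center.
Variable v : L -> int.
Hypothesis vM : forall f g, f != 0 -> g != 0 -> v (f * g) = v f + v g.
Hypothesis v_unit : forall q, e q != 0 -> v (ev q) = 0.
Hypothesis v_t : (0 < v (ev t))%R.
Hypothesis v1 : exists2 s, s != 0 & v s = 1.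

Lemma v_one : v 1 = 0.
Proof. by have := vM (oner_neq0 L) (oner_neq0 L); rewrite mulr1 => /eqP; rewrite -subr_eq0 opprD addNKr oppr_eq0 => /eqP. Qed.

Lemma v_exp f (n : nat) : f != 0 -> v (f ^+ n) = v f *+ n.
Proof.
move=> f0; elim: n => [|n IH]; first by rewrite expr0 v_one mulr0n.
by rewrite exprS vM ?expf_neq0// IH mulrS.
Qed.

Lemma v_inv f : f != 0 -> v f^-1 = - v f.
Proof.
move=> f0; have := vM f0 (invr_neq0 f0); rewrite mulfV// v_one => /eqP.
by rewrite eq_sym addrC addr_eq0 => /eqP.
Qed.

Lemma v_exprz f (n : int) : f != 0 -> v (f ^ n) = v f * n.
Proof.
move=> f0; case: n => n.
  by rewrite -exprnP v_exp// -mulr_natr natz.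
by rewrite NegzE -exprnN v_inv ?expf_neq0// v_exp// -mulr_natr natz mulrN.
Qed.

(** v is a multiple of the order at the point, because units of the local ring
    have value 0; it takes the value 1, hence the multiple is 1. *)
Lemma place_uniformizer : v (ev t) = 1.
Proof.
have [s s0 vs] := v1; have [q [u [q0 u0 E]]] := point_ordP s0.
move: E; move: (point_ord s) => n /(congr1 v).
rewrite (vM s0 (unit_neq0 u0)) (vM (expfz_neq0 n ev_t) (unit_neq0 q0)).
rewrite (v_unit q0) (v_unit u0) vs !addr0 v_exprz// => h.
have n0 : (0 < n)%R by rewrite -(pmulr_rgt0 _ v_t) -h.
by move: v_t h n0; move: (v (ev t)) => m; nia.
Qed.
End Center.

End PointOrder.

(** * Valuation rings of places *)

Section PlaceTheory.
Variables (K : closedFieldType) (Q : {poly {poly K}}) (L : function_field Q).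
Variable v : L -> int.
Hypothesis pv : is_place v.
Implicit Types f g : L.

(** A place v has no meaningful value at 0, so membership in its valuation ring
    and in the maximal ideal is stated under f != 0. *)
Definition vge0 f := f != 0 -> (0 <= v f)%R.
Definition vgt0 f := f != 0 -> (0 < v f)%R.

Lemma placeM f g : f != 0 -> g != 0 -> v (f * g) = v f + v g.
Proof. by case: pv => H _ _ _; exact: H. Qed.

Lemma place1 : v 1 = 0. Proof. exact: v_one placeM. Qed.

Lemma placeV f : f != 0 -> v f^-1 = - v f. Proof. exact: v_inv placeM f. Qed.

Lemma placeX f n : f != 0 -> v (f ^+ n) = v f *+ n. Proof. exact: v_exp placeM f n. Qed.

Lemma placeC c : c != 0 -> v (ff_const L c) = 0.
Proof. by case: pv => _ _ H _; exact: H. Qed.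

Lemma placeN f : f != 0 -> v (- f) = v f.
Proof.
move=> f0; rewrite -mulN1r placeM ?oppr_eq0 ?oner_eq0//.
by rewrite -(rmorph1 (ff_const L)) -rmorphN placeC ?add0r// oppr_eq0 oner_eq0.
Qed.

Lemma vge0M f g : vge0 f -> vge0 g -> vge0 (f * g).
Proof.
move=> f0 g0; rewrite /vge0 mulf_eq0 negb_or => /andP[/[dup]/f0 h1 fn /[dup]/g0 h2 gn].
by rewrite placeM// addr_ge0.
Qed.

Lemma vge0D f g : vge0 f -> vge0 g -> vge0 (f + g).
Proof.
have [->|fn] := eqVneq f 0; first by rewrite add0r.
have [->|gn] := eqVneq g 0; first by rewrite addr0.
move=> /(_ fn) f0 /(_ gn) g0 fgn; case: pv => _ /(_ f g fn gn fgn) H _ _.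
by apply: le_trans H; rewrite le_min f0.
Qed.

Lemma vgt0D f g : vgt0 f -> vgt0 g -> vgt0 (f + g).
Proof.
have [->|fn] := eqVneq f 0; first by rewrite add0r.
have [->|gn] := eqVneq g 0; first by rewrite addr0.
move=> /(_ fn) f0 /(_ gn) g0 fgn; case: pv => _ /(_ f g fn gn fgn) H _ _.
by apply: lt_le_trans H; rewrite lt_min f0.
Qed.

Lemma vgt0M f g : vgt0 f -> vge0 g -> vgt0 (f * g).
Proof.
move=> f0 g0; rewrite /vgt0 mulf_eq0 negb_or => /andP[/[dup]/f0 h1 fn /[dup]/g0 h2 gn].
by rewrite placeM// ltr_wpDr.
Qed.

Lemma vgt0W f : vgt0 f -> vge0 f.
Proof. by move=> f0 fn; exact/ltW/f0. Qed.

Lemma vge0C c : vge0 (ff_const L c).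
Proof. by rewrite /vge0 fmorph_eq0 => c0; rewrite placeC. Qed.

Lemma vgt0C c : vgt0 (ff_const L c) -> c = 0.
Proof.
have [//|c0] := eqVneq c 0; rewrite /vgt0 fmorph_eq0 => /(_ c0).
by rewrite placeC.
Qed.

Lemma vge0N f : vge0 f -> vge0 (- f).
Proof. by move=> f0; rewrite /vge0 oppr_eq0 => fn; rewrite placeN// f0. Qed.

Lemma vgt0N f : vgt0 f -> vgt0 (- f).
Proof. by move=> f0; rewrite /vgt0 oppr_eq0 => fn; rewrite placeN// f0. Qed.

Lemma vge0_horner (p : {poly L}) x : vge0 x -> (forall i, vge0 p`_i) -> vge0 p.[x].
Proof.
move=> x0; elim/poly_ind: p => [|p c IH] Hp; first by rewrite horner0 /vge0 eqxx.
rewrite hornerMXaddC; apply: vge0D.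
  apply: vge0M => //; apply: IH => i; have := Hp i.+1.
  by rewrite coefD coefMX coefC/= addr0.
by have := Hp 0; rewrite coefD coefMX coefC/= add0r.
Qed.

Lemma place_eq0 f : f != 0 -> vge0 f -> ~ vgt0 f -> v f = 0.
Proof.
move=> fn /(_ fn) f0 nf; apply: contrapT => vf; apply: nf => _.
by rewrite lt_neqAle f0 andbT eq_sym; apply/eqP.
Qed.

End PlaceTheory.

(** The polynomial splits into linear factors, and a product can be in the maximal
    ideal only if a factor is; thus the residue of f at the place is a constant. *)
Lemma place_root (K : closedFieldType) (Q : {poly {poly K}}) (L : function_field Q)
    (v : L -> int) (p : {poly K}) (f : L) :
  is_place v -> p != 0 -> vge0 v f -> vgt0 v (map_poly (ff_const L) p).[f] ->
  exists2 r, root p r & vgt0 v (f - ff_const L r).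
Proof.
move=> pv p0 f0; have [s pE] := closed_field_poly_normal p.
have {p0} l0 : lead_coef p != 0 by rewrite lead_coef_eq0.
move: (lead_coef p) l0 pE => l l0 ->; rewrite map_polyZ hornerZ => H.
have {}H : vgt0 v (map_poly (ff_const L) (\prod_(z <- s) ('X - z%:P))).[f].
  have -> : (map_poly (ff_const L) (\prod_(z <- s) ('X - z%:P))).[f] =
     ff_const L l * (map_poly (ff_const L) (\prod_(z <- s) ('X - z%:P))).[f] * ff_const L l^-1.
    by rewrite mulrAC -rmorphM mulfV// rmorph1 mul1r.
  by apply: (vgt0M pv) => //; exact: vge0C.
suff [r rs rf] : exists2 r, r \in s & vgt0 v (f - ff_const L r).
  by exists r => //; rewrite rootZ ?root_prod_XsubC//.
elim: s H => [|z s IH]; rewrite ?big_nil ?big_cons.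
  by rewrite rmorph1 hornerC => /(_ (oner_neq0 _)); rewrite (place1 pv).
rewrite rmorphM hornerM rmorphB /= map_polyX map_polyC !hornerE /= => H.
have [fz|fz] := pselect (vgt0 v (f - ff_const L z)); first by exists z; rewrite ?mem_head.
suff /IH[r rs rf] : vgt0 v (map_poly (ff_const L) (\prod_(z <- s) ('X - z%:P))).[f].
  by exists r => //; rewrite inE rs orbT.
have fz0 : f - ff_const L z != 0 by apply/eqP => fz0; apply: fz; rewrite /vgt0 fz0 eqxx.
move=> g0; have := H (mulf_neq0 fz0 g0); rewrite (placeM pv)// (place_eq0 fz0) ?add0r//.
by apply: (vge0D pv) => //; apply: (vge0N pv); exact: vge0C.
Qed.

(** c has five distinct fifth roots, too many for a polynomial of degree at most 4. *)
Lemma fifth_roots_poly (K : closedFieldType) (c : K) (q : {poly K}) :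
  5%:R != 0 :> K -> c != 0 -> (size q <= 5)%N ->
  (forall b, b ^+ 5 = c -> q.[b] = 0) -> q = 0.
Proof.
move=> n5 c0 sq H; pose p : {poly K} := 'X^5 - c%:P.
have mp : p \is monic by rewrite monicXnsubC.
have [s pE] := closed_field_poly_normal p.
rewrite (monicP mp) scale1r in pE.
have us : uniq s.
  rewrite -separable_prod_XsubC -pE separable_poly.unlock; apply/Bezout_eq1_coprimepP.
  exists (- (c^-1)%:P, (c^-1 / 5%:R) *: 'X) => /=.
  rewrite /p derivB derivXn derivC subr0 /= -scaler_nat -scalerAr -scalerAl scalerA.
  rewrite -exprS mulrCA mulfV// mulr1 -mul_polyC mulrBr !mulNr opprK.
  by rewrite -polyCM mulVf// addrAC addNr add0r.
have ss : size s = 5%N.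
  by have := congr1 (fun r : {poly K} => size r) pE; rewrite size_prod_XsubC /p size_XnsubC// => -[].
apply/eqP; apply: contraTT sq => q0; rewrite -ltnNge -ss; apply: max_poly_roots => //.
apply/allP => b; rewrite -root_prod_XsubC -pE /root !hornerE subr_eq0 => /eqP/H ->.
exact: eqxx.
Qed.

Lemma specialize_inner (K : fieldType) (a : K) (q : {poly {poly K}}) :
  exists2 s : {poly {poly K}}, (size s <= size q)%N &
    q = map_poly polyC (map_poly (horner_eval a) q) + ('X - a%:P)%:P * s.
Proof.
exists (\poly_(i < size q) ((q`_i - (q`_i).[a]%:P) %/ ('X - a%:P))); first exact: size_poly.
apply/polyP => i; rewrite coefD coef_map coef_map coefCM coef_poly /=.
case: ltnP => iq; last by rewrite nth_default// horner_evalE horner0 mulr0 addr0.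
rewrite [_ * (_ %/ _)]mulrC divpK; first by rewrite addrC subrK.
by rewrite dvdp_XsubCl /root !hornerE subrr.
Qed.

Section Evaluation.
Variables (K : closedFieldType) (L : fieldType) (iota : {rmorphism K -> L}) (X Y : L).
Local Notation A := {poly {poly K}}.

Definition pev : {rmorphism A -> L} :=
  horner_eval X \o (horner_eval Y%:P \o map_poly (map_poly iota)).

Lemma pevE q : pev q = eval_xy iota X Y q. Proof. by []. Qed.

Lemma evC p : pev p%:P = (map_poly iota p).[X].
Proof. by rewrite pevE /eval_xy map_polyC hornerC. Qed.

Lemma evCC c : pev c%:P%:P = iota c.
Proof. by rewrite evC map_polyC hornerC. Qed.

Lemma evY : pev 'X = Y.
Proof. by rewrite pevE /eval_xy map_polyX hornerX hornerC. Qed.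

Lemma evX : pev 'X%:P = X.
Proof. by rewrite evC map_polyX hornerX. Qed.

Lemma free_constant_neq0 (d : {poly K}) :
  (forall q : A, (size q <= 5)%N -> pev q = 0 -> q = 0) -> d != 0 -> pev d%:P != 0.
Proof.
move=> free; apply: contra_neq => /free; rewrite size_polyC => h.
by apply/polyC_inj/h; apply: leq_trans (leq_b1 _) _.
Qed.

End Evaluation.

Section PointEvaluation.
Variables (K : fieldType) (a b : K).

Definition pe : {rmorphism {poly {poly K}} -> K} :=
  horner_eval a \o horner_eval b%:P.

Lemma peE q : pe q = q.[b%:P].[a]. Proof. by []. Qed.

Lemma peC p : pe p%:P = p.[a].
Proof. by rewrite peE hornerC. Qed.

Lemma peY : pe 'X = b.
Proof. by rewrite peE hornerX hornerC. Qed.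

Lemma pe_lift p : pe (map_poly polyC p) = p.[b].
Proof. by rewrite peE horner_map hornerC. Qed.

End PointEvaluation.

#[global] Opaque pev pe.

(** * The smooth affine curve Y^5 = P(X) and its differentials *)
Section Model.
Variables (K : closedFieldType) (Q : {poly {poly K}}) (L : function_field Q).
Variables (X Y : L) (P : {poly K}).
Local Notation iota := (ff_const L).
Local Notation A := {poly {poly K}}.
Local Notation ev := (pev (ff_const L) X Y).

(** L has the basis 1, Y, ..., Y^4 over K(X), and Y^5 = P(X) with P separable.  All
    that follows applies twice, to (X, Y) and to (1 / X, - Y / X). *)
Hypothesis five_neq0 : 5%:R != 0 :> K.
Hypothesis curveY : Y ^+ 5 = ev P%:P.
Hypothesis free_powers : forall q : A, (size q <= 5)%N -> ev q = 0 -> q = 0.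
Hypothesis denominators : forall f : L, exists (q : A) (d : {poly K}),
  [/\ d != 0, (size q <= 5)%N & f * ev d%:P = ev q].
Hypothesis P_separable : forall a, P.[a] = 0 -> P^`().[a] != 0.

Lemma evC_neq0 d : d != 0 -> ev d%:P != 0.
Proof. exact: free_constant_neq0. Qed.

Lemma inv_denominator f : f != 0 -> exists (q : A) (d : {poly K}),
  d != 0 /\ f * ev q = ev d%:P.
Proof.
move=> f0; have [q [d [d0 _ E]]] := denominators f^-1.
by exists q, d; rewrite -E mulVKf.
Qed.

Section Point.
Variables a b : K.
Hypothesis on_curve : b ^+ 5 = P.[a].

Lemma pe_ker q : ev q = 0 -> pe a b q = 0.
Proof.
pose m : A := 'X^5 - P%:P.
have mm : m \is monic by rewrite monicXnsubC.
have sm : size m = 6 by rewrite size_XnsubC.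
rewrite (Pdiv.RingMonic.rdivp_eq mm q) !rmorphD !rmorphM.
have -> : ev m = 0 by rewrite rmorphB rmorphXn evY curveY subrr.
have -> : pe a b m = 0 by rewrite rmorphB rmorphXn peY peC on_curve subrr.
rewrite !mulr0 !add0r => /free_powers->; rewrite ?rmorph0//.
by have := Pdiv.Ring.ltn_rmodp q m; rewrite sm ltnS => ->; exact: monic_neq0.
Qed.

(** Over a root a of P the coordinate Y is a parameter, since X - a is Y^5 over a
    value that is nonzero at a simple root.  Elsewhere X - a is a parameter, since
    (Y^5 - b^5) / (Y - b) is 5 b^4 at the point.  In both cases the derivation
    Y^4 d/dX maps the parameter to a unit, given by t': the differential dX / Y^4
    has neither zero nor pole at the point. *)
Lemma local_parameter : exists t c u s k t',
  [/\ pe a b t = 0, pe a b c != 0 /\ pe a b u != 0,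
      (0 < k)%N /\ ev c * (X - iota a) = ev t ^+ k,
      ev u * (Y - iota b) = ev t * ev s
    & pe a b t' != 0 /\ forall D : L -> L, is_derivation D ->
      D X = Y ^+ 4 -> D Y = ev P^`()%:P / 5 -> D (ev t) = ev t'].
Proof.
have [P1 P1E] : exists p, P - P.[a]%:P = p * ('X - a%:P).
  by apply/factor_theorem; rewrite /root !hornerE subrr.
have XE : ev ('X - a%:P)%:P = X - iota a.
  by rewrite polyCB rmorphB evX evCC.
have PE : ev P1%:P * (X - iota a) = Y ^+ 5 - iota b ^+ 5.
  rewrite curveY -XE -rmorphM -polyCM -P1E polyCB rmorphB evCC -on_curve.
  by rewrite rmorphXn.
have [b0|b0] := eqVneq b 0.
  exists 'X, P1%:P, 1, 1, 5%N, ((5%:R^-1 *: P^`())%:P); rewrite peY !rmorph1 oner_eq0.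
  rewrite !peC hornerZ evY b0 rmorph0 subr0 mulr1 mul1r.
  have Pa : P.[a] = 0 by rewrite -on_curve b0 expr0n.
  split=> //.
  - split=> //; have : (P - P.[a]%:P)^`().[a] = P1.[a].
      by rewrite P1E derivM derivXsubC mulr1 !hornerE subrr mulr0 add0r.
    by rewrite derivB derivC subr0 => <-; exact: P_separable.
  - by split=> //; rewrite PE b0 rmorph0 expr0n subr0.
  - split; first by rewrite mulf_neq0 ?invr_neq0 ?P_separable.
    move=> D _ _ ->; rewrite -mul_polyC polyCM rmorphM evCC fmorphV rmorph_nat.
    by rewrite mulrC.
exists ('X - a%:P)%:P, 1, ('X^4 + b%:P%:P * 'X^3 + b%:P%:P^+2 * 'X^2 + b%:P%:P ^+ 3 * 'X + b%:P%:P ^+ 4), P1%:P, 1%N, ('X^4).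
split.
- by rewrite peC !hornerE subrr.
- rewrite rmorph1 oner_eq0; split=> //.
  rewrite !(rmorphXn, rmorphD, rmorphM) peY !peC hornerC.
  suff -> : b ^+ 4 + b * b ^+ 3 + b ^+ 2 * b ^+ 2 + b ^+ 3 * b + b ^+ 4 = 5%:R * b ^+ 4.
    by rewrite mulf_neq0 ?expf_neq0.
  ring.
- by rewrite rmorph1 mul1r expr1 XE.
- rewrite XE [RHS]mulrC PE !(rmorphXn, rmorphD, rmorphM)/= evY evCC.
  ring.
- rewrite rmorphXn peY expf_neq0//; split=> // D [DD _ DC] DX _.
  by rewrite XE DD -rmorphN DC addr0 DX rmorphXn evY.
Qed.

Lemma pe_ideal q : exists q1 q2,
  ev q = iota (pe a b q) + ev q1 * (Y - iota b) + ev q2 * (X - iota a).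
Proof.
have [q1 E1] : exists p, q - q.[b%:P]%:P = p * ('X - b%:P%:P).
  by apply/factor_theorem; rewrite /root !hornerE subrr.
have [q2 E2] : exists p, q.[b%:P] - q.[b%:P].[a]%:P = p * ('X - a%:P).
  by apply/factor_theorem; rewrite /root !hornerE subrr.
exists q1, q2%:P.
have E : q = q.[b%:P].[a]%:P%:P + q1 * ('X - b%:P%:P) + q2%:P * ('X - a%:P)%:P.
  by rewrite -polyCM -E2 -E1 polyCB; ring.
by rewrite {1}E ![ev (_ + _)]rmorphD ![ev (_ * _)]rmorphM polyCB ![ev (_ - _)]rmorphB !evCC evY evX.
Qed.

(** The two requirements of the order of vanishing.  Divisibility by t follows as the
    ideal of the point is generated by X - a and Y - b, both multiples of t.  For
    the bound, q divides a polynomial d in X alone, and d vanishes at a to a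
    finite order. *)
Lemma point_order_hyps : exists t t',
  [/\ ev t != 0 /\ pe a b t = 0,
      forall q, pe a b q = 0 -> exists u q', pe a b u != 0 /\ ev u * ev q = ev t * ev q',
      forall q, ev q != 0 -> exists M : nat,
        forall n u q', pe a b u != 0 -> ev u * ev q = ev t ^+ n * ev q' -> (n <= M)%N
    & pe a b t' != 0 /\ forall D : L -> L, is_derivation D ->
      D X = Y ^+ 4 -> D Y = ev P^`()%:P / 5 -> D (ev t) = ev t'].
Proof.
have [t [c [u [s [k [t' [t0 [c0 u0] [k0 cE] uE [t'0 DE]]]]]]]] := local_parameter.
have Xa : X - iota a != 0.
  have -> : X - iota a = ev ('X - a%:P)%:P by rewrite polyCB rmorphB evX evCC.
  by rewrite evC_neq0 ?polyXsubC_eq0.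
have un q : pe a b q != 0 -> ev q != 0 by apply: contra => /eqP/pe_ker ->.
have tn : ev t != 0.
  apply: contra_neq (mulf_neq0 (un _ c0) Xa) => t00.
  by rewrite cE t00 expr0n eqn0Ngt k0.
exists t, t'; split=> //.
- move=> q q0; have [q1 [q2]] := pe_ideal q; rewrite q0 rmorph0 add0r => E.
  exists (u * c), (c * s * q1 + u * t ^+ k.-1 * q2); rewrite rmorphM mulf_neq0//; split=> //.
  rewrite E !(rmorphXn, rmorphD, rmorphM) /= mulrDr.
  have -> : ev u * ev c * (ev q1 * (Y - iota b)) = ev c * ev q1 * (ev u * (Y - iota b)) by ring.
  have -> : ev u * ev c * (ev q2 * (X - iota a)) = ev u * ev q2 * (ev c * (X - iota a)) by ring.
  by rewrite uE cE -{1}(prednK k0) exprS; ring.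
- move=> q /inv_denominator[q' [d [d0 dE]]].
  have [m [d1 /implyP/(_ d0) d1a d1E]] := multiplicity_XsubC d a.
  exists (k * m)%N => n u' q'' u'0 E; rewrite leqNgt; apply/negP => lt.
  have H : ev (u' * d1%:P) = ev (t ^+ (n - k * m) * q'' * q' * c ^+ m).
    apply: (mulfI (expf_neq0 (k * m) tn)).
    rewrite !(rmorphM, rmorphXn)/= [in RHS]mulrA [in RHS]mulrA [in RHS]mulrA.
    rewrite -exprD subnKC ?(ltnW lt)// -E {1}exprM -cE exprMn.
    have -> : ev u' * ev q * ev q' * ev c ^+ m = ev u' * (ev q * ev q') * ev c ^+ m by ring.
    rewrite dE d1E polyCM rmorphM rmorphXn /= polyCB rmorphXn !rmorphB evX evCC; ring.
  move/eqP: H; rewrite -subr_eq0 -rmorphB => /eqP/pe_ker/eqP.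
  rewrite rmorphB !rmorphM rmorphXn t0 expr0n subn_eq0 leqNgt lt/= !mul0r subr0.
  by rewrite mulf_eq0 (negbTE u'0)/= peC -[_ == 0]/(root d1 a) (negbTE d1a).
Qed.

Section Center.
Variable v : L -> int.
Hypotheses (pv : is_place v) (X0 : vge0 v X).
Hypotheses (vX : vgt0 v (X - iota a)) (vY : vgt0 v (Y - iota b)).

Lemma center_Y : vge0 v Y.
Proof.
rewrite -(subrK (iota b) Y); apply: (vge0D pv); last exact: vge0C.
exact: vgt0W.
Qed.

Lemma center_ev_ge0 q : vge0 v (ev q).
Proof.
elim/poly_ind: q => [|q c IH]; first by rewrite rmorph0 /vge0 eqxx.
rewrite rmorphD rmorphM evY; apply: (vge0D pv).
  by apply: (vge0M pv) => //; exact: center_Y.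
rewrite evC; apply: (vge0_horner pv X0) => i; rewrite coef_map.
exact: (vge0C pv).
Qed.

Lemma center_ev_gt0 q : pe a b q = 0 -> vgt0 v (ev q).
Proof.
have [q1 [q2 ->]] := pe_ideal q => ->; rewrite rmorph0 add0r.
by apply: (vgt0D pv); rewrite mulrC; apply: (vgt0M pv) => //; exact: center_ev_ge0.
Qed.

(** The evaluation at the point is the residue map of v on polynomials: the constant
    pe a b q differs from ev q by an element of the maximal ideal. *)
Lemma center_unit q : pe a b q != 0 -> v (ev q) = 0.
Proof.
move=> q0; apply: place_eq0.
- by apply: contraNneq q0 => /pe_ker ->.
- exact: center_ev_ge0.
move=> qgt; move: q0; suff /(vgt0C pv) -> : vgt0 v (iota (pe a b q)) by rewrite eqxx.
have -> : iota (pe a b q) = ev q - ev (q - (pe a b q)%:P%:P).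
  by rewrite rmorphB evCC opprB addrC subrK.
apply: (vgt0D pv) => //; apply: (vgt0N pv); apply: center_ev_gt0.
by rewrite rmorphB peC hornerC subrr.
Qed.

End Center.

End Point.

Lemma frac_ev f : exists q d, ev d != 0 /\ f = ev q / ev d.
Proof.
have [q [d [d0 _ E]]] := denominators f; exists q, d%:P.
by rewrite evC_neq0//; split=> //; rewrite -E mulfK// evC_neq0.
Qed.

Lemma place_ev_ge0 v : is_place v -> vge0 v X -> forall q, vge0 v (ev q).
Proof.
move=> pv X0 q; have PX p : vge0 v (ev p%:P).
  by rewrite evC; apply: (vge0_horner pv X0) => i; rewrite coef_map; exact: (vge0C pv).
have Y0 : vge0 v Y.
  move=> Yn; have := PX P; rewrite -curveY /vge0 => /(_ (expf_neq0 5 Yn)).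
  by rewrite (placeX pv)// pmulrn_lge0.
elim/poly_ind: q => [|q c IH]; first by rewrite rmorph0 /vge0 eqxx.
by rewrite rmorphD rmorphM evY; apply: (vge0D pv) => //; exact: (vge0M pv).
Qed.

(** A place at which X has no pole is centered at a point of the curve.  A function t
    with v t = 1 divides a polynomial in X up to functions without pole, so some
    nonzero polynomial in X is in the maximal ideal and X has a residue a; the
    residue of Y is then a fifth root of P(a). *)
Lemma place_center v : is_place v -> vge0 v X ->
  exists a b, [/\ b ^+ 5 = P.[a], vgt0 v (X - iota a) & vgt0 v (Y - iota b)].
Proof.
move=> pv X0; have evq q : vge0 v (ev q) by exact: place_ev_ge0.
have Y0 : vge0 v Y by rewrite -(evY iota X Y).
have [a Xa] : exists a, vgt0 v (X - iota a).
  have [t t0 vt] : exists2 t, t != 0 & v t = 1 by case: pv.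
  have [q [d [d0 _ E]]] := denominators t.
  have dn := evC_neq0 d0.
  have qn : ev q != 0 by rewrite -E mulf_neq0.
  have [p [e [e0 E']]] := inv_denominator qn.
  have en := evC_neq0 e0.
  have pn : ev p != 0 by apply: contraNneq en => pn; rewrite -E' pn mulr0.
  have [|a _ Xa] := @place_root _ _ _ v e X pv e0 X0; last by exists a.
  rewrite -(evC iota X Y) -E' -E => _; rewrite !(placeM pv) ?mulf_neq0// vt.
  by rewrite -addrA ltr_pwDl ?addr_ge0//; [exact: evq | exact: evq].
have Ya : vgt0 v (map_poly iota ('X^5 - P.[a]%:P)).[Y].
  rewrite rmorphB /= map_polyXn map_polyC !hornerE /= curveY.
  have [p pE] : exists p, P - P.[a]%:P = p * ('X - a%:P).
    by apply/factor_theorem; rewrite /root !hornerE subrr.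
  have -> : ev P%:P - iota P.[a] = (X - iota a) * ev p%:P.
    have <- : ev ('X - a%:P)%:P = X - iota a by rewrite polyCB rmorphB evX evCC.
    rewrite -(evCC iota X Y) -rmorphB -rmorphM; congr (ev _).
    by rewrite -polyCB pE polyCM mulrC.
  by apply: (vgt0M pv).
have [|b] := @place_root _ _ _ v ('X^5 - P.[a]%:P) Y pv _ Y0 Ya.
  by rewrite monic_neq0// monicXnsubC.
by rewrite /root !hornerE subr_eq0 => /eqP bE Yb; exists a, b.
Qed.

(** The affine curve is normal: a function in the local rings of all its points is
    a polynomial in the coordinates.  Write f = q / d with d in K[X] and
    let a be a root of d.  If P(a) != 0 there are five points over a,
    and q(a, Y), of degree at most 4, vanishes at all of them.  If P(a) = 0 there
    is one point over a, where Y has order 1 and X - a has order 5; a nonzero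
    q(a, Y) would have order less than 5 there.  In both cases X - a divides q and
    can be cancelled. *)
Lemma local_global f :
  (forall a b, b ^+ 5 = P.[a] -> exists q u, pe a b u != 0 /\ f * ev u = ev q) ->
  exists2 q : A, (size q <= 5)%N & f = ev q.
Proof.
move=> loc; have [q [d [d0 sq E]]] := denominators f.
have Yn : Y != 0.
  rewrite -(evY iota X Y); apply/eqP => /free_powers; rewrite size_polyX => /(_ isT)/eqP.
  by rewrite polyX_eq0.
have [n] := ubnP (size d); elim: n => // n IH in q d d0 sq E *; rewrite ltnS => dn.
have [d1|d1] := leqP (size d) 1.
  have dc := size1_polyC d1; have c0 : d`_0 != 0 by rewrite -polyC_eq0 -dc.
  exists (q * (d`_0)^-1%:P%:P); first by rewrite mulrC mul_polyC (leq_trans (size_scale_leq _ _)).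
  by rewrite rmorphM -E dc evCC coefC/= evCC fmorphV mulfK// fmorph_eq0.
have [a] := closed_rootP d (negbT (gtn_eqF d1)); move=> /factor_theorem[d' dE].
have XE : ev ('X - a%:P)%:P = X - iota a by rewrite polyCB rmorphB evX evCC.
have Xn : X - iota a != 0 by rewrite -XE evC_neq0// polyXsubC_eq0.
have [s ss qE] := specialize_inner a q.
set q0 := map_poly (horner_eval a) q in qE.
have q0E b : pe a b q = q0.[b].
  by rewrite qE rmorphD rmorphM peC pe_lift !hornerE subrr mul0r addr0.
suff q00 : q0 = 0.
  move: qE; rewrite q00 rmorph0 add0r => qE.
  apply: (IH s d').
  - by apply: contraNneq d0 => d'0; rewrite dE d'0 mul0r.
  - exact: leq_trans ss sq.
  - by apply: (mulIf Xn); rewrite -{1}XE -mulrA -rmorphM -polyCM -dE E qE rmorphM XE mulrC.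
  - apply: leq_trans dn.
    rewrite dE size_Mmonic ?monicXsubC ?size_XsubC ?addn2//.
    by apply: contraNneq d0 => d'0; rewrite dE d'0 mul0r.
have sq0 : (size q0 <= 5)%N by apply: leq_trans (size_poly _ _) sq.
have [Pa|Pa] := eqVneq P.[a] 0; last first.
  apply: (fifth_roots_poly five_neq0 Pa sq0) => b oc; have [r [u [u0 uE]]] := loc a b oc.
  apply: (mulIf u0); rewrite -q0E mul0r -rmorphM.
  have : ev (q * u - d%:P * r) = 0 by rewrite rmorphB !rmorphM -E -uE; ring.
  move=> /(pe_ker oc)/eqP; rewrite rmorphB subr_eq0 => /eqP ->.
  by rewrite rmorphM peC dE !hornerE subrr mulr0 mul0r.
have oc : 0 ^+ 5 = P.[a] by rewrite Pa expr0n.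
have [r [u [u0 uE]]] := loc a 0 oc.
have [P1 P1E] : exists p, P = p * ('X - a%:P) by apply/factor_theorem/rootP.
have P1a : P1.[a] != 0.
  by have := P_separable Pa; rewrite P1E derivM derivXsubC mulr1 !hornerE subrr mulr0 add0r.
apply/eqP/negPn/negP => q00.
have [i [g /implyP/(_ q00) g0 gE]] := multiplicity_XsubC q0 0.
rewrite subr0 in gE.
have i5 : (i < 5)%N.
  have gn : g != 0 by apply: contraNneq g0 => ->; rewrite root0.
  by apply: leq_trans sq0; rewrite gE size_mulXn// -addn1 leq_add2l size_poly_gt0.
pose g' := map_poly polyC g : A.
have H : ev (u * P1%:P * g' - 'X^(5 - i) * (d'%:P * r - u * s)) = 0.
  apply: (mulfI (expf_neq0 i Yn)); rewrite mulr0 rmorphB mulrBr.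
  rewrite ![ev (_ * _)]rmorphM rmorphXn evY [X in _ - X]mulrA -exprD subnKC ?(ltnW i5)//.
  have qE' : ev q = Y ^+ i * ev g' + (X - iota a) * ev s.
    have gE' : map_poly polyC q0 = g' * 'X^i by rewrite gE rmorphM /= map_polyXn.
    rewrite {1}qE gE' rmorphD [ev (g' * _)]rmorphM [ev (_%:P * _)]rmorphM XE.
    by rewrite rmorphXn evY mulrC.
  have YE : Y ^+ 5 = ev P1%:P * (X - iota a) by rewrite curveY P1E polyCM rmorphM XE.
  rewrite YE rmorphB !rmorphM -uE.
  have EE : f * ev d'%:P * (X - iota a) = Y ^+ i * ev g' + (X - iota a) * ev s.
    by rewrite -qE' -E dE polyCM rmorphM XE mulrA.
  transitivity (ev u * ev P1%:P * (Y ^+ i * ev g' + (X - iota a) * ev s - f * ev d'%:P * (X - iota a))).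
    ring.
  by rewrite EE subrr mulr0.
(* q(a, Y) is Y^i g with g a unit and i < 5, which contradicts f = q / d, as X - a
   is Y^5 up to a unit. *)
move: H => /(pe_ker oc)/eqP; rewrite rmorphB !rmorphM rmorphXn peY.
rewrite expr0n subn_eq0 leqNgt i5 mul0r subr0 peC pe_lift !mulf_eq0.
by rewrite (negbTE u0) (negbTE P1a) -[_ == 0]/(root g 0) (negbTE g0).
Qed.

Variable D : L -> L.
Hypotheses (dD : is_derivation D) (DX : D X = Y ^+ 4) (DY : D Y = ev P^`()%:P / 5).

(** The center of v is a smooth point, where v is the order of vanishing; its local
    parameter has a derivative that is a unit there. *)
Lemma place_parameter v : is_place v -> vge0 v X ->
  exists t, [/\ t != 0, v t = 1, D t != 0 & v (D t) = 0].
Proof.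
move=> pv X0; have [a [b [oc Xa Yb]]] := place_center pv X0.
have [t [t' [[t0 et] div bound [et' Dt]]]] := point_order_hyps oc.
exists (ev t); rewrite Dt//; split=> //.
- apply: (place_uniformizer (pe_ker oc) frac_ev t0 div bound) => //.
  + exact: placeM.
  + exact: (center_unit oc pv X0 Xa Yb).
  + exact: (center_ev_gt0 pv X0 Xa Yb et t0).
  + by case: pv.
- by apply: contraNneq et' => /(pe_ker oc) ->.
- exact: (center_unit oc pv X0 Xa Yb).
Qed.

Lemma D_ev q : exists q', D (ev q) = ev q'.
Proof.
have [DA DM DC] := dD.
have D0 : D 0 = 0 by have := DA 0 0; rewrite addr0 => /eqP; rewrite eq_sym -subr_eq0 addrK => /eqP.
have DP p : exists q', D (ev p%:P) = ev q'.
  elim/poly_ind: p => [|p c [p' E]]; first by exists 0; rewrite !rmorph0.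
  exists (p' * 'X%:P + p%:P * 'X^4).
  rewrite polyCD polyCM rmorphD rmorphM evX evCC DA DC addr0 DM E DX.
  by rewrite rmorphD !(rmorphXn, rmorphM) evX evY.
elim/poly_ind: q => [|q c [q' E]]; first by exists 0; rewrite !rmorph0.
have [c' E'] := DP c.
exists (q' * 'X + q * (5^-1 *: P^`())%:P + c').
rewrite rmorphD DA E' rmorphD; congr (_ + _).
rewrite rmorphM evY DM E DY -mul_polyC polyCM rmorphD !rmorphM evY evCC fmorphV rmorph_nat.
by rewrite [_^-1 * _]mulrC.
Qed.

(** The derivation D maps polynomials to polynomials, hence the local ring of the
    point to itself, so f = h * D s lies in this ring with h and s. *)
Lemma regular_local f a b : b ^+ 5 = P.[a] -> regular_differential D f ->
  exists q u, pe a b u != 0 /\ f * ev u = ev q.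
Proof.
move=> oc; have [t [t' [[t0 et] div bound [et' Dt]]]] := point_order_hyps oc.
have kev := pe_ker oc.
pose v := point_ord ev (pe a b) t.
have pv : is_place v.
  split.
  - exact: (point_ordM kev frac_ev et t0 div bound).
  - exact: (point_ordD kev frac_ev et t0 div bound).
  - move=> c c0; apply: (point_ordE kev frac_ev et t0 div bound).
    by rewrite -(evCC iota X Y); apply: ord_unit; rewrite peC hornerC.
  - exists (ev t) => //; apply: (point_ordE kev frac_ev et t0 div bound); exact: ord_t.
move=> /(_ v pv)[s [h [s0 vs hv ->]]].
have [h0|h0] := eqVneq h 0.
  by exists 0, 1; rewrite !rmorph1 rmorph0 h0 mul0r mul0r oner_eq0.
have loc := point_ord_local kev frac_ev t0 div bound.
have [|q [u [u0 E]]] := loc s s0; first by rewrite -/v vs.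
have [q' [u' [u0' E']]] := loc h h0 (hv h0).
have [q1 D1] := D_ev q; have [u1 D2] := D_ev u.
exists (q' * (q1 * u - q * u1)), (u' * u ^+ 2).
rewrite !(rmorphXn, rmorphM) mulf_neq0 ?expf_neq0//; split=> //.
have [_ DM _] := dD.
have := DM s (ev u); rewrite E D1 D2 => D3.
by rewrite rmorphB !rmorphM -E' D3 -E; ring.
Qed.

End Model.

Local Notation "x %:F" := (@FracField.tofrac _ x).

(** * The field of fractions of the quintic curve *)

Lemma fraction_numden (R : idomainType) (c : {fraction R}) :
  exists r s : R, s != 0 /\ c = r%:F / s%:F.
Proof.
elim/quotW: c => f; exists (frac f).1, (frac f).2; split; first exact: denom_ratioP.
apply: (canRL (mulfK _)); first by rewrite tofrac_eq0 denom_ratioP.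
unlock FracField.tofrac; rewrite -[LHS]FracField.pi_mul.
apply/eqmodP; rewrite /= FracField.equivfE /FracField.mulf.
by rewrite !numden_Ratio ?mulf_neq0 ?oner_neq0 ?denom_ratioP// !mulr1 mulrC.
Qed.

(** By Cayley-Hamilton A ^ k is the scalar matrix a; take determinants. *)
Lemma det_root_pow (F : fieldType) (n : nat) (A : 'M[F]_n.+1) (a : F) (k : nat) :
  char_poly A %| 'X^k - a%:P -> (\det A) ^+ k = a ^+ n.+1.
Proof.
case/dvdpP=> q qE; have : horner_mx A ('X^k - a%:P) = 0.
  by rewrite qE rmorphM /= Cayley_Hamilton mulr0.
rewrite rmorphB rmorphXn /= horner_mx_X horner_mx_C => /eqP; rewrite subr_eq0 => /eqP AE.
have detX j : \det (A ^+ j) = \det A ^+ j.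
  by elim: j => [|j IH]; rewrite ?expr0 ?det1// !exprS -mulmxE det_mulmx IH.
by rewrite -detX AE det_scalar.
Qed.

Lemma companion_exists (F : fieldType) (h : {poly F}) (n : nat) :
  h \is monic -> size h = n.+2 -> exists A : 'M[F]_n.+1, char_poly A = h.
Proof.
move=> hm sh; move: (companionmx h) (companionmxK hm); rewrite sh => A AE.
by exists A.
Qed.

(** The number c is, up to sign, the constant term of the monic factor, that is the
    product of its roots, and each root is a k-th root of a.  Taking the
    determinant of the companion matrix avoids a splitting field. *)
Lemma factor_power (F : fieldType) (a : F) (k : nat) (q : {poly F}) :
  (0 < k)%N -> q %| 'X^k - a%:P -> size q != 1%N ->
  exists c n, size q = n.+2 /\ c ^+ k = a ^+ n.+1.
Proof.
move=> k0 qp sq.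
have q0 : q != 0.
  by apply: contraTneq qp => ->; rewrite dvd0p monic_neq0// monicXnsubC.
have l0 : lead_coef q != 0 by rewrite lead_coef_eq0.
have qh : (lead_coef q)^-1 *: q %= q by apply: eqp_scale; rewrite invr_eq0.
have hm : (lead_coef q)^-1 *: q \is monic by rewrite monicE lead_coefZ mulVf.
have [n sn] : exists n, size q = n.+2.
  by move: sq; rewrite -size_poly_eq0 in q0; case: (size q) q0 => // -[|n]// _ _; exists n.
have [A AE] := companion_exists hm (etrans (eqp_size qh) sn).
exists (\det A), n; split=> //; apply: det_root_pow.
by rewrite AE (eqp_dvdl _ qh).
Qed.

(** A factor of degree d of T^5 - w would give, through the determinant of its
    companion matrix, a fifth power equal to w^d; the order of vanishing at the
    simple root of w excludes 0 < d < 5. *)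
Lemma irreducible_quintic (K : fieldType) (w : {poly K}) (a : K) :
  root w a -> ~~ root w^`() a ->
  irreducible_poly ('X^5 - w%:F%:P : {poly {fraction {poly K}}}).
Proof.
move=> wa dwa; have w0 : w != 0 by apply: contraNneq dwa => ->; rewrite deriv0 root0.
have mw : mup a w = 1%N.
  have /factor_theorem[q wE] := wa.
  rewrite wE mupMr; first by rewrite -['X - _]expr1 mup_XsubCX eqxx.
  apply: contra dwa; rewrite /root wE derivM derivXsubC mulr1 !hornerE subrr mulr0 add0r.
  by [].
have mwX k : mup a (w ^+ k) = k.
  elim: k => [|k IH]; first by rewrite expr0 mupNroot// root1.
  by rewrite exprS mupM ?expf_neq0// mw IH.
have mX k (p : {poly K}) : p != 0 -> mup a (p ^+ k) = (k * mup a p)%N.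
  move=> p0; elim: k => [|k IH]; first by rewrite expr0 mupNroot// root1.
  by rewrite exprS mupM ?expf_neq0// IH mulSn.
set p := 'X^5 - _; have sp : size p = 6 by rewrite size_XnsubC.
have mp : p \is monic by rewrite monicXnsubC.
split; first by rewrite sp.
move=> q sq qp.
have [] := factor_power _ qp sq => // c [n [sn]].
have [r [s [s0 ->]]] := fraction_numden c.
rewrite expr_div_n => /(canRL (divfK _)); rewrite expf_neq0 ?tofrac_eq0// => /(_ isT).
rewrite -!rmorphXn -rmorphM => /eqP; rewrite -subr_eq0 -rmorphB tofrac_eq0 subr_eq0 => /eqP E.
have r0 : r != 0.
  apply: contraNneq (mulf_neq0 (expf_neq0 n.+1 w0) (expf_neq0 5 s0)) => r0.
  by rewrite -E r0 expr0n.
have := congr1 (mup a) E; rewrite mX// (mupM a (expf_neq0 _ w0) (expf_neq0 _ s0)) mwX mX// => H.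
rewrite -(dvdp_size_eqp qp) sp sn.
have := dvdp_leq (monic_neq0 mp) qp; rewrite sp => le.
by apply/eqP; move: H le; rewrite sn; lia.
Qed.

Lemma pev_emb (K : closedFieldType) (L : fieldType) (emb : {rmorphism {poly K} -> L})
    (iota : {rmorphism K -> L}) (z : L) (q : {poly {poly K}}) :
  (forall c, iota c = emb c%:P) -> pev iota (emb 'X) z q = (map_poly emb q).[z].
Proof.
move=> iE; have embE (p : {poly K}) : (map_poly iota p).[emb 'X] = emb p.
  elim/poly_ind: p => [|p c IH]; first by rewrite !rmorph0 horner0.
  by rewrite !rmorphD !rmorphM /= map_polyX map_polyC !hornerE IH /= iE.
elim/poly_ind: q => [|q c IH]; first by rewrite !rmorph0 horner0.
by rewrite !rmorphD !rmorphM /= evY evC map_polyX map_polyC !hornerE IH embE.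
Qed.

Lemma common_denominator (R : idomainType) (F : fieldType) (tf : {rmorphism R -> F})
    (r : {poly F}) :
  (forall c, exists a b, tf b != 0 /\ c = tf a / tf b) ->
  exists2 d : R, tf d != 0 & exists q : {poly R}, map_poly tf q = (tf d)%:P * r.
Proof.
move=> numden; elim/poly_ind: r => [|r c [d d0 [q qE]]].
  by exists 1; [rewrite rmorph1 oner_neq0 | exists 0; rewrite rmorph0 mulr0].
have [a [b [b0 ->]]] := numden c; exists (d * b); first by rewrite rmorphM mulf_neq0.
exists (b%:P * q * 'X + (d * a)%:P).
rewrite rmorphD !(rmorphM (map_poly tf)) /= map_polyX !map_polyC /= qE mulrDr.
rewrite (rmorphM tf d b) polyCM; congr (_ + _); first by ring.
by rewrite -!polyCM rmorphM; congr (_%:P); field.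
Qed.

Lemma size_map_tofrac (R : idomainType) (q : {poly R}) :
  size (map_poly (@FracField.tofrac R) q) = size q.
Proof. by apply: size_map_inj_poly; [move=> x y /eqP; rewrite tofrac_eq => /eqP|exact: tofrac0]. Qed.

Lemma root_irreducible (F : fieldType) (L : fieldExtType F) (p r : {poly F}) (z : L) :
  irreducible_poly p -> root (map_poly (in_alg L) p) z ->
  root (map_poly (in_alg L) r) z -> p %| r.
Proof.
move=> [_ irr] pz rz; have gz : root (map_poly (in_alg L) (gcdp p r)) z.
  by rewrite gcdp_map root_gcd pz.
have := irr (gcdp p r); rewrite dvdp_gcdl => H.
rewrite -(eqp_dvdl _ (H _ isT)) ?dvdp_gcdr//.
apply: contraTneq gz => /eqP/size_poly1P[c c0 ->].
by rewrite map_polyC rootC fmorph_eq0.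
Qed.

(** The field K(X)[T] / (T^5 - w).  Its elements are polynomials in T of degree at most
    4 over K(X), whence the three properties on which the study of the curve
    rests. *)
Lemma quintic_field (K : closedFieldType) (w : {poly K}) (a : K) :
  root w a -> ~~ root w^`() a ->
  exists (L : fieldType) (iota : {rmorphism K -> L}) (X Y : L),
  [/\ Y ^+ 5 = pev iota X Y w%:P,
      forall q : {poly {poly K}}, (size q <= 5)%N -> pev iota X Y q = 0 -> q = 0
    & forall f : L, exists (q : {poly {poly K}}) (d : {poly K}),
        [/\ d != 0, (size q <= 5)%N & f * pev iota X Y d%:P = pev iota X Y q]].
Proof.
move=> wa dwa; have irr := irreducible_quintic wa dwa.
have [L _ [z rz zfull]] := irredp_FAdjoin irr.
move: irr rz; set p := 'X^5 - _ => irr rz.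
have mp : p \is monic by rewrite monicXnsubC.
have sp : size p = 6 by rewrite size_XnsubC.
pose emb : {rmorphism {poly K} -> L} := in_alg L \o @FracField.tofrac {poly K}.
pose iota : {rmorphism K -> L} := emb \o polyC.
have evE q : pev iota (emb 'X) z q = (map_poly emb q).[z] by exact: pev_emb.
have embE q : map_poly emb q = map_poly (in_alg L) (map_poly (@FracField.tofrac _) q).
  by rewrite map_poly_comp.
exists L, iota, (emb 'X), z; split.
- rewrite evE map_polyC hornerC; move: rz; rewrite /root rmorphB/= map_polyXn map_polyC.
  by rewrite !hornerE subr_eq0 => /eqP.
- move=> q sq; rewrite evE embE => /eqP/(root_irreducible irr rz) pq.
  apply/eqP; rewrite -size_poly_leq0 -size_map_tofrac leqn0 size_poly_eq0.
  apply: contraTT sq => r0; rewrite -ltnNge -size_map_tofrac.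
  by have := dvdp_leq r0 pq; rewrite sp.
- move=> f; have : f \in <<1; z>>%VS by rewrite zfull memvf.
  case/Fadjoin1_polyP => r fE.
  have {}fE : f = (map_poly (in_alg L) (r %% p)).[z].
    rewrite fE {1}(divp_eq r p) rmorphD rmorphM hornerD hornerM.
    by rewrite (rootP rz) mulr0 add0r.
  have [|d d0 [q qE]] := @common_denominator _ _ (@FracField.tofrac {poly K}) (r %% p).
    by move=> c; have [u [v [v0 cE]]] := fraction_numden c; exists u, v; rewrite tofrac_eq0.
  rewrite tofrac_eq0 in d0.
  exists q, d; split=> //.
    have : (size (d%:F%:P * (r %% p))%R <= 5)%N.
      rewrite mul_polyC (leq_trans (size_scale_leq _ _))// -ltnS.
      by have := ltn_modp r p; rewrite sp monic_neq0.
    by rewrite -qE size_map_tofrac.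
  rewrite !evE !embE qE !map_polyC rmorphM /= map_polyC !hornerE fE mulrC.
  by [].
Qed.

(** * Derivations of the function field *)

(** The quotient rule forces D (q / e); it is independent of the fraction because d
    preserves the kernel of ev. *)
Lemma derivation_extension (A : comNzRingType) (L : fieldType) (ev : {rmorphism A -> L})
    (d : A -> A) :
  (forall p q, d (p + q) = d p + d q) ->
  (forall p q, d (p * q) = d p * q + p * d q) ->
  (forall q, ev q = 0 -> ev (d q) = 0) ->
  (forall f, exists q e, ev e != 0 /\ f = ev q / ev e) ->
  exists D : L -> L,
    [/\ forall f g, D (f + g) = D f + D g,
        forall f g, D (f * g) = D f * g + f * D g
      & forall q, D (ev q) = ev (d q)].
Proof.
move=> dD dM dker frac.
have [nd ndP] := choice (fun f => let: ex_intro q (ex_intro e h) := frac f in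
  ex_intro (fun qe : A * A => ev qe.2 != 0 /\ f = ev qe.1 / ev qe.2) (q, e) h).
pose D f := (ev (d (nd f).1) - f * ev (d (nd f).2)) / ev (nd f).2.
have d0 : d 0 = 0 by apply: (addrI (d 0)); rewrite -dD !addr0.
have dN q : d (- q) = - d q.
  by apply/eqP; rewrite -addr_eq0 -dD addNr d0.
have DE f q e : ev e != 0 -> f * ev e = ev q -> D f * ev e = ev (d q) - f * ev (d e).
  move=> e0 fE; rewrite /D; have [] := ndP f; move: (nd f) => [a b] /= b0 fb.
  have {fb} fb : f * ev b = ev a by rewrite fb divfK.
  have := dker (a * e - q * b); rewrite rmorphB !rmorphM -fE -fb mulrAC subrr => /(_ erefl).
  rewrite dD dN !dM rmorphB !rmorphD !rmorphM -fE -fb => E.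
  apply: (mulIf b0); rewrite mulrAC divfK//.
  by apply/eqP; rewrite -subr_eq0 -[X in _ == X]E; apply/eqP; ring.
exists D; split.
- move=> f g; have [f0 fE] := ndP f; have [g0 gE] := ndP g.
  move: f0 g0 fE gE; move: (nd f) (nd g) => [a b] [a' b'] /= b0 b0' fE gE.
  have fE' : f * ev b = ev a by rewrite fE divfK.
  have gE' : g * ev b' = ev a' by rewrite gE divfK.
  have bb : ev (b * b') != 0 by rewrite rmorphM mulf_neq0.
  apply: (mulIf bb); rewrite (@DE (f + g) (a * b' + a' * b))//; last first.
    by rewrite rmorphD !rmorphM -fE' -gE'; ring.
  have -> : (D f + D g) * ev (b * b') = D f * ev b * ev b' + D g * ev b' * ev b.
    by rewrite rmorphM; ring.
  rewrite (DE _ _ _ b0 fE') (DE _ _ _ b0' gE') dD !dM !rmorphD !rmorphM -fE' -gE'; ring.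
- move=> f g; have [f0 fE] := ndP f; have [g0 gE] := ndP g.
  move: f0 g0 fE gE; move: (nd f) (nd g) => [a b] [a' b'] /= b0 b0' fE gE.
  have fE' : f * ev b = ev a by rewrite fE divfK.
  have gE' : g * ev b' = ev a' by rewrite gE divfK.
  have bb : ev (b * b') != 0 by rewrite rmorphM mulf_neq0.
  apply: (mulIf bb); rewrite (@DE (f * g) (a * a'))//; last first.
    by rewrite !rmorphM -fE' -gE'; ring.
  rewrite !dM rmorphM mulrDl.
  have -> : D f * g * (ev b * ev b') = D f * ev b * (g * ev b') by ring.
  have -> : f * D g * (ev b * ev b') = D g * ev b' * (f * ev b) by ring.
  by rewrite (DE _ _ _ b0 fE') (DE _ _ _ b0' gE') !rmorphD !rmorphM -fE' -gE'; ring.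
- move=> q; have := DE (ev q) q 1; rewrite rmorph1 oner_eq0 !mulr1 => /(_ isT erefl) ->.
  have -> : d 1 = 0 by apply: (addrI (d 1)); rewrite addr0 -{3}[1]mulr1 dM mulr1 mul1r.
  by rewrite rmorph0 mulr0 subr0.
Qed.

Section QuinticDerivation.
Variables (K : closedFieldType) (L : fieldType) (iota : {rmorphism K -> L}) (X Y : L).
Variable w : {poly K}.
Local Notation A := {poly {poly K}}.
Local Notation ev := (pev iota X Y).
Hypothesis five_neq0 : 5%:R != 0 :> K.
Hypothesis curveY : Y ^+ 5 = ev w%:P.
Hypothesis free_powers : forall q : A, (size q <= 5)%N -> ev q = 0 -> q = 0.
Hypothesis denominators : forall f : L, exists (q : A) (d : {poly K}),
  [/\ d != 0, (size q <= 5)%N & f * ev d%:P = ev q].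

(** The derivation Y^4 d/dX on polynomials, in which Y' = w' / (5 Y^4) has been
    multiplied by Y^4 to stay in the ring. *)
Definition D0 (q : A) : A :=
  'X^4 * map_poly (@deriv K) q + (5%:R^-1 *: w^`())%:P * q^`().

Lemma map_derivM (p q : A) :
  map_poly (@deriv K) (p * q) = map_poly (@deriv K) p * q + p * map_poly (@deriv K) q.
Proof.
apply/polyP => i; rewrite coefD coef_map !coefM /= raddf_sum -big_split/=.
by apply: eq_bigr => j _; rewrite derivM !coef_map.
Qed.

Lemma map_deriv_Xn n : map_poly (@deriv K) 'X^n = 0.
Proof.
apply/polyP => i; rewrite coef_map coefXn coef0 /=.
by case: eqP => _; rewrite ?derivC// -polyC1 derivC.
Qed.

Lemma D0D p q : D0 (p + q) = D0 p + D0 q.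
Proof. by rewrite /D0 raddfD /= derivD; ring. Qed.

Lemma D0M p q : D0 (p * q) = D0 p * q + p * D0 q.
Proof. by rewrite /D0 map_derivM derivM; ring. Qed.

Lemma evC_neq0' d : d != 0 -> ev d%:P != 0.
Proof. exact: free_constant_neq0. Qed.

(** The kernel of ev is generated by T^5 - w, which D0 maps to 0. *)
Lemma D0_ker q : ev q = 0 -> ev (D0 q) = 0.
Proof.
pose m : A := 'X^5 - w%:P.
have mm : m \is monic by rewrite monicXnsubC.
have sm : size m = 6 by rewrite size_XnsubC.
have em : ev m = 0 by rewrite rmorphB rmorphXn evY curveY subrr.
have dm : D0 m = 0.
  rewrite /D0 raddfB /= map_deriv_Xn map_polyC /= derivB derivXn derivC subr0 sub0r.
  rewrite mulrnAr -mulrnAl -polyCMn -scaler_nat scalerA mulfV// scale1r.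
  by rewrite mulrN mulrC addNr.
rewrite {1}(Pdiv.RingMonic.rdivp_eq mm q) rmorphD rmorphM em mulr0 add0r => /free_powers r0.
rewrite (Pdiv.RingMonic.rdivp_eq mm q) r0; last first.
  by have := Pdiv.Ring.ltn_rmodp q m; rewrite sm ltnS => ->; exact: monic_neq0.
by rewrite addr0 D0M dm mulr0 addr0 rmorphM em mulr0.
Qed.

Lemma quintic_derivation : exists D : L -> L,
  [/\ [/\ forall f g, D (f + g) = D f + D g,
          forall f g, D (f * g) = D f * g + f * D g
        & forall c, D (iota c) = 0],
      D X = Y ^+ 4 & D Y = ev w^`()%:P / 5%:R].
Proof.
have [|D [DD DM DE]] := derivation_extension D0D D0M D0_ker.
  move=> f; have [q [d [d0 _ E]]] := denominators f.
  by exists q, d%:P; rewrite evC_neq0'//; split=> //; rewrite -E mulfK// evC_neq0'.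
exists D; split; first split=> //.
- by move=> c; rewrite -(evCC iota X Y) DE /D0 map_polyC /= !derivC !mulr0 addr0 rmorph0.
- rewrite -{1}(evX iota X Y) DE /D0 map_polyC /= derivX derivC mulr0 addr0 mulr1.
  by rewrite rmorphXn evY.
- rewrite -{1}(evY iota X Y) DE /D0 -['X]expr1 map_deriv_Xn expr1 derivX mulr0 add0r mulr1.
  by rewrite -mul_polyC polyCM rmorphM evCC fmorphV rmorph_nat mulrC.
Qed.

End QuinticDerivation.

(** * The plane model c^5 y^5 = w^4 *)

(** A Gauss lemma.  P stays nonzero when the inner variable is specialized at any a,
    so a root of d is a root of s, and the linear factors of d can be cancelled one
    at a time. *)
Lemma primitive_divides (K : closedFieldType) (P : {poly {poly K}}) (d : {poly K})
    (q s : {poly {poly K}}) :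
  (forall a, map_poly (horner_eval a) P != 0) -> d != 0 ->
  d%:P * q = s * P -> exists r, q = r * P.
Proof.
move=> prim; have [n] := ubnP (size d); elim: n => // n IH in d q s *; rewrite ltnS => dn d0 E.
have [d1|d1] := leqP (size d) 1.
  have dc := size1_polyC d1; have c0 : d`_0 != 0 by rewrite -polyC_eq0 -dc.
  exists ((d`_0)^-1%:P%:P * s); rewrite -mulrA -E mulrA -polyCM {2}dc -polyCM mulVf//.
  by rewrite mul1r.
have [a] := closed_rootP d (negbT (gtn_eqF d1)); move=> /factor_theorem[d' dE].
have d'0 : d' != 0 by apply: contraNneq d0 => d'0; rewrite dE d'0 mul0r.
have [s' _ sE] := specialize_inner a s.
have sa : map_poly (horner_eval a) s = 0.
  apply: (mulIf (prim a)); rewrite mul0r -rmorphM -E rmorphM /= map_polyC /= horner_evalE dE.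
  by rewrite !hornerE subrr mulr0 mul0r.
rewrite sa rmorph0 add0r in sE.
apply: (IH d' q s') => //.
  by apply: leq_trans dn; rewrite dE size_Mmonic ?monicXsubC ?size_XsubC ?addn2.
have Xa : ('X - a%:P)%:P != 0 :> {poly {poly K}} by rewrite polyC_eq0 polyXsubC_eq0.
by apply: (mulfI Xa); rewrite mulrA -polyCM mulrC [_ * d']mulrC -dE mulrC E sE -mulrA.
Qed.

Lemma poly5E (R : nzRingType) (r : {poly R}) : (size r <= 5)%N ->
  r = (r`_0)%:P + (r`_1)%:P * 'X + (r`_2)%:P * 'X^2 + (r`_3)%:P * 'X^3 + (r`_4)%:P * 'X^4.
Proof.
move=> sr; apply/polyP => -[|[|[|[|[|i]]]]];
  rewrite !coefD !coefCM ?coefC ?coefX ?coefXn /= ?(mulr0, mulr1, addr0, add0r)//.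
by rewrite nth_default// (leq_trans sr).
Qed.

(** The curve c^5 y^5 = w^4 has the same function field as Y^5 = w, with
    y = Y^4 / c: since y c = w / Y, Y is rational in X and y.  It is singular,
    which is why the genus is computed on the other model. *)
Section PlaneModel.
Variables (K : closedFieldType) (L : fieldType) (iota : {rmorphism K -> L}) (X Y : L).
Variables (w c : {poly K}).
Local Notation A := {poly {poly K}}.
Local Notation ev := (pev iota X Y).
Hypothesis curveY : Y ^+ 5 = ev w%:P.
Hypothesis free_powers : forall q : A, (size q <= 5)%N -> ev q = 0 -> q = 0.
Hypothesis denominators : forall f : L, exists (q : A) (d : {poly K}),
  [/\ d != 0, (size q <= 5)%N & f * ev d%:P = ev q].
Hypothesis w0 : w != 0.
Hypothesis c0 : c != 0.
Hypothesis coprime_wc : forall a, c.[a] = 0 -> w.[a] != 0.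

Let y := Y ^+ 4 / ev c%:P.
Let P : A := (c ^+ 5)%:P * 'X^5 - (w ^+ 4)%:P.
Local Notation ey := (pev iota X y).

Let ec0 : ev c%:P != 0. Proof. exact: evC_neq0' free_powers c c0. Qed.

Let eyC p : ey p%:P = ev p%:P. Proof. by rewrite !evC. Qed.

(** Pseudo-division by P leaves a remainder of degree at most 4 in y, which vanishes
    because 1, y, ..., y^4 are multiples of 1, Y^4, ..., Y; the power of c^5
    introduced by the division is removed as P is primitive, c and w having no
    common root. *)
Lemma plane_ker q : eval_xy iota X y q = 0 <-> exists r, q = r * P.
Proof.
rewrite -pevE -/ey.
have eP : ey P = 0.
  rewrite rmorphB [ey (_ * _)]rmorphM !eyC (rmorphXn ey) evY.
  rewrite !(polyC_exp, rmorphXn) expr_div_n -!exprM mulrC divfK ?expf_neq0//.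
  by rewrite [(4 * 5)%N]mulnC exprM curveY subrr.
split; last by move=> [r ->]; rewrite rmorphM eP mulr0.
move=> q0; have := Pdiv.ComRing.rdivp_eq P q.
have cX : size ((c ^+ 5)%:P * 'X^5 : A) = 6.
  by rewrite size_mulXn ?polyC_eq0 ?expf_neq0// size_polyC expf_neq0.
have sw : (size (- (w ^+ 4)%:P : A)%R < size ((c ^+ 5)%:P * 'X^5 : A)%R)%N.
  by rewrite cX size_polyN (leq_ltn_trans (size_polyC_leq1 _)).
have sP : size P = 6 by rewrite size_polyDl.
have -> : lead_coef P = c ^+ 5.
  by rewrite lead_coefDl// lead_coefM lead_coefXn lead_coefC mulr1.
set k := Pdiv.CommonRing.rscalp _ _; set s := Pdiv.CommonRing.rdivp _ _.
set r := Pdiv.CommonRing.rmodp _ _ => E.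
have sr : (size r <= 5)%N.
  have := Pdiv.Ring.ltn_rmodp q P; rewrite sP ltnS => ->.
  by rewrite -size_poly_eq0 sP.
have er : ey r = 0.
  have := congr1 ey E; rewrite -mul_polyC rmorphM q0 mulr0 rmorphD rmorphM eP mulr0 add0r.
  by move=> <-.
(* c^4 r(y), rewritten in the basis 1, Y, ..., Y^4: the powers y, y^2, y^3, y^4 are
   proportional to Y^4, w Y^3, w^2 Y^2, w^3 Y. *)
pose r' : A := (r`_0 * c ^+ 4)%:P + (r`_4 * w ^+ 3)%:P * 'X + (r`_3 * c * w ^+ 2)%:P * 'X^2
  + (r`_2 * c ^+ 2 * w)%:P * 'X^3 + (r`_1 * c ^+ 3)%:P * 'X^4.
have er' : ev r' = ev c%:P ^+ 4 * ey r.
  have eX p n : ev (p ^+ n)%:P = ev p%:P ^+ n by rewrite polyC_exp rmorphXn.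
  have eM p1 p2 : ev (p1 * p2)%:P = ev p1%:P * ev p2%:P by rewrite polyCM rmorphM.
  have eMX (p : {poly K}) n : ev (p%:P * 'X^n) = ev p%:P * Y ^+ n.
    by rewrite rmorphM rmorphXn evY.
  have eyMX (p : {poly K}) n : ey (p%:P * 'X^n) = ev p%:P * y ^+ n.
    by rewrite rmorphM rmorphXn evY eyC.
  have eMX1 (p : {poly K}) : ev (p%:P * 'X) = ev p%:P * Y by rewrite rmorphM evY.
  have eyMX1 (p : {poly K}) : ey (p%:P * 'X) = ev p%:P * y by rewrite rmorphM evY eyC.
  rewrite [in RHS](poly5E sr) /r' !rmorphD !(eMX, eyMX, eMX1, eyMX1) !eyC !(eX, eM).
  rewrite -curveY /y; move: ec0; move: (ev c%:P) => C C0; field.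
  exact: C0.
have r'0 : r' = 0.
  apply: free_powers; last by rewrite er' er mulr0.
  have sX (b : {poly K}) n : (n <= 4)%N -> (size (b%:P * 'X^n : A)%R <= 5)%N.
    move=> n4; rewrite mul_polyC (leq_trans (size_scale_leq _ _))// size_polyXn.
    by rewrite ltnS.
  have sD (p1 p2 : A) : (size p1 <= 5)%N -> (size p2 <= 5)%N -> (size (p1 + p2)%R <= 5)%N.
    by move=> h1 h2; rewrite (leq_trans (size_polyD _ _))// geq_max h1.
  rewrite /r'; do 3 (apply: (sD); last exact: sX).
  apply: (sD); last exact: (sX _ 1%N).
  by rewrite (leq_trans (size_polyC_leq1 _)).
have r'c i : r'`_i = 0 by rewrite r'0 coef0.
have rc i : r`_i = 0.
  have := r'c 0%N; have := r'c 1%N; have := r'c 2%N; have := r'c 3%N; have := r'c 4%N.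
  rewrite /r' !coefD !coefCM !coefC !coefX !coefXn /= !(mulr0, mulr1, addr0, add0r).
  have nz (b d : {poly K}) : d != 0 -> b * d = 0 -> b = 0.
    by move=> d0 /eqP; rewrite mulf_eq0 (negbTE d0) orbF => /eqP.
  move=> /(nz _ _ (expf_neq0 3 c0)) h1.
  move=> /(nz _ _ w0)/(nz _ _ (expf_neq0 2 c0)) h2.
  move=> /(nz _ _ (expf_neq0 2 w0))/(nz _ _ c0) h3.
  move=> /(nz _ _ (expf_neq0 3 w0)) h4 /(nz _ _ (expf_neq0 4 c0)) h0.
  by move: i => [|[|[|[|[|i]]]]]//; rewrite nth_default// (leq_trans sr).
have r0 : r = 0 by apply/polyP => i; rewrite rc coef0.
apply: (@primitive_divides _ P ((c ^+ 5) ^+ k) q s).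
- move=> a; apply/negP => /eqP Pa.
  have h5 := congr1 (fun p : {poly K} => p`_5) Pa.
  have h0 := congr1 (fun p : {poly K} => p`_0) Pa.
  move: h5 h0; rewrite !coef_map /P !coefB !coefCM !coefC !coefXn /=.
  rewrite !(mulr0, mulr1, subr0, sub0r) !horner_evalE hornerN => + /eqP.
  rewrite oppr_eq0 !horner_exp => /eqP; rewrite !expf_eq0 /= => /eqP/coprime_wc.
  by move=> /negbTE ->.
- by rewrite !expf_neq0.
- by rewrite mul_polyC E r0 addr0.
Qed.

Lemma plane_generation f : exists a b,
  eval_xy iota X y b != 0 /\ f = eval_xy iota X y a / eval_xy iota X y b.
Proof.
pose S f := exists a b, ey b != 0 /\ f = ey a / ey b.
have SD g h : S g -> S h -> S (g + h).
  move=> [a [b [b0 ->]]] [a' [b' [b0' ->]]]; exists (a * b' + a' * b), (b * b').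
  by rewrite rmorphD !rmorphM mulf_neq0//; split=> //; field; apply/andP.
have SM g h : S g -> S h -> S (g * h).
  move=> [a [b [b0 ->]]] [a' [b' [b0' ->]]]; exists (a * a'), (b * b').
  by rewrite !rmorphM mulf_neq0//; split=> //; field; apply/andP.
have SV g : S g -> S g^-1.
  move=> [a [b [b0 ->]]]; have [a0|a0] := eqVneq (ey a) 0.
    by exists 0, 1; rewrite a0 mul0r invr0 rmorph0 rmorph1 oner_neq0 mul0r.
  by exists b, a; rewrite invf_div.
have Sp q : S (ey q) by exists q, 1; rewrite rmorph1 oner_neq0 divr1.
have SC p : S (ev p%:P) by rewrite -eyC.
have SY : S Y.
  have [Y0|Y0] := eqVneq Y 0; first by rewrite Y0 -(rmorph0 ey).
  have -> : Y = ev w%:P / (y * ev c%:P).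
    by rewrite /y divfK// -curveY exprS mulfK// expf_neq0.
  have Sy : S y by rewrite -(evY iota X y); exact: Sp.
  exact: (SM _ _ (SC w) (SV _ (SM _ _ Sy (SC c)))).
have Sev q : S (ev q).
  elim/poly_ind: q => [|q p IH]; first by rewrite rmorph0 -(rmorph0 ey).
  by rewrite rmorphD rmorphM evY; apply: SD => //; exact: SM.
have [q [d [d0 _ E]]] := denominators f.
have -> : f = ev q / ev d%:P by rewrite -E mulfK// (evC_neq0' free_powers).
by apply: SM => //; exact: SV.
Qed.

End PlaneModel.

(** * Homogenization *)

Section Homogenization.
Variables (K : closedFieldType) (L : fieldType) (iota : {rmorphism K -> L}).
Local Notation A := {poly {poly K}}.

(** X^N p(1 / X). *)
Definition hompoly (N : nat) (p : {poly K}) : {poly K} := \poly_(i < N.+1) p`_(N - i).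

Definition deg_le (N : nat) (q : A) := forall i, q`_i != 0 -> (size (q`_i)%R + i <= N.+1)%N.

(** The polynomial q of total degree at most N in the coordinates (1 / X, - Y / X),
    multiplied by the N-th power of 1 / X; the sign compensates that of - Y / X. *)
Definition homog (N : nat) (q : A) : A := \poly_(i < 5) ((-1) ^+ i *: hompoly (N - i) q`_i).

Lemma hompoly0 N : hompoly N 0 = 0.
Proof. by apply/polyP => i; rewrite coef_poly !coef0 if_same. Qed.

Lemma hompoly_eq0 N (p : {poly K}) : (size p <= N.+1)%N -> hompoly N p = 0 -> p = 0.
Proof.
move=> sp h; apply/polyP => i; rewrite coef0.
have [iN|iN] := leqP i N; last by rewrite nth_default// (leq_trans sp).
have := congr1 (fun r : {poly K} => r`_(N - i)) h.
by rewrite coef_poly coef0 ltnS leq_subr subKn.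
Qed.

Lemma hompoly_horner N (p : {poly K}) (x : L) : x != 0 -> (size p <= N.+1)%N ->
  (map_poly iota p).[x^-1] * x ^+ N = (map_poly iota (hompoly N p)).[x].
Proof.
move=> x0 sp; rewrite (@horner_coef_wide _ N.+1); last first.
  by rewrite size_map_poly.
rewrite [RHS](@horner_coef_wide _ N.+1); last by rewrite size_map_poly size_poly.
rewrite mulr_suml (reindex_inj rev_ord_inj)/=; apply: eq_bigr => i _.
rewrite !coef_map coef_poly ltn_ord subSS -mulrA; congr (_ * _).
by rewrite exprVn mulrC -expfB_cond ?(negbTE x0) ?leq_subr// subKn// -ltnS.
Qed.

Lemma ev_sum (X Y : L) (q : A) : (size q <= 5)%N ->
  pev iota X Y q = \sum_(i < 5) pev iota X Y (q`_i)%:P * Y ^+ i.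
Proof.
move=> sq; rewrite {1}(poly5E sq) !rmorphD !(rmorphXn, rmorphM) evY.
by rewrite !big_ord_recr big_ord0/= add0r expr0 mulr1 expr1.
Qed.

Lemma homog_ev (X Y : L) N (q : A) : X != 0 -> (size q <= 5)%N -> deg_le N q ->
  pev iota X^-1 (- (Y / X)) q * X ^+ N = pev iota X Y (homog N q).
Proof.
move=> X0 sq dq; rewrite !ev_sum//; last exact: size_poly.
rewrite mulr_suml; apply: eq_bigr => i _; rewrite coef_poly ltn_ord.
have [q0|q0] := eqVneq q`_i 0; first by rewrite q0 hompoly0 scaler0 !rmorph0 !mul0r.
have := dq _ q0 => h.
have iN : (i <= N)%N by move: h; rewrite -size_poly_gt0 in q0; lia.
rewrite -mul_polyC polyCM rmorphM evCC !evC rmorphXn rmorphN rmorph1.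
rewrite -(@hompoly_horner (N - i))//; last by lia.
have -> : (- (Y / X)) ^+ i = (-1) ^+ i * (Y ^+ i / X ^+ i).
  exact: etrans (exprNn _ _) (congr1 _ (expr_div_n _ _ _)).
rewrite -{1}(subnK iN) exprD; move: (_.[_]) => u.
by field; exact: expf_neq0.
Qed.

Lemma deg_le_exists (q : A) : (size q <= 5)%N -> exists N, deg_le N q.
Proof.
move=> sq; exists ((\max_(i < 5) size (q`_i)%R) + 5)%N => i q0.
have i5 : (i < 5)%N by rewrite ltnNge; apply: contra q0 => h; rewrite nth_default// (leq_trans sq).
have := @leq_bigmax _ (fun i : 'I_5 => size (q`_i)%R) (Ordinal i5) => /= h; lia.
Qed.

Lemma deg_leW N M (q : A) : (N <= M)%N -> deg_le N q -> deg_le M q.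
Proof. by move=> NM dq i /dq h; apply: leq_trans h _; rewrite ltnS. Qed.

Lemma homog_eq0 N (q : A) : (size q <= 5)%N -> deg_le N q -> homog N q = 0 -> q = 0.
Proof.
move=> sq dq h; apply/polyP => i; rewrite coef0.
have [i5|i5] := ltnP i 5; last by rewrite nth_default// (leq_trans sq).
have [//|q0] := eqVneq q`_i 0.
have := congr1 (fun r : A => r`_i) h; rewrite coef_poly i5 coef0 => /eqP.
rewrite scaler_eq0 signr_eq0 /= => /eqP/hompoly_eq0 -> //.
have := dq _ q0; rewrite -size_poly_gt0 in q0; move: (size _) q0 => m; lia.
Qed.

Lemma homogC N d : homog N d%:P = (hompoly N d)%:P.
Proof.
apply/polyP => -[|i]; rewrite coef_poly !coefC /= ?subn0 ?scale1r// hompoly0 scaler0.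
by rewrite if_same.
Qed.

End Homogenization.

Lemma pe_specialize (K : fieldType) (a b : K) (q : {poly {poly K}}) :
  pe a b q = (map_poly (horner_eval a) q).[b].
Proof.
have [s _ {1}->] := specialize_inner a q.
by rewrite rmorphD rmorphM peC pe_lift !hornerE subrr mul0r addr0.
Qed.

(** * Regular differentials and the degree *)
Section Infinity.
Variables (K : closedFieldType) (Q : {poly {poly K}}) (L : function_field Q).
Variables (X Y : L) (w : {poly K}) (D : L -> L).
Local Notation iota := (ff_const L).
Local Notation A := {poly {poly K}}.
Local Notation ev := (pev iota X Y).
Local Notation ev' := (pev iota X^-1 (- (Y / X))).
Hypothesis five_neq0 : 5%:R != 0 :> K.
Hypothesis curveY : Y ^+ 5 = ev w%:P.
Hypothesis free_powers : forall q : A, (size q <= 5)%N -> ev q = 0 -> q = 0.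
Hypothesis denominators : forall f : L, exists (q : A) (d : {poly K}),
  [/\ d != 0, (size q <= 5)%N & f * ev d%:P = ev q].
Hypothesis w_separable : forall a, w.[a] = 0 -> w^`().[a] != 0.
Hypotheses (dD : is_derivation D) (DX : D X = Y ^+ 4) (DY : D Y = ev w^`()%:P / 5%:R).
Hypothesis sw : (size w <= 6)%N.
(** The antisymmetry of w makes (1 / X, - Y / X) a point of the same curve; the
    second equation is its derivative. *)
Hypothesis w_anti : hompoly 5 w = - w.
Hypothesis dw_anti : ev' w^`()%:P * X ^+ 4 = ev w^`()%:P * X - ev w%:P *+ 5.
Hypothesis w_0 : w.[0] != 0.

Let X0 : X != 0.
Proof.
rewrite -(evX iota X Y); apply/eqP => /free_powers; rewrite (leq_trans (size_polyC_leq1 _))//.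
by move=> /(_ isT)/eqP; rewrite polyC_eq0 polyX_eq0.
Qed.

Let ev'_homog N (q : A) : (size q <= 5)%N -> deg_le N q ->
  ev q * X^-1 ^+ N = ev' (homog N q).
Proof.
move=> sq dq; rewrite -homog_ev ?invr_neq0// invrK; congr (pev _ _ _ _ * _).
by rewrite mulNr opprK divfK.
Qed.

Lemma infinity_curve : (- (Y / X)) ^+ 5 = ev' w%:P.
Proof.
rewrite exprNn expr_div_n curveY -signr_odd expr1 mulN1r.
apply: (mulIf (expf_neq0 5 X0)); rewrite mulNr divfK ?expf_neq0//.
by rewrite [in RHS]evC hompoly_horner// w_anti rmorphN hornerN -(evC iota X Y).
Qed.

Lemma infinity_free (q : A) : (size q <= 5)%N -> ev' q = 0 -> q = 0.
Proof.
move=> sq q0; have [N dq] := deg_le_exists sq.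
have := homog_ev iota Y X0 sq dq; rewrite q0 mul0r => /esym/free_powers h.
by apply: (homog_eq0 sq dq); apply: h; exact: size_poly.
Qed.

Lemma infinity_denominators f : exists (q : A) (d : {poly K}),
  [/\ d != 0, (size q <= 5)%N & f * ev' d%:P = ev' q].
Proof.
have [q [d [d0 sq E]]] := denominators f.
have [N dq] := deg_le_exists sq.
have sd : (size (d%:P : A) <= 5)%N by rewrite (leq_trans (size_polyC_leq1 _)).
have [M dd] := deg_le_exists sd.
have NM : deg_le (N + M) q by apply: deg_leW dq; rewrite leq_addr.
have MN : deg_le (N + M) (d%:P : A) by apply: deg_leW dd; rewrite leq_addl.
exists (homog (N + M) q), (hompoly (N + M) d); split.
- apply: contra_neq d0 => /hompoly_eq0; apply; have := MN 0%N; rewrite coefC/= addn0.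
  by have [->|_ /(_ isT)] := eqVneq d 0; rewrite ?size_poly0.
- exact: size_poly.
- by rewrite -homogC -!ev'_homog// mulrA E.
Qed.

(** The derivation (- Y / X)^4 d/d(1 / X), which plays in the second chart the role
    that D has in the first. *)
Let D' f := - X^-1 ^+ 2 * D f.

Let dD' : is_derivation D'.
Proof.
have [DD DM DC] := dD; split=> [f g|f g|c]; rewrite /D' ?DD ?DM ?DC; ring.
Qed.

Let DV : D X^-1 = - D X / X ^+ 2.
Proof.
have [DD DM DC] := dD; apply: (mulfI X0).
have : D (X * X^-1) = 0 by rewrite mulfV// -(rmorph1 iota) DC.
by rewrite DM addrC => /eqP; rewrite addr_eq0 => /eqP ->; field.
Qed.

Lemma infinity_DX : D' X^-1 = (- (Y / X)) ^+ 4.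
Proof. by rewrite /D' DV DX; field. Qed.

Lemma infinity_DY : D' (- (Y / X)) = ev' w^`()%:P / 5%:R.
Proof.
have n5 : 5%:R != 0 :> L by rewrite -(rmorph_nat iota) fmorph_eq0.
have [DD DM DC] := dD.
have D0 : D 0 = 0 by rewrite -{1}(rmorph0 iota) DC.
have DN f : D (- f) = - D f by apply/eqP; rewrite -addr_eq0 -DD addNr D0.
rewrite /D' DN DM DV DX DY; apply: (mulIf n5); rewrite divfK//.
apply: (mulIf (expf_neq0 4 X0)); rewrite dw_anti -curveY; field.
by rewrite X0 n5.
Qed.

(** In the chart at infinity the differential has the coefficient - ev' (homog N q) /
    (1 / X)^(N - 2).  If it is regular at the five points over 1 / X = 0 and N > 2,
    the polynomial homog N q, of degree at most 4 in the second coordinate, vanishes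
    at all of them; its restriction to 1 / X = 0 is the part of degree N of q. *)
Lemma infinity_descent N (q : A) : (2 < N)%N -> (size q <= 5)%N -> deg_le N q ->
  regular_differential D (ev q) -> deg_le N.-1 q.
Proof.
move=> N2 sq dq reg.
have reg' : regular_differential D' (- X^-1 ^+ 2 * ev q).
  by move=> v /reg[t [h [t0 vt vh ->]]]; exists t, h; split=> //; rewrite /D'; ring.
have h0 : map_poly (horner_eval 0) (homog N q) = 0.
  apply: (fifth_roots_poly five_neq0 w_0); first exact: leq_trans (size_poly _ _) (size_poly _ _).
  move=> b oc; rewrite -pe_specialize.
  have [r [u [u0 E]]] := regular_local five_neq0 infinity_curve infinity_free
    infinity_denominators w_separable dD' infinity_DX infinity_DY oc reg'.
  have : ev' (homog N q * u + 'X%:P ^+ (N - 2) * r) = 0.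
    rewrite rmorphD !(rmorphXn, rmorphM) -E -ev'_homog// evX -{1}(subnK (ltnW N2)) exprD; ring.
  move=> /(pe_ker infinity_curve infinity_free oc)/eqP.
  rewrite rmorphD !(rmorphXn, rmorphM) peC hornerX expr0n subn_eq0 leqNgt N2 mul0r addr0.
  by rewrite mulf_eq0 (negbTE u0) orbF => /eqP.
move=> i q0; have := dq i q0; rewrite leq_eqVlt => /orP[/eqP sE|]; last first.
  by rewrite ltnS prednK// (ltn_trans _ N2).
have i5 : (i < 5)%N by rewrite ltnNge; apply: contra q0 => h; rewrite nth_default// (leq_trans sq).
have := congr1 (fun r : {poly K} => r`_i) h0.
rewrite coef_map coef_poly i5 coef0 /= horner_evalE hornerZ => /eqP.
rewrite mulf_eq0 signr_eq0 /= horner_coef0 coef_poly /= subn0.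
have -> : (N - i)%N = (size (q`_i)%R).-1 by lia.
by rewrite -lead_coefE lead_coef_eq0 (negbTE q0).
Qed.

(** As D is Y^4 d/dX, f stands for the differential f dX / Y^4.  Regularity on the
    affine curve makes f a polynomial, and regularity at infinity lowers its degree
    to 2.  Conversely every place has its center in one of the two charts, where
    the differential has the coefficient q or - homog 2 q on a nonvanishing
    differential. *)
Lemma regular_polynomials f : regular_differential D f <->
  exists q : A, [/\ (size q <= 5)%N, deg_le 2 q & f = ev q].
Proof.
split=> [reg|[q [sq dq ->]] v pv].
  have [|q sq fE] := local_global five_neq0 curveY free_powers denominators w_separable (f := f).
    move=> a b oc; exact: (regular_local five_neq0 curveY free_powers denominators w_separable dD DX DY oc reg).
  exists q; rewrite fE; split=> //; rewrite fE in reg.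
  have [N] := deg_le_exists sq; elim: N => [|N IH] dq; first exact: deg_leW dq.
  have [N2|N2] := leqP N.+1 2; first exact: deg_leW dq.
  by apply: IH; exact: (infinity_descent N2 sq dq reg).
have unitV g t : D t != 0 -> v (D t) = 0 -> vge0 v g -> vge0 v (g / D t).
  move=> t0 vt g0; apply: (vge0M pv) => //.
  by move=> _; rewrite (placeV pv)// vt oppr0.
have [vX|vX] := pselect (vge0 v X).
  have [t [t0 vt Dt0 vDt]] := place_parameter five_neq0 curveY free_powers denominators
    w_separable dD DX DY pv vX.
  exists t, (ev q / D t); split=> //; last by rewrite divfK.
  exact/unitV/(place_ev_ge0 curveY).
have vX' : vge0 v X^-1.
  move=> _; rewrite (placeV pv)// oppr_ge0 leNgt; apply/negP => h; apply: vX => _.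
  exact: ltW.
have [t [t0 vt Dt0 vDt]] := place_parameter five_neq0 infinity_curve infinity_free infinity_denominators
    w_separable dD' infinity_DX infinity_DY pv vX'.
exists t, (- ev' (homog 2 q) / D' t); split=> //; last first.
  rewrite -ev'_homog//; move: Dt0; rewrite /D' mulf_eq0 negb_or => /andP[h1 h2].
  by rewrite -mulrN invfM mulrA mulfK// divfK.
rewrite -/(vge0 v _) mulNr; apply: (vge0N pv); apply: (vge0M pv).
  exact: (place_ev_ge0 infinity_curve).
by move=> _; rewrite (placeV pv)// vDt oppr0.
Qed.

End Infinity.

(** * The genus *)

Section Conics.
Variables (K : closedFieldType) (L : fieldType) (iota : {rmorphism K -> L}) (X Y : L).
Local Notation A := {poly {poly K}}.

Definition conic_poly (c : 'I_6 -> K) : A := let C k := c (inord k) in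
  Poly [:: Poly [:: C 0%N; C 1%N; C 2%N]; Poly [:: C 3%N; C 4%N]; Poly [:: C 5%N]].

Definition conic_basis (i : 'I_6) : L := [:: 1; X; X ^+ 2; Y; X * Y; Y ^+ 2]`_i.

Lemma conic_coef c i j : (conic_poly c)`_i`_j =
  nth 0 (nth [::] [:: [:: c (inord 0); c (inord 1); c (inord 2)];
    [:: c (inord 3); c (inord 4)]; [:: c (inord 5)]] i) j.
Proof.
rewrite coef_Poly; move: i => [|[|[|i]]].
- exact: (coef_Poly [:: _; _; _] j).
- exact: (coef_Poly [:: _; _] j).
- exact: (coef_Poly [:: _] j).
by rewrite /= nth_nil coef0 !nth_nil.
Qed.

Lemma ev_conic c : pev iota X Y (conic_poly c) = \sum_i iota (c i) * conic_basis i.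
Proof.
rewrite /conic_poly /= !cons_poly_def !mul0r !add0r.
rewrite !(rmorphD (pev iota X Y), rmorphM (pev iota X Y), polyCD, polyCM) evY !evCC evX.
have -> : \sum_i iota (c i) * conic_basis i =
    \sum_(i < 6) iota (c (inord i)) * [:: 1; X; X ^+ 2; Y; X * Y; Y ^+ 2]`_i.
  by apply: eq_bigr => i _; rewrite inord_val.
by rewrite !big_ord_recr big_ord0 /=; ring.
Qed.

Lemma size_conic c : (size (conic_poly c) <= 5)%N.
Proof. exact: leq_trans (size_Poly _) _. Qed.

Lemma deg_conic c : deg_le 2 (conic_poly c).
Proof.
move=> i; rewrite /conic_poly coef_Poly; move: i => [|[|[|i]]] nz.
- by rewrite addn0; exact: (size_Poly [:: _; _; _]).
- by rewrite addn1 ltnS; exact: (size_Poly [:: _; _]).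
- by rewrite addn2 !ltnS; exact: (size_Poly [:: _]).
by move: nz; rewrite /= nth_nil eqxx.
Qed.

Lemma conic_eq0 c : conic_poly c = 0 -> forall i, c i = 0.
Proof.
move=> h i; have H a b := conic_coef c a b; rewrite h in H.
have := H 0%N 0%N; have := H 0%N 1%N; have := H 0%N 2%N; have := H 1%N 0%N.
have := H 1%N 1%N; have := H 2%N 0%N; rewrite !coef0 /= => h5 h4 h3 h2 h1 h0.
have hk k : (k < 6)%N -> c (inord k) = 0 by move: k => [|[|[|[|[|[|k]]]]]].
by rewrite -(inord_val i) hk.
Qed.

Lemma conic_surj (q : A) : (size q <= 5)%N -> deg_le 2 q -> exists c, q = conic_poly c.
Proof.
move=> sq dq; exists (fun i : 'I_6 => [:: q`_0`_0; q`_0`_1; q`_0`_2; q`_1`_0; q`_1`_1; q`_2`_0]`_i).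
apply/polyP => i; apply/polyP => j; rewrite conic_coef !inordK//=.
have big : (2 < i + j)%N -> q`_i`_j = 0.
  move=> ij; have [->|q0] := eqVneq q`_i 0; first by rewrite coef0.
  by rewrite nth_default//; have := dq _ q0; move: (size _) => m; lia.
move: i j big => [|[|[|i]]] [|[|[|j]]] //= big; rewrite ?nth_nil ?big//; lia.
Qed.

End Conics.

Section Genus.
Variable K : closedFieldType.
Hypothesis char0 : forall n, n.+1%:R != 0 :> K.
Local Notation A := {poly {poly K}}.
Local Notation w := (Wform 'X 1 : {poly K}).

Definition dWform (B : comNzRingType) (x : B) : B :=
  x ^+ 4 - 4 * x ^+ 3 - 6 * x ^+ 2 + 4 * x + 1.

Lemma rmorph_dWform (B C : comNzRingType) (f : {rmorphism B -> C}) (x : B) :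
  f (dWform x) = dWform (f x).
Proof. by rewrite /dWform !(rmorphXn, rmorph_nat, rmorphB, rmorphM, rmorphD, rmorph1). Qed.

Lemma w_horner a : w.[a] = Wform a 1.
Proof. by rewrite -horner_evalE rmorph_Wform /= horner_evalE hornerX rmorph1. Qed.

Lemma deriv_w : w^`() = 5 * dWform 'X :> {poly K}.
Proof.
have dn n : (n%:R : {poly K})^`() = 0 by rewrite -polyC_natr derivC.
rewrite /Wform /dWform !expr1n !mulr1 !(derivB, derivD, derivM, derivXn, derivX, dn) -polyC1 derivC.
by ring.
Qed.

Lemma dw_horner a : w^`().[a] = 5 * dWform a.
Proof.
rewrite deriv_w hornerM -!horner_evalE rmorph_dWform /= !horner_evalE hornerX.
by rewrite -[5 : {poly K}]polyC_natr hornerC.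
Qed.

Lemma w_Poly : w = Poly [:: -1; 5; 10; - 10; - 5; 1].
Proof. by rewrite /= !cons_poly_def /Wform !(polyC_natr, polyCN); ring. Qed.

Lemma size_w : (size w <= 6)%N.
Proof. by rewrite w_Poly; exact: size_Poly. Qed.

Lemma hompoly_w : hompoly 5 w = - w.
Proof.
apply/polyP => i; rewrite w_Poly coefN coef_poly !coef_Poly.
by move: i => [|[|[|[|[|[|i]]]]]] //=; rewrite ?opprK ?nth_nil ?oppr0.
Qed.

Lemma w_coprime_sqr a : ('X ^+ 2 + 1 : {poly K}).[a] = 0 -> w.[a] != 0.
Proof.
rewrite w_horner !hornerE => /eqP; rewrite addr_eq0 => /eqP a2.
have -> : Wform a 1 = 16%:R * (a - 1).
  rewrite /Wform.
  have -> : a ^+ 5 = a * (a ^+ 2) ^+ 2 by ring.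
  have -> : a ^+ 4 = (a ^+ 2) ^+ 2 by ring.
  have -> : a ^+ 3 = a * a ^+ 2 by ring.
  by rewrite a2; ring.
rewrite mulf_neq0 ?char0// subr_eq0; apply: contra_eq_neq a2 => ->.
by rewrite expr1n -subr_eq0 opprK; exact: (char0 1).
Qed.

(** At a common root of w and w', the identity W^2 + V^2 = 2 (a^2 + 1)^5, in which V
    is a combination of w and w', gives a^2 = - 1; but then W(a) = 16 (a - 1) is
    not 0. *)
Lemma w_separable a : w.[a] = 0 -> w^`().[a] != 0.
Proof.
move=> w0; rewrite dw_horner mulf_neq0 ?(char0 4)//; apply: contra_eqN w0 => /eqP u0.
have [/w_coprime_sqr//|c0] := eqVneq (('X ^+ 2 + 1 : {poly K}).[a]) 0.
rewrite w_horner; apply: contraNneq c0 => w0.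
have : 2 * (a ^+ 2 + 1) ^+ 5 = Wform a 1 ^+ 2 + ((a ^+ 2 + 1) * dWform a - a * Wform a 1) ^+ 2.
  by rewrite /Wform /dWform; ring.
rewrite w0 u0 !mulr0 subrr !expr0n addr0 => /eqP.
by rewrite mulf_eq0 (negbTE (char0 1))/= expf_eq0 /= !hornerE.
Qed.

Lemma w_root1 : root w 1.
Proof. by rewrite /root w_horner /Wform; apply/eqP; ring. Qed.

Lemma dw_root1 : ~~ root w^`() 1.
Proof. by apply: w_separable; apply/rootP/w_root1. Qed.

Lemma w_at0 : w.[0] != 0.
Proof.
rewrite w_horner /Wform; apply: contra_neq (oner_neq0 K) => h; apply: oppr_inj.
by rewrite oppr0 -h; ring.
Qed.

Lemma curveD5_form : curveD5 K = (('X ^+ 2 + 1) ^+ 5)%:P * 'X ^+ 5 - (w ^+ 4)%:P.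
Proof.
rewrite /curveD5 -exprMn; congr (_ - (_ ^+ 4)%:P); rewrite /Wform; ring.
Qed.

Lemma genus_curveD5 : has_genus (curveD5 K) 6.
Proof.
have [L [iota [X [Y [cY free den]]]]] := quintic_field w_root1 dw_root1.
have c0 : 'X ^+ 2 + 1 != 0 :> {poly K}.
  by rewrite monic_neq0// -[1]opprK -polyCN monicXnsubC.
have w0 : w != 0 by apply: contraNneq dw_root1 => ->; rewrite deriv0 root0.
pose y := Y ^+ 4 / pev iota X Y ('X ^+ 2 + 1)%:P.
have ker q : eval_xy iota X y q = 0 <-> exists r, q = r * curveD5 K.
  by rewrite curveD5_form; exact: plane_ker cY free w0 c0 w_coprime_sqr q.
have gen := plane_generation cY free den c0.
pose F := FunctionField ker gen.
have [D [dD DX DY]] := quintic_derivation (char0 4) cY free den.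
have X0 : X != 0.
  rewrite -(evX iota X Y); apply/eqP => /free; rewrite (leq_trans (size_polyC_leq1 _))//.
  by move=> /(_ isT)/eqP; rewrite polyC_eq0 polyX_eq0.
have evw X' Y' : pev iota X' Y' w%:P = Wform X' 1.
  by rewrite -[LHS]/((pev iota X' Y' \o polyC) w) rmorph_Wform /= evX !rmorph1.
have evdw X' Y' : pev iota X' Y' w^`()%:P = 5 * dWform X'.
  rewrite deriv_w -[LHS]/((pev iota X' Y' \o polyC) (5 * dWform 'X)) rmorphM rmorph_dWform /= evX.
  by rewrite !rmorph_nat.
have reg := @regular_polynomials K (curveD5 K) F X Y w D (char0 4) cY free den w_separable dD DX DY
  size_w hompoly_w _ w_at0.
have Y0 : Y != 0.
  rewrite -(evY iota X Y); apply/eqP => /free; rewrite size_polyX => /(_ isT)/eqP.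
  by rewrite polyX_eq0.
exists F, D, (conic_basis X Y); split.
- exact: dD.
- by exists X; rewrite DX expf_neq0.
- move=> f; rewrite reg; last by rewrite evw !evdw /dWform /Wform; field.
  split=> [[q [sq dq ->]]|[c ->]].
    have [c qE] := conic_surj sq dq.
    by exists c; rewrite qE; exact: ev_conic.
  by exists (conic_poly c); rewrite ev_conic size_conic; split=> //; exact: deg_conic.
- move=> c; rewrite -[X in X = 0 -> _](ev_conic iota X Y) => /free.
  by rewrite size_conic => /(_ isT); exact: conic_eq0.
Qed.

End Genus.

Import numFieldNormedType.Exports.

Local Open Scope classical_set_scope.
Local Open Scope card_scope.
Local Open Scope ring_scope.

(** * The real fifth root and the form W *)
Lemma is_derive_continuous (R : realType) (f : R -> R) (t l : R) :
  is_derive t (1 : R) f l -> {for t, continuous f}.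
Proof. by case=> + _; move/derivable1_diffP/differentiable_continuous. Qed.

Section Root5.
Variable R : realType.
Implicit Types x y : R.

Lemma ltr_exp5 x y : x < y -> x ^+ 5 < y ^+ 5.
Proof.
move=> xy; rewrite -subr_gt0.
have -> : y ^+ 5 - x ^+ 5 = (y - x) * ((x ^+ 2 + x * y / 2) ^+ 2
   + (y ^+ 2 + x * y / 2) ^+ 2 + (x * y) ^+ 2 / 2) by field.
rewrite mulr_gt0 ?subr_gt0//.
have [x0|x0] := eqVneq x 0.
  rewrite x0 in xy *; rewrite !(mul0r, expr0n)/= addr0 !add0r addr0.
  by rewrite expr0n/= add0r -exprM; apply: exprn_gt0.
have [y0|y0] := eqVneq y 0.
  rewrite y0 !(mulr0, mul0r, expr0n)/= !addr0.
  by rewrite expr0n/= addr0 -exprM exprn_even_gt0//= x0 orbT.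
rewrite ltr_wpDl ?addr_ge0 ?sqr_ge0// divr_gt0//.
by rewrite exprn_even_gt0//= mulf_neq0.
Qed.

Lemma exp5_inj : injective (fun x => x ^+ 5).
Proof.
move=> x y /= xy; case: (ltgtP x y) => // /ltr_exp5; by rewrite xy ltxx.
Qed.

Lemma root5K x : root5 x ^+ 5 = x.
Proof.
have [->|x0] := eqVneq x 0; first by rewrite /root5 sgr0 mul0r expr0n.
rewrite /root5 exprMn -[X in _ * X]powR_mulrn ?powR_ge0// -powRrM mulVf ?pnatr_eq0// powRr1//.
rewrite exprS -[4%N]/(2 * 2)%N exprM sqr_sg x0 expr1n mulr1.
by rewrite -numEsg.
Qed.

Lemma exp5K x : root5 (x ^+ 5) = x.
Proof. by apply: exp5_inj; rewrite root5K. Qed.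

Lemma root50 : root5 0 = 0 :> R.
Proof. by apply: exp5_inj; rewrite root5K expr0n. Qed.

Lemma root5_eq0 x : (root5 x == 0) = (x == 0).
Proof. by rewrite -{2}(root5K x) expf_eq0. Qed.

Lemma root5M x y : root5 (x * y) = root5 x * root5 y.
Proof. by apply: exp5_inj; rewrite /= [RHS]exprMn !root5K. Qed.

Lemma root5N x : root5 (- x) = - root5 x.
Proof. by apply: exp5_inj; rewrite /= root5K [RHS]exprNn root5K; ring. Qed.

Lemma continuous_root5 : continuous (@root5 R).
Proof.
move=> y; rewrite -(root5K y).
have := @near_can_continuous R (fun x => x ^+ 5) (@root5 R) (root5 y).
move=> /(_ _ _)/nbhs_singleton; apply.
  exact: (@filterE _ (nbhs (root5 y)) (nbhs_filter _) _ exp5K).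
apply: (@filterE _ (nbhs (root5 y)) (nbhs_filter _)) => x; exact: exprn_continuous.
Qed.

Lemma is_derive_root5 x : x != 0 ->
  is_derive x (1 : R) (@root5 R) ((5 * root5 x ^+ 4)^-1).
Proof.
move=> x0; rewrite -{1}(root5K x).
apply: (@is_derive_inverse R (fun x => x ^+ 5) (@root5 R)).
- exact: (@filterE _ (nbhs (root5 x)) (nbhs_filter _) _ exp5K).
- apply: (@filterE _ (nbhs (root5 x)) (nbhs_filter _)) => z; exact: exprn_continuous.
- apply: is_derive_eq; rewrite /GRing.scale/= mulr1.
  by ring.
- by rewrite mulf_neq0 ?expf_neq0 ?root5_eq0.
Qed.

End Root5.

Section WPolys.
Variable R : realType.
Implicit Types x y t : R.

(** The imaginary part of (1 + i) (x + i y)^5, whose real part is W. *)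
Definition V x y : R :=
  x ^+ 5 + 5 * x ^+ 4 * y - 10 * x ^+ 3 * y ^+ 2 - 10 * x ^+ 2 * y ^+ 3
  + 5 * x * y ^+ 4 + y ^+ 5.

Lemma VW_norm x y : V x y ^+ 2 + W x y ^+ 2 = 2 * (x ^+ 2 + y ^+ 2) ^+ 5.
Proof. by rewrite /V /W; ring. Qed.

(** The derivatives of W(t, 1) and V(t, 1), divided by 5. *)
Definition dW t : R := t ^+ 4 - 4 * t ^+ 3 - 6 * t ^+ 2 + 4 * t + 1.
Definition dV t : R := t ^+ 4 + 4 * t ^+ 3 - 6 * t ^+ 2 - 4 * t + 1.

Lemma is_derive_W1 t : is_derive t (1 : R) (fun t => W t 1) (5 * dW t).
Proof.
rewrite /W; apply: is_derive_eq; rewrite /dW /GRing.scale/=.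
by ring.
Qed.

Lemma is_derive_V1 t : is_derive t (1 : R) (fun t => V t 1) (5 * dV t).
Proof.
rewrite /V; apply: is_derive_eq; rewrite /dV /GRing.scale/=.
by ring.
Qed.

Lemma onePsqr_gt0 t : 0 < t ^+ 2 + 1.
Proof. by rewrite ltr_wpDl ?sqr_ge0. Qed.

Definition Wpoly : {poly R} :=
  'X ^+ 5 - 5%:P * 'X ^+ 4 - 10%:P * 'X ^+ 3 + 10%:P * 'X ^+ 2 + 5%:P * 'X - 1.

Lemma Wpoly_horner t : Wpoly.[t] = W t 1.
Proof. by rewrite /Wpoly !(hornerD, hornerN, hornerM, hornerC, hornerXn, hornerX) /W; ring. Qed.

Lemma poly_roots_seq (p : {poly R}) : p != 0 ->
  exists s : seq R, forall t, root p t -> t \in s.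
Proof.
move: {2}(size p) (leqnn (size p)) => n; elim: n p => [|n IH] p.
  by rewrite leqn0 size_poly_eq0 => ->.
move=> szp p0; have [[a /factor_theorem[q pq]]|nr] := pselect (exists a, root p a).
  have q0 : q != 0 by apply: contraNneq p0 => q0; rewrite pq q0 mul0r.
  have [|//|s sP] := IH q.
    by move: szp; rewrite pq size_Mmonic ?monicXsubC// size_XsubC addn2.
  exists (a :: s) => t; rewrite pq rootM root_XsubC inE => /orP[/sP ->|->//].
  by rewrite orbT.
by exists [::] => t pt; case: nr; exists t.
Qed.

Lemma Wpoly_neq0 : Wpoly != 0.
Proof.
apply/eqP => /(congr1 (fun p => p.[0])); rewrite Wpoly_horner horner0 /W.
by move=> h; have : (-1 : R) != 0; [rewrite oppr_eq0 oner_neq0|rewrite -h; case/eqP; ring].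
Qed.

Lemma W_roots : exists s : seq R, forall t, W t 1 = 0 -> t \in s.
Proof.
have [s sP] := poly_roots_seq Wpoly_neq0.
by exists s => t Wt; apply: sP; rewrite /root Wpoly_horner Wt.
Qed.

Lemma continuous_W1 : continuous (fun t : R => W t 1).
Proof.
by move=> t; apply: is_derive_continuous (is_derive_W1 t).
Qed.

(** A common zero of W and W' would be a zero of t^2 + 1, by the combination of W and
    W' that the proof exhibits; so every real zero of W is simple. *)
Lemma dW_neq0 t : W t 1 = 0 -> dW t != 0.
Proof.
move=> Wt; apply/eqP => dWt.
have : (t ^+ 2 + 1) ^+ 5 = 0.
  suff : (t ^+ 2 + 1) ^+ 5 = 2^-1 * (V t 1 * (dW t * (t ^+ 2 + 1) - 6 * t * W t 1) 
    + W t 1 * (5 * dV t * (t ^+ 2 + 1) + 6 * W t 1)).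
    by move=> ->; rewrite Wt dWt; ring.
  by rewrite /W /V /dV /dW; field.
by move/eqP; rewrite expf_eq0/= (gt_eqF (onePsqr_gt0 t)).
Qed.

End WPolys.

(** * A primitive of the integrand of alpha *)
Section AlphaPrimitive.
Variable R : realType.
Implicit Types x y t : R.
Let mu := @lebesgue_measure R.
Let f := @alpha_integrand R.

(** The integrand is the sum of the derivative of alpha_elem and of alpha_rest.  Both
    are continuous on the line: one integration by parts has traded the
    singularity W^(- 4/5) for W^(1/5) and W^(6/5). *)
Definition alpha_elem t : R :=
  root5 (W t 1) * V t 1 * (2 * (t ^+ 2 + 1) ^+ 3)^-1.
Definition alpha_rest t : R := 3 * root5 (W t 1) ^+ 6 * ((t ^+ 2 + 1) ^+ 4)^-1.

Lemma continuous_rootW : continuous (fun t : R => root5 (W t 1)).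
Proof.
move=> t; apply: (@continuous_comp _ _ _ (fun t => W t 1) (@root5 R)).
  exact: continuous_W1.
exact: continuous_root5.
Qed.

Lemma is_derive_alpha_elem t : W t 1 != 0 ->
  is_derive t (1 : R) alpha_elem (f t - alpha_rest t).
Proof.
move=> Wt0.
have dr := is_derive1_comp (g := fun t => W t 1) (is_derive_root5 Wt0) (is_derive_W1 t).
have dv := is_derive_V1 t.
have dT : is_derive t (1 : R) (fun t => 2 * (t ^+ 2 + 1) ^+ 3) (12 * t * (t ^+ 2 + 1) ^+ 2).
  by apply: is_derive_eq; rewrite /GRing.scale/=; ring.
have T0 := onePsqr_gt0 t.
have T0' : t ^+ 2 + 1 != 0 by rewrite gt_eqF.
have dTV : is_derive t (1 : R) (fun t => (2 * (t ^+ 2 + 1) ^+ 3)^-1) _ :=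
  is_deriveV (f := fun t => 2 * (t ^+ 2 + 1) ^+ 3) _ dT.
have {}dTV := dTV (mulf_neq0 (negbT (pnatr_eq0 R 2)) (expf_neq0 3 T0')).
have [H1 H2] := is_deriveM (is_deriveM dr dv) dTV.
split; [exact: H1|apply: (etrans H2)].
rewrite (_ : ((@root5 R \o (fun t => W t 1)) * (fun t => V t 1)) t = root5 (W t 1) * V t 1)//.
rewrite /f /alpha_integrand /alpha_rest /GRing.scale/=.
have := root5K (W t 1); have : root5 (W t 1) != 0 by rewrite root5_eq0.
move: (root5 _) => r r0 rW.
transitivity ((dW t * V t 1 / (2 * (t ^+ 2 + 1) ^+ 3) + 5 * r ^+ 5 * dV t / (2 * (t ^+ 2 + 1) ^+ 3)
  - 3 * t * r ^+ 5 * V t 1 / (t ^+ 2 + 1) ^+ 4) / r ^+ 4).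
  by field; rewrite r0 T0'.
rewrite rW.
transitivity (((t ^+ 2 + 1) - 3 * (r ^+ 5) ^+ 2 / (t ^+ 2 + 1) ^+ 4) / r ^+ 4); last first.
  by field; rewrite r0 T0'.
rewrite rW; congr (_ / _); rewrite /W /V /dV /dW.
by field.
Qed.

Lemma continuous_alpha_rest : continuous alpha_rest.
Proof.
move=> t; rewrite /alpha_rest.
apply: (@cvgM _ _ _ _ (fun t => 3 * root5 (W t 1) ^+ 6) (fun t => ((t ^+ 2 + 1) ^+ 4)^-1)).
  apply: cvgMr.
  apply: (@continuous_comp _ _ _ (fun t => root5 (W t 1)) (fun x => x ^+ 6)).
    exact: continuous_rootW.
  exact: exprn_continuous.
apply: cvgV; first by rewrite expf_neq0// gt_eqF// onePsqr_gt0.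
apply: (@continuous_comp _ _ _ (fun t => t ^+ 2 + 1) (fun x => x ^+ 4)); last exact: exprn_continuous.
by apply: cvgD; [exact: exprn_continuous|exact: cvg_cst].
Qed.

Lemma continuous_alpha_elem : continuous alpha_elem.
Proof.
move=> t; rewrite /alpha_elem.
apply: cvgM.
  apply: cvgM; first exact: continuous_rootW.
  exact: (is_derive_continuous (is_derive_V1 t)).
apply: cvgV; first by rewrite mulf_neq0// expf_neq0// gt_eqF// onePsqr_gt0.
apply: cvgMr.
apply: (@continuous_comp _ _ _ (fun t => t ^+ 2 + 1) (fun x => x ^+ 3)); last exact: exprn_continuous.
by apply: cvgD; [exact: exprn_continuous|exact: cvg_cst].
Qed.

(** W^2 <= W^2 + V^2 = 2 (t^2 + 1)^5, after a fifth root. *)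
Lemma rootW_sqr_le t : root5 (W t 1) ^+ 2 <= 2 * (t ^+ 2 + 1).
Proof.
have T0 := onePsqr_gt0 t.
have h : (root5 (W t 1) ^+ 2) ^+ 5 <= (2 * (t ^+ 2 + 1)) ^+ 5.
  rewrite -exprM mulnC exprM root5K.
  have := VW_norm t 1; rewrite expr1n => /(congr1 (fun z => z - V t 1 ^+ 2)).
  rewrite addrAC subrr add0r => ->.
  have v0 := sqr_ge0 (V t 1); have := exprn_gt0 5 T0.
  by rewrite exprMn; move: (_ ^+ 5) (_ ^+ 2) v0 => A B; lra.
rewrite leNgt; apply/negP => /ltr_exp5; by rewrite ltNge h.
Qed.

(** By the bounds on W^(2/5) and V^2 that follow from W^2 + V^2 = 2 (t^2 + 1)^5, the
    powers of t^2 + 1 cancel. *)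
Lemma alpha_elem_le1 t : `|alpha_elem t| <= 1.
Proof.
have T0 := onePsqr_gt0 t.
rewrite -(@ler_pXn2r _ 2%N) ?nnegrE// expr1n -normrX ger0_norm ?sqr_ge0//.
rewrite /alpha_elem exprMn exprVn ler_pdivrMr ?exprn_gt0 ?mulr_gt0// mul1r.
have -> : (2 * (t ^+ 2 + 1) ^+ 3) ^+ 2 = 2 ^+ 2 * (t ^+ 2 + 1) ^+ 6 by ring.
rewrite exprMn.
have -> : 2 ^+ 2 * (t ^+ 2 + 1) ^+ 6 = (2 * (t ^+ 2 + 1)) * (2 * (t ^+ 2 + 1) ^+ 5) by ring.
apply: ler_pM; rewrite ?sqr_ge0 ?rootW_sqr_le//.
have := VW_norm t 1; rewrite expr1n => <-.
by rewrite lerDl sqr_ge0.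
Qed.

Lemma alpha_rest_ge0 t : 0 <= alpha_rest t.
Proof.
have T0 := onePsqr_gt0 t.
rewrite /alpha_rest divr_ge0 ?exprn_ge0 ?(ltW T0)// mulr_ge0//.
by rewrite -[6%N]/(2 * 3)%N exprM exprn_ge0 ?sqr_ge0.
Qed.

Lemma alpha_rest_le t : alpha_rest t <= 24 * (1 + t ^+ 2)^-1.
Proof.
have T0 := onePsqr_gt0 t.
rewrite /alpha_rest ler_pdivrMr ?exprn_gt0//.
have -> : 24 * (1 + t ^+ 2)^-1 * (t ^+ 2 + 1) ^+ 4 = 3 * (2 * (t ^+ 2 + 1)) ^+ 3.
  by field; rewrite -(addrC (t ^+ 2)) gt_eqF.
rewrite ler_pM2l// -[6%N]/(2 * 3)%N exprM.
by rewrite ler_pXn2r ?nnegrE ?sqr_ge0 ?rootW_sqr_le// mulr_ge0// ltW.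
Qed.

End AlphaPrimitive.

Lemma set_itvccE (R : realType) (a b x : R) : `[a, b]%classic x = (a <= x <= b) :> Prop.
Proof. by rewrite /= in_itv. Qed.

(** The fundamental theorem for a nonnegative function with finitely many
    singularities, given a primitive that is continuous across them. *)
Section FTCExceptions.
Variable R : realType.
Let mu := @lebesgue_measure R.
Variables f Phi : R -> R.
Hypothesis f_ge0 : forall x, 0 <= f x.
Hypothesis mf : measurable_fun setT f.
Hypothesis cPhi : continuous Phi.

Lemma shrinking_itv_bigcup (a b : R) : a < b ->
  \bigcup_n `[a + (b - a) / n.+3%:R, b - (b - a) / n.+3%:R]%classic = `]a, b[%classic.
Proof.
move=> ab; have ab0 : 0 < b - a by rewrite subr_gt0.
apply/seteqP; split => x.
  move=> [n _] /=; rewrite !in_itv/= => /andP[h1 h2].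
  have d0 : 0 < (b - a) / n.+3%:R by rewrite divr_gt0.
  apply/andP; split.
    by apply: lt_le_trans h1; rewrite ltrDl.
  by apply: le_lt_trans h2 _; rewrite ltrBlDr ltrDl.
rewrite /= in_itv/= => /andP[ax xb].
pose e := Num.min (x - a) (b - x).
have e0 : 0 < e by rewrite lt_min !subr_gt0 ax xb.
exists (Num.truncn ((b - a) / e)) => //.
have h : (b - a) / (Num.truncn ((b - a) / e)).+3%:R <= e.
  rewrite ler_pdivrMr// mulrC -ler_pdivrMr//.
  by apply: le_trans (ltW (truncnS_gt _)) _; rewrite ler_nat !ltnS leqW.
have e1 : e <= x - a by rewrite /e ge_min lexx.
have e2 : e <= b - x by rewrite /e ge_min lexx orbT.
rewrite set_itvccE; apply/andP; split.
  by rewrite -lerBrDl; apply: le_trans h e1.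
by rewrite lerBrDl -lerBrDr; apply: le_trans h e2.
Qed.

(** Monotone convergence over the compact subintervals of the open interval. *)
Lemma ge0_FTC2_oo (a b : R) : a < b ->
  (forall x : R, a < x < b -> {for x, continuous f} /\ is_derive x (1 : R) Phi (f x)) ->
  (\int[mu]_(x in `[a, b]) (f x)%:E = (Phi b - Phi a)%:E)%E.
Proof.
move=> ab df; have ab0 : 0 < b - a by rewrite subr_gt0.
have mfE (D : set R) : measurable_fun D (EFin \o f : measurableTypeR R -> _).
  by apply/measurable_EFinP; exact: measurable_funTS.
rewrite (integral_itv_bndoo true false)// -shrinking_itv_bigcup//.
pose F n := `[a + (b - a) / n.+3%:R, b - (b - a) / n.+3%:R]%classic.
have dd n : (b - a) / n.+3%:R <= (b - a) / 3.
  by rewrite ler_pM2l// lef_pV2 ?posrE// ler_nat.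
have d0 n : 0 < (b - a) / n.+3%:R by rewrite divr_gt0.
have ndF : nondecreasing_seq F.
  move=> m n mn; apply/subsetPset => x; rewrite /F !set_itvccE => /andP[h1 h2].
  have h : (b - a) / n.+3%:R <= (b - a) / m.+3%:R.
    by rewrite ler_pM2l// lef_pV2 ?posrE// ler_nat.
  apply/andP; split.
    by apply: le_trans h1; rewrite lerD2l.
  by apply: le_trans h2 _; rewrite lerD2l lerN2.
have c1 : (\int[mu]_(x in F i) (f x)%:E @[i --> \oo] --> \int[mu]_(x in \bigcup_i F i) (f x)%:E)%E.
  apply: ge0_nondecreasing_set_cvg_integral => //.
  - by move=> i; exact: measurable_itv.
  - by move=> i; exact: mfE.
  - by move=> i x _; rewrite lee_fin.
apply: (cvg_unique (@ereal_hausdorff _) c1) => /=.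
have intF n : (\int[mu]_(x in F n) (f x)%:E =
    (Phi (b - (b - a) / n.+3%:R) - Phi (a + (b - a) / n.+3%:R))%:E)%E.
  have := d0 n; have := dd n; rewrite /F; move: ((b - a) / n.+3%:R) => d h h0.
  rewrite EFinB; apply: continuous_FTC2.
  - by lra.
  - apply: continuous_in_subspaceT => x; rewrite inE set_itvccE => /andP[h1 h2].
    by have [] := df x; first by apply/andP; split; lra.
  - split.
    + move=> x; rewrite in_itv/= => /andP[h1 h2].
      by have [|_ []] := df x; first by apply/andP; split; lra.
    + by apply: cvg_at_right_filter; exact: cPhi.
    + by apply: cvg_at_left_filter; exact: cPhi.
  - move=> x; rewrite in_itv/= => /andP[h1 h2]; rewrite derive1E.
    by have [|_ []] := df x; first by apply/andP; split; lra.
rewrite (eq_cvg _ _ intF).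
apply: cvg_EFin; first by near=> n.
rewrite /comp/=.
have cd : ((b - a) / n.+3%:R) @[n --> \oo] --> (0 : R).
  rewrite -[0](mulr0 (b - a)); apply: cvgMr.
  have := @cvg_harmonic R; rewrite -(cvg_shiftn 2); apply: cvg_trans.
  by apply: near_eq_cvg; near=> n; rewrite /harmonic/= addn2.
have cc (u : nat -> R) (l : R) : u n @[n --> \oo] --> l -> Phi (u n) @[n --> \oo] --> Phi l.
  by move=> ul; apply: cvg_comp; [exact: ul|exact: cPhi].
apply: cvgB; apply: cc.
- rewrite -[X in _ --> X](subr0 b); apply: cvgB => //; exact: cvg_cst.
- rewrite -[X in _ --> X](addr0 a); apply: cvgD => //; exact: cvg_cst.
Unshelve. all: by end_near. Qed.

Lemma ge0_FTC2_exceptions (s : seq R) (a b : R) : a <= b ->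
  (forall x, x \notin s -> {for x, continuous f} /\ is_derive x (1 : R) Phi (f x)) ->
  (\int[mu]_(x in `[a, b]) (f x)%:E = (Phi b - Phi a)%:E)%E.
Proof.
move=> + df.
have : forall x, a < x < b -> x \notin s ->
    {for x, continuous f} /\ is_derive x (1 : R) Phi (f x).
  by move=> x _; exact: df.
elim: s a b {df} => [|c s IH] a b df; rewrite le_eqVlt => /predU1P[->|ab].
- by rewrite set_itv1 integral_set1 subrr.
- by apply: ge0_FTC2_oo => // x xab; exact: df.
- by rewrite set_itv1 integral_set1 subrr.
have mfE (D : set R) : measurable_fun D (EFin \o f : measurableTypeR R -> _).
  by apply/measurable_EFinP; exact: measurable_funTS.
have [/andP[ac cb]|ncab] := boolP (a < c < b); last first.
  apply: IH; last exact: ltW.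
  move=> x xab xs; apply: df => //; rewrite inE negb_or xs andbT.
  by apply: contraNneq ncab => <-.
have e1 : (\int[mu]_(x in `[a, c]) (f x)%:E = (Phi c - Phi a)%:E)%E.
  apply: IH; last exact: ltW.
  move=> x /andP[ax xc] xs; apply: df; first by rewrite ax (lt_trans xc cb).
  by rewrite inE negb_or xs andbT lt_eqF.
have e2 : (\int[mu]_(x in `[c, b]) (f x)%:E = (Phi b - Phi c)%:E)%E.
  apply: IH; last exact: ltW.
  move=> x /andP[cx xb] xs; apply: df; first by rewrite xb (lt_trans ac cx).
  by rewrite inE negb_or xs andbT gt_eqF.
rewrite (@itv_bndbnd_setU _ _ (BLeft a) (BRight c) (BRight b)); last 2 first.
  by rewrite bnd_simp ltW.
  by rewrite bnd_simp ltW.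
rewrite ge0_integral_setU//=; last 3 first.
- exact: mfE.
- by move=> x _; rewrite lee_fin.
- apply/disj_setPS => x [/=]; rewrite !in_itv/= => /andP[_ xc] /andP[].
  by rewrite ltNge xc.
rewrite e1 integral_itv_obnd_cbnd// e2 -EFinD; congr (_%:E); ring.
Qed.

End FTCExceptions.

Lemma itv_notin_seq (R : realFieldType) (s : seq R) (a b : R) : a < b ->
  exists2 t, t \in `]a, b[ & t \notin s.
Proof.
elim: s a b => [|c s IH] a b ab.
  by exists ((a + b) / 2) => //; rewrite mid_in_itvoo.
have hm : a < (a + b) / 2 < b by rewrite midf_lt ?midf_lt//; lra.
have [cm|cm] := leP c ((a + b) / 2).
  have [|t] := IH ((a + b) / 2) b; first by case/andP: hm.
  rewrite in_itv/= => /andP[t1 t2] ts; exists t; first by rewrite in_itv/= t2 andbT; lra.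
  by rewrite inE negb_or ts andbT gt_eqF// (le_lt_trans cm).
have [|t] := IH a ((a + b) / 2); first by case/andP: hm.
rewrite in_itv/= => /andP[t1 t2] ts; exists t; first by rewrite in_itv/= t1/=; lra.
by rewrite inE negb_or ts andbT lt_eqF// (lt_trans t2).
Qed.

Section AlphaPhi.
Variable R : realType.
Implicit Types x y t : R.
Let mu := @lebesgue_measure R.
Let f := @alpha_integrand R.

Lemma alpha_integrand_ge0 t : 0 <= f t.
Proof.
rewrite /f /alpha_integrand divr_ge0 ?(ltW (onePsqr_gt0 t))//.
by rewrite -[4%N]/(2 * 2)%N exprM sqr_ge0.
Qed.

Lemma alpha_integrand_gt0 t : W t 1 != 0 -> 0 < f t.
Proof.
move=> Wt; rewrite /f /alpha_integrand divr_gt0 ?onePsqr_gt0//.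
by rewrite -[4%N]/(2 * 2)%N exprM exprn_even_gt0//= expf_neq0// root5_eq0.
Qed.

Lemma continuous_alpha_integrand t : W t 1 != 0 -> {for t, continuous f}.
Proof.
move=> Wt; rewrite /f /alpha_integrand.
apply: (@cvgM _ _ _ _ (fun t => t ^+ 2 + 1) (fun t => (root5 (W t 1) ^+ 4)^-1)).
  by apply: cvgD; [exact: exprn_continuous|exact: cvg_cst].
apply: cvgV; first by rewrite expf_neq0// root5_eq0.
apply: (@continuous_comp _ _ _ (fun t => root5 (W t 1)) (fun x => x ^+ 4)); last exact: exprn_continuous.
exact: continuous_rootW.
Qed.

Lemma measurable_alpha_integrand : measurable_fun setT f.
Proof.
pose A := [set t : R | W t 1 != 0].
have oA : open A.
  have := @open_comp _ _ (fun t : R => W t 1) [set x | x != 0].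
  by apply; [move=> x _; exact: continuous_W1|exact: open_neq].
have mA : measurable A by exact: open_measurable.
rewrite -(setUv A); apply/measurable_funU => //; first exact: measurableC.
split.
  apply: open_continuous_measurable_fun => // t; rewrite inE; exact: continuous_alpha_integrand.
apply: (@eq_measurable_fun _ _ (measurableTypeR R) (measurableTypeR R) _ (cst 0)); last exact: measurable_cst.
move=> t; rewrite inE /A /= => /negP; rewrite negbK => /eqP Wt.
by rewrite /f /alpha_integrand Wt root50 expr0n invr0 mulr0.
Qed.

Lemma integrable_oneDsqrV : mu.-integrable setT (EFin \o (fun x : R => (oneDsqr x)^-1)).
Proof.
have c : continuous (fun x : R => (oneDsqr x)^-1) by exact: continuous_oneDsqrV.
have p x : 0 <= (oneDsqr x : R)^-1 by rewrite invr_ge0 (le_trans _ (oneDsqr_ge1 x)).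
apply/integrableP; split.
  by apply/measurable_EFinP; exact: continuous_measurable_fun.
under eq_integral do rewrite /= ger0_norm//.
rewrite ge0_symfun_integralT//.
  by rewrite -set_itvcy integral0y_oneDsqr ltry.
by move=> x; rewrite /= /oneDsqr sqrrN.
Qed.

Lemma measurable_alpha_rest : measurable_fun setT (EFin \o @alpha_rest R : measurableTypeR R -> _).
Proof.
apply/measurable_EFinP; apply: continuous_measurable_fun; exact: continuous_alpha_rest.
Qed.

Lemma integrable_alpha_rest : mu.-integrable setT (EFin \o @alpha_rest R).
Proof.
pose g (x : R) : R := (oneDsqr x)^-1.
have h : mu.-integrable setT (fun x => 24%:E * (EFin \o g) x)%E.
  by apply: integrableZl => //; exact: integrable_oneDsqrV.
apply: le_integrable h => //.
  exact: measurable_alpha_rest.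
move=> x _ /=; rewrite lee_fin ger0_norm ?alpha_rest_ge0//.
apply: le_trans (alpha_rest_le x) _; rewrite /oneDsqr. exact: ler_norm.
Qed.

Definition Phi t : R := alpha_elem t + \int[mu]_(x in `]-oo, t]) alpha_rest x.

Let PhiR t : is_derive t (1 : R) (fun t => \int[mu]_(x in `]-oo, t]) alpha_rest x) (alpha_rest t).
Proof.
have lt1 : t < t + 1 by rewrite ltrDl.
have iR : mu.-integrable `]-oo, t + 1] (EFin \o @alpha_rest R).
  exact: (integrableS _ _ _ integrable_alpha_rest).
have [h1 h2] := continuous_FTC1 lt1 iR (ltNyr _) (@continuous_alpha_rest R t).
by split; [exact: h1|rewrite -derive1E].
Qed.

Lemma continuous_Phi : continuous Phi.
Proof.
move=> t; apply: cvgD; first exact: continuous_alpha_elem.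
exact: (is_derive_continuous (PhiR t)).
Qed.

Lemma is_derive_Phi t : W t 1 != 0 -> is_derive t (1 : R) Phi (f t).
Proof.
move=> Wt; have := is_deriveD (is_derive_alpha_elem Wt) (PhiR t).
by rewrite subrK.
Qed.

Lemma Phi_bounded : exists M : R, forall t, `|Phi t| <= M.
Proof.
exists (1 + fine (\int[mu]_x (EFin \o @alpha_rest R) x)%E) => t.
apply: le_trans (ler_normD _ _) _; apply: lerD; first exact: alpha_elem_le1.
rewrite ger0_norm; last by apply: Rintegral_ge0 => x _; exact: alpha_rest_ge0.
apply: fine_le.
- apply: integrable_fin_num => //; exact: integrableS integrable_alpha_rest.
- exact: integrable_fin_num integrable_alpha_rest.
apply: ge0_subset_integral => //.
  exact: measurable_alpha_rest.
by move=> x _; rewrite lee_fin alpha_rest_ge0.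
Qed.

Lemma integral_alpha a b : a <= b ->
  (\int[mu]_(x in `[a, b]) (f x)%:E = (Phi b - Phi a)%:E)%E.
Proof.
have [s sP] := W_roots R.
move=> ab; apply: (ge0_FTC2_exceptions alpha_integrand_ge0 measurable_alpha_integrand continuous_Phi (s := s)) => //.
move=> x xs; have Wx : W x 1 != 0 by apply: contraNneq xs => /sP.
by split; [exact: continuous_alpha_integrand|exact: is_derive_Phi].
Qed.

(** Phi is nondecreasing because it integrates a nonnegative function.  If it were
    constant on an interval, its derivative would vanish at a point of the interval
    that is not a zero of W, where the integrand is positive. *)
Lemma Phi_incr a b : a < b -> Phi a < Phi b.
Proof.
have nd x y : x <= y -> Phi x <= Phi y.
  move=> xy; rewrite -subr_ge0 -lee_fin -integral_alpha//.
  by apply: integral_ge0 => z _; rewrite lee_fin alpha_integrand_ge0.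
move=> ab; rewrite lt_neqAle nd ?ltW// andbT; apply/eqP => Pab.
have [s sP] := W_roots R.
have [t tab ts] := itv_notin_seq s ab.
have Wt : W t 1 != 0 by apply: contraNneq ts => /sP.
have := alpha_integrand_gt0 Wt; have [_ <-] := is_derive_Phi Wt.
rewrite (_ : 'D_1 Phi t = 'D_1 (cst (Phi a)) t); first by rewrite derive_cst ltxx.
apply: (@near_eq_derive R R R Phi (cst (Phi a)) t 1); have := near_in_itvoo tab.
apply: filterS => z; rewrite in_itv/= => /andP[az zb].
by apply/eqP; rewrite eq_le {1}Pab !nd// ltW.
Qed.

Lemma Phi_le a b : a <= b -> Phi a <= Phi b.
Proof. by rewrite le_eqVlt => /predU1P[->//|/Phi_incr/ltW]. Qed.

Lemma Phi_inj : injective Phi.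
Proof. by move=> a b; case: (ltgtP a b) => // /Phi_incr; rewrite lt_neqAle => /andP[/eqP h _] e; case: h. Qed.

Let mfE (D : set R) : measurable_fun D (EFin \o f : measurableTypeR R -> _).
Proof. by apply/measurable_EFinP; exact: (measurable_funTS measurable_alpha_integrand). Qed.

(** The integrals over unbounded sets are limits of increments of Phi; as Phi is
    bounded, this makes the integrand integrable on the line. *)
Lemma cvg_integral_alpha (a b : R^nat) (D : set R) :
  nondecreasing_seq (fun n => `[a n, b n]%classic : set R) ->
  (forall n, a n <= b n) ->
  \bigcup_n `[a n, b n]%classic = D ->
  ((Phi (b n) - Phi (a n))%:E @[n --> \oo] --> \int[mu]_(x in D) (f x)%:E)%E.
Proof.
move=> nd ab <-.
have c1 : (\int[mu]_(x in `[a i, b i]) (f x)%:E @[i --> \oo] --> \int[mu]_(x in \bigcup_i `[a i, b i]%classic) (f x)%:E)%E.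
  apply: ge0_nondecreasing_set_cvg_integral => //.
  - by move=> i; exact: mfE.
  - by move=> i x _; rewrite lee_fin alpha_integrand_ge0.
move: c1; rewrite (@eq_cvg _ _ _ _ (fun n => (Phi (b n) - Phi (a n))%:E)) // => n.
exact: integral_alpha.
Qed.

Lemma itv_sym_bigcup : \bigcup_n `[- n%:R, n%:R]%classic = [set: R].
Proof.
apply/seteqP; split => // x _; exists (Num.truncn `|x|).+1 => //.
rewrite set_itvccE; rewrite -ler_norml; exact/ltW/truncnS_gt.
Qed.

Lemma itv_right_bigcup (c : R) : \bigcup_n `[c, c + n%:R]%classic = `[c, +oo[%classic.
Proof.
apply/seteqP; split => x.
  by move=> [n _]; rewrite set_itvccE /= in_itv/= andbT => /andP[].
rewrite /= in_itv/= andbT => cx.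
exists (Num.truncn `|x - c|).+1 => //; rewrite set_itvccE cx/= -lerBlDl.
apply: le_trans (ler_norm _) _; exact/ltW/truncnS_gt.
Qed.

Lemma nd_itv_sym : nondecreasing_seq (fun n => `[- n%:R, n%:R]%classic : set R).
Proof.
move=> m n mn; apply/subsetPset => x; rewrite !set_itvccE => /andP[h1 h2].
have h : m%:R <= n%:R :> R by rewrite ler_nat.
by rewrite (le_trans _ h1) ?lerN2// (le_trans h2).
Qed.

Lemma nd_itv_right (c : R) : nondecreasing_seq (fun n => `[c, c + n%:R]%classic : set R).
Proof.
move=> m n mn; apply/subsetPset => x; rewrite !set_itvccE => /andP[-> h2]/=.
by apply: le_trans h2 _; rewrite lerD2l ler_nat.
Qed.

Lemma integrable_alpha : mu.-integrable setT (EFin \o f).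
Proof.
apply/integrableP; split; first exact: mfE.
under eq_integral do rewrite /= ger0_norm ?alpha_integrand_ge0//.
have [M PM] := Phi_bounded.
have c := cvg_integral_alpha nd_itv_sym _ itv_sym_bigcup.
have {}c := c (fun n => (@ge0_cp _ n%:R (ler0n _ _)).2).
apply: (@le_lt_trans _ _ (2 * M)%:E); last exact: ltry.
rewrite -(cvg_lim _ c)//; apply: lime_le; first by apply/cvg_ex; eexists; exact: c.
near=> n; rewrite lee_fin; have := PM n%:R; have := PM (- n%:R).
by rewrite !ler_norml => /andP[h1 h2] /andP[h3 h4]; lra.
Unshelve. all: by end_near. Qed.

Lemma alpha_Some x : alpha (Some x) = Phi x - Phi 1.
Proof.
rewrite /alpha /Rintegral; case: ifPn => [h|]; first by rewrite integral_alpha.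
by rewrite -ltNge => /ltW h; rewrite integral_alpha//= opprB.
Qed.

Lemma cvg_Phi_pinfty : Phi (1 + n%:R) @[n --> \oo] --> Phi 1 + alpha None.
Proof.
have c := cvg_integral_alpha (nd_itv_right 1) _ (itv_right_bigcup 1).
have {c} : ((Phi (1 + n%:R) - Phi 1) @[n --> \oo] --> alpha (None : option R)).
  rewrite /alpha /Rintegral; apply: (@fine_cvg _ _ _ _ (fun n => (Phi (1 + n%:R) - Phi 1)%:E)).
  rewrite fineK.
    by apply: c => n; rewrite lerDl.
  by apply: integrable_fin_num => //; exact: integrableS integrable_alpha.
move=> /(cvgD (cvg_cst (Phi 1))); apply: cvg_trans; apply: near_eq_cvg; near=> n.
by rewrite /= addrC subrK.
Unshelve. all: by end_near. Qed.

Lemma cvg_Phi_sym : (Phi n%:R - Phi (- n%:R)) @[n --> \oo] --> 5 * Omega R.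
Proof.
have c := cvg_integral_alpha nd_itv_sym _ itv_sym_bigcup.
rewrite /Omega mulrA divff// mul1r /Rintegral; apply: (@fine_cvg _ _ _ _ (fun n => (Phi n%:R - Phi (- n%:R))%:E)).
rewrite fineK.
  by apply: c => n; rewrite ge0_cp.
by apply: integrable_fin_num => //; exact: integrable_alpha.
Qed.

Lemma Phi_lt_pinfty x : Phi x < Phi 1 + alpha None.
Proof.
apply: (@lt_le_trans _ _ (Phi (x + 1))); first by rewrite Phi_incr ?ltrDl.
apply: (cvgr_to_ge cvg_Phi_pinfty); near=> n; apply: Phi_le.
rewrite addrC lerD2l; near: n; exact: nbhs_infty_ger.
Unshelve. all: by end_near. Qed.

Lemma cvg_Phi_ninfty : Phi (- n%:R) @[n --> \oo] --> Phi 1 + alpha None - 5 * Omega R.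
Proof.
have c : Phi n%:R @[n --> \oo] --> Phi 1 + alpha None.
  rewrite -(cvg_shiftS (fun n => Phi n%:R)); apply: cvg_trans cvg_Phi_pinfty.
  by apply: near_eq_cvg; near=> n; rewrite /= -natr1 addrC.
have : (Phi n%:R - (Phi n%:R - Phi (- n%:R))) @[n --> \oo] --> Phi 1 + alpha None - 5 * Omega R.
  by apply: cvgB c cvg_Phi_sym.
apply: cvg_trans; apply: near_eq_cvg; near=> n.
by rewrite /= opprB addrC subrK.
Unshelve. all: by end_near. Qed.

Lemma Phi_gt_ninfty x : Phi 1 + alpha None - 5 * Omega R < Phi x.
Proof.
apply: (@le_lt_trans _ _ (Phi (x - 1))); last by rewrite Phi_incr ?gtrBl.
apply: (cvgr_to_le cvg_Phi_ninfty); near=> n; apply: Phi_le.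
by rewrite lerNl; near: n; exact: nbhs_infty_ger.
Unshelve. all: by end_near. Qed.

Lemma Phi_surj v : Phi 1 + alpha None - 5 * Omega R < v < Phi 1 + alpha None ->
  exists x, Phi x = v.
Proof.
case/andP => v1 v2.
have [a Pa] : exists a, Phi a <= v.
  have : \forall n \near \oo, Phi (- n%:R) <= v by exact: cvgr_le cvg_Phi_ninfty _ v1.
  by move=> /filter_ex[n ?]; exists (- n%:R).
have [b Pb] : exists b, v <= Phi b.
  have : \forall n \near \oo, v <= Phi (1 + n%:R) by exact: cvgr_ge cvg_Phi_pinfty _ v2.
  by move=> /filter_ex[n ?]; exists (1 + n%:R).
have ab : a <= b by rewrite leNgt; apply/negP => /Phi_incr; rewrite ltNge (le_trans Pa Pb).
have [|x _ <-] := @IVT R Phi a b v ab (continuous_subspaceT continuous_Phi).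
  by rewrite ge_min Pa/= le_max Pb orbT.
by exists x.
Qed.

End AlphaPhi.

(** * The inverse function k of alpha *)
Lemma const_off_seq (R : realType) (s : seq R) (f : R -> R) (a b : R) : a <= b ->
  (forall x, a <= x <= b -> {for x, continuous f}) ->
  (forall x, a < x < b -> x \notin s -> is_derive x (1 : R) f 0) -> f a = f b.
Proof.
elim: s a b => [|c s IH] a b ab cf df.
  move: ab; rewrite le_eqVlt => /predU1P[->//|ab].
  have [||x _] := @MVT R f (cst 0) a b ab.
  - by move=> x; rewrite in_itv/= => xab; exact: df.
  - by apply: continuous_in_subspaceT => x; rewrite inE set_itvccE; exact: cf.
  - by rewrite /cst mul0r => /eqP; rewrite subr_eq0 => /eqP.
have [/andP[ac cb]|ncab] := boolP (a < c < b); last first.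
  apply: IH => // x xab xs; apply: df => //.
  by rewrite inE negb_or xs andbT; apply: contraNneq ncab => <-.
transitivity (f c); apply: IH.
- exact: ltW.
- by move=> x /andP[ax xc]; apply: cf; rewrite ax (le_trans xc)// ltW.
- move=> x /andP[ax xc] xs; apply: df; first by rewrite ax (lt_trans xc).
  by rewrite inE negb_or xs lt_eqF.
- exact: ltW.
- by move=> x /andP[cx xb]; apply: cf; rewrite xb andbT (le_trans _ cx)// ltW.
- move=> x /andP[cx xb] xs; apply: df; first by rewrite xb andbT (lt_trans ac).
  by rewrite inE negb_or xs gt_eqF.
Qed.

(** The difference quotient at a is, by the mean value theorem, a value of h at a
    nearby point other than a.  This crosses the zeros of W, where alpha is not
    differentiable but its inverse is. *)
Lemma is_derive_of_limit (R : realType) (f h : R -> R) (a : R) :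
  (\forall s \near a, {for s, continuous f}) ->
  (\forall s \near a, s != a -> is_derive s (1 : R) f (h s)) ->
  {for a, continuous h} -> is_derive a (1 : R) f (h a).
Proof.
move=> cf df ch.
suff L : (fun k : R => k^-1 *: ((f \o shift a) (k *: 1) - f a)) k @[k --> 0^'] --> h a.
  by split; [apply/cvg_ex; exists (h a)|apply: cvg_lim].
have /nbhs_ballP[d1 /= d10 B1] := cf; have /nbhs_ballP[d2 /= d20 B2] := df.
apply/cvgrPdist_lt => e e0.
have /cvgrPdist_lt/(_ _ e0)/nbhs_ballP[d3 /= d30 B3] := ch.
near=> k; have k0 : k != 0 by near: k; exact: nbhs_dnbhs_neq.
have [kd1 kd2 kd3] : [/\ `|k| < d1, `|k| < d2 & `|k| < d3].
  by split; near: k; exact: dnbhs0_lt.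
have [c [ck ca eqc]] : exists c, [/\ `|a - c| <= `|k|, c != a & f (k + a) - f a = h c * k].
  have B z : `|a - z| <= `|k| -> {for z, continuous f}.
    by move=> zk; apply: B1; rewrite /ball/= (le_lt_trans zk).
  have B' z : `|a - z| <= `|k| -> z != a -> is_derive z (1 : R) f (h z).
    by move=> zk; apply: B2; rewrite /ball/= (le_lt_trans zk).
  have [kp|kn|kz] := ltgtP 0 k; last by rewrite -kz eqxx in k0.
  - have [|||c] := @MVT R f h a (k + a); first by rewrite ltrDr.
    + move=> x; rewrite in_itv/= => /andP[ax xk]; apply: B'; last by rewrite gt_eqF.
      by rewrite ltr0_norm ?subr_lt0// gtr0_norm//; lra.
    + apply: continuous_in_subspaceT => x; rewrite inE set_itvccE => /andP[ax xk].
      by apply: B; rewrite ler0_norm ?subr_le0// gtr0_norm//; lra.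
    rewrite in_itv/= => /andP[ac ck] E; exists c; split; last by rewrite E addrK.
      by rewrite ltr0_norm ?subr_lt0// gtr0_norm//; lra.
    by rewrite gt_eqF.
  - have [|||c] := @MVT R f h (k + a) a; first by rewrite gtrDr.
    + move=> x; rewrite in_itv/= => /andP[ax xk]; apply: B'; last by rewrite lt_eqF.
      by rewrite gtr0_norm ?subr_gt0// ltr0_norm//; lra.
    + apply: continuous_in_subspaceT => x; rewrite inE set_itvccE => /andP[ax xk].
      by apply: B; rewrite ger0_norm ?subr_ge0// ltr0_norm//; lra.
    rewrite in_itv/= => /andP[ac ck] E; exists c; split.
    + by rewrite gtr0_norm ?subr_gt0// ltr0_norm//; lra.
    + by rewrite lt_eqF.
    + by apply: oppr_inj; rewrite opprB E; ring.
rewrite /= /GRing.scale/= mulr1 eqc mulrC mulfK//.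
by apply: B3; rewrite /ball/= (le_lt_trans ck).
Unshelve. all: by end_near. Qed.

Lemma near_seq_eq (R : realType) (s : seq R) (x : R) : \forall y \near x, y \in s -> y = x.
Proof.
elim: s => [|c s IH]; first by near=> y.
have [->|cx] := eqVneq c x.
  by near=> y; rewrite inE => /orP[/eqP//|]; near: y.
near=> y; rewrite inE => /orP[yc|]; last by near: y.
exfalso; move: yc; apply/negP; near: y.
apply: open_nbhs_nbhs; split; last by rewrite /= eq_sym.
exact: open_neq.
Unshelve. all: by end_near. Qed.

Arguments alpha : simpl never.

Section AlphaInverse.
Variable R : realType.
Implicit Types (x y s t : R) (X Y : option R).
Notation P := (5 * Omega R).

(** The values of alpha fill one period: the half-open interval of length 5 Omega whose
    closed end is the value at infinity. *)
Lemma alpha_bounds X : alpha None - P < alpha X <= alpha None.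
Proof.
have h x : alpha None - P < alpha (Some x) < alpha None.
  have := Phi_gt_ninfty x; have := Phi_lt_pinfty x; rewrite alpha_Some => h1 h2.
  by apply/andP; split; lra.
case: X => [x|]; first by case/andP: (h x) => -> /ltW.
rewrite lexx andbT; case/andP: (h 0) => a b; exact: lt_trans a b.
Qed.

Lemma period_gt0 : 0 < P.
Proof. by have /andP[] := alpha_bounds None; rewrite ltrBlDr ltrDl. Qed.

Lemma alpha_inj : injective (@alpha R).
Proof.
have h x : alpha (Some x) != alpha (None : option R).
  by rewrite lt_eqF// alpha_Some; have := Phi_lt_pinfty x; lra.
case=> [x|] [y|] //.
- by rewrite !alpha_Some => /(@addIr _ _ _ _)/Phi_inj ->.
- by move=> /eqP; rewrite (negbTE (h x)).
- by move=> /eqP; rewrite eq_sym (negbTE (h y)).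
Qed.

Lemma alpha_mod_inj X Y (m : int) : alpha X = alpha Y + m%:~R * P -> X = Y.
Proof.
move=> E; have /andP[x1 x2] := alpha_bounds X; have /andP[y1 y2] := alpha_bounds Y.
have p0 := period_gt0; apply: alpha_inj; rewrite E.
suff -> : m = 0 by rewrite mul0r addr0.
have mP : `|m%:~R * P| < P by rewrite ltr_norml; apply/andP; split; lra.
move: mP; rewrite normrM (gtr0_norm p0) gtr_pMl// -intr_norm.
by rewrite -[1]/(1%:~R) ltr_int => h; apply/eqP; rewrite -normr_eq0; lia.
Qed.

Lemma alpha_surj s : exists X (m : int), s = alpha X + m%:~R * P.
Proof.
have p0 := period_gt0.
pose m := Num.ceil ((s - alpha None) / P).
have m1 : (s - alpha None) <= m%:~R * P by rewrite -ler_pdivrMr//; exact: ceil_ge.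
have m2 : (m%:~R - 1) * P < (s - alpha None).
  by rewrite -ltr_pdivlMr//; have := ceilB1_lt ((s - alpha None) / P); rewrite intrB.
have [e|ne] := eqVneq (s - m%:~R * P) (alpha None).
  by exists None, m; rewrite -e subrK.
have [|x Px] := @Phi_surj R (s - m%:~R * P + Phi 1).
  by move: ne; rewrite neq_lt => /orP[]; lra.
by exists (Some x), m; rewrite alpha_Some Px; ring.
Qed.

Lemma kfunP s : exists m : int, s = alpha (kfun s) + m%:~R * P.
Proof.
have [X [m sX]] := alpha_surj s.
rewrite /kfun; case: xgetP => [Y _ //|/(_ X)]; case; by exists m.
Qed.

Lemma kfun_mod X (m : int) : kfun (alpha X + m%:~R * P) = X.
Proof.
have [n] := kfunP (alpha X + m%:~R * P) => E.
apply/esym/(@alpha_mod_inj _ _ (n - m)); rewrite intrB mulrBl addrA -E; ring.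
Qed.

Lemma alphaK X : kfun (alpha X) = X.
Proof. by have := kfun_mod X 0; rewrite mul0r addr0. Qed.

Lemma kfun_periodic s (m : int) : kfun (s + m%:~R * P) = kfun s.
Proof.
have [n ->] := kfunP s; rewrite -addrA -mulrDl -intrD !kfun_mod//.
Qed.

(** The value of k' where k takes the value x. *)
Definition kslope x : R := root5 (W x 1) ^+ 4 / (x ^+ 2 + 1).

Lemma continuous_kslope : continuous kslope.
Proof.
move=> x; apply: cvgM.
  apply: (@continuous_comp _ _ _ (fun t => root5 (W t 1)) (fun x => x ^+ 4)); last exact: exprn_continuous.
  exact: continuous_rootW.
apply: cvgV; first by rewrite gt_eqF// onePsqr_gt0.
by apply: cvgD; [exact: exprn_continuous|exact: cvg_cst].
Qed.

Lemma kval_continuous s : kfun s != None -> {near s, continuous (@kval R)}.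
Proof.
have [m] := kfunP s; case: (kfun s) => // x -> _.
apply: (@near_can_continuous R (fun x => alpha (Some x) + m%:~R * P) (@kval R)).
  by near=> z; rewrite /kval kfun_mod.
near=> z; apply: cvgD; last exact: cvg_cst.
under eq_fun do rewrite alpha_Some.
rewrite alpha_Some; apply: cvgB; [exact: continuous_Phi|exact: cvg_cst].
Unshelve. all: by end_near. Qed.

Lemma kfun_near_finite s : kfun s != None ->
  \forall t \near s, kfun t != None.
Proof.
move=> ks.
have [m] := kfunP s; case E: (kfun s) ks => [x|]// _ sx.
have : \forall t \near s, alpha None - P + m%:~R * P < t < alpha None + m%:~R * P.
  apply: near_in_itvoo; rewrite in_itv/=.
  have := Phi_gt_ninfty x; have := Phi_lt_pinfty x; rewrite sx alpha_Some => h1 h2.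
  by apply/andP; split; lra.
apply: filterS => t /andP[t1 t2]; apply/eqP => kt.
have [n] := kfunP t; rewrite kt => tn.
have p0 := period_gt0.
have : (n < m)%R by rewrite -(ltr_int R) -(ltr_pM2r p0); lra.
have : (m - 1 < n)%R by rewrite -(ltr_int R) -(ltr_pM2r p0) intrB; lra.
lia.
Qed.

Lemma kfun_near_inj s : exists2 e : R, 0 < e & forall t u,
  `|t - s| < e -> `|u - s| < e -> kfun t = kfun u -> t = u.
Proof.
have p0 := period_gt0; exists (P / 2); first by rewrite divr_gt0.
move=> t u ts us ktu; have [m tE] := kfunP t; have [n uE] := kfunP u.
have : `|t - u| < P.
  by rewrite -(subrKA s) (splitr P); apply: le_lt_trans (ler_normD _ _) _; rewrite ltrD// distrC.
rewrite tE uE ktu opprD addrACA subrr add0r -mulrBl -intrB.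
rewrite normrM (gtr0_norm p0) gtr_pMl// -intr_norm -[1]/(1%:~R) ltr_int => h.
by have -> : m = n by lia.
Qed.

Lemma kval_near_inj s : kfun s != None -> exists2 e : R, 0 < e & forall t u,
  `|t - s| < e -> `|u - s| < e -> kval t = kval u -> t = u.
Proof.
move=> ks; have [e e0 H] := kfun_near_inj s.
have /nbhs_ballP[d /= d0 D] := kfun_near_finite ks.
exists (Num.min e d); first by rewrite lt_min e0 d0.
move=> t u; rewrite !lt_min => /andP[te td] /andP[ue ud] ktu; apply: H => //.
have : kfun t != None by apply: D; rewrite /ball/= distrC.
have : kfun u != None by apply: D; rewrite /ball/= distrC.
by move: ktu; rewrite /kval; case: (kfun t) => // x; case: (kfun u) => // y /= ->.
Qed.

Lemma kval_W_near s : kfun s != None ->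
  \forall t \near s, t != s -> W (kval t) 1 != 0.
Proof.
move=> ks; have [rs rP] := W_roots R.
have := kval_continuous ks => /nbhs_singleton ck.
have [e e0 E] := kval_near_inj ks.
have : \forall t \near s, kval t \in rs -> kval t = kval s.
  exact: (ck _ (near_seq_eq rs (kval s))).
move=> H; near=> t => ts; apply: contra_neq ts => /rP Wt.
apply: E; last by have -> : kval t = kval s by move: Wt; near: t.
  by rewrite distrC; near: t; exact: nbhsx_ballx.
by rewrite subrr normr0.
Unshelve. all: by end_near. Qed.

(** Where W does not vanish this is the derivative of an inverse function; the zeros
    of W are isolated, and there the formula extends by continuity. *)
Lemma is_derive_kval s : kfun s != None ->
  is_derive s (1 : R) (@kval R) (kslope (kval s)).
Proof.
move=> ks; apply: (@is_derive_of_limit R (@kval R) (kslope \o @kval R) s).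
- exact: kval_continuous.
- near=> t => ts.
  have Wt : W (kval t) 1 != 0 by move: ts; near: t; exact: kval_W_near.
  have : kfun t != None by near: t; exact: kfun_near_finite.
  have [m] := kfunP t; move: Wt; rewrite [kval t]/kval; case: (kfun t) => // x /= Wx tE _.
  rewrite tE; pose F x := alpha (Some x) + m%:~R * P.
  have FE : F = (fun x => Phi x - Phi 1 + m%:~R * P).
    by apply/funext => z; rewrite /F alpha_Some.
  rewrite -/(F x).
  have -> : kslope (kval (F x)) = (alpha_integrand x)^-1.
    rewrite /F [kval _]/kval kfun_mod/=; by rewrite /kslope /alpha_integrand invf_div.
  apply: (@is_derive_inverse R F (@kval R)).
  + by near=> z; rewrite /F [kval _]/kval kfun_mod.
  + near=> z; rewrite FE; apply: cvgD; last exact: cvg_cst.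
    by apply: cvgB; [exact: continuous_Phi|exact: cvg_cst].
  + rewrite FE; have := is_derive_Phi Wx => dP.
    by apply: is_derive_eq; rewrite subr0 addr0.
  + by rewrite gt_eqF// alpha_integrand_gt0.
- apply: continuous_comp; last exact: continuous_kslope.
  by have := kval_continuous ks => /nbhs_singleton.
Unshelve. all: by end_near. Qed.

Lemma kderE s : kfun s != None -> kder s = kslope (kval s).
Proof. by move=> ks; rewrite /kder derive1E; have [_ ->] := is_derive_kval ks. Qed.

(** k' (k^2 + 1) is W(k)^(4/5), whose fourth root is the modulus of W(k)^(1/5). *)
Lemma kdenomE s : kfun s != None -> kdenom s = root5 (W (kval s) 1).
Proof.
move=> ks; rewrite /kdenom kderE//; set w := W _ _.
rewrite -powRM; last 2 first.
- rewrite /kslope divr_ge0 ?(ltW (onePsqr_gt0 _))//.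
  by rewrite -[4%N]/(2 * 2)%N exprM sqr_ge0.
- exact/ltW/onePsqr_gt0.
rewrite /kslope divfK ?gt_eqF ?onePsqr_gt0// -/w.
have -> : root5 w ^+ 4 = `|root5 w| `^ 4.
  by rewrite powR_mulrn// -normrX ger0_norm// -[4%N]/(2 * 2)%N exprM sqr_ge0.
rewrite -powRrM divff ?pnatr_eq0// powRr1// /root5.
have [->|w0] := eqVneq w 0; first by rewrite sgr0 !mul0r.
by rewrite normrM normr_sg w0 mul1r [X in _ * X]ger0_norm ?powR_ge0.
Qed.

Lemma curveD5E (a b : R) :
  (curveD5 R).[b%:P].[a] = (a ^+ 2 + 1) ^+ 5 * b ^+ 5 - W a 1 ^+ 4.
Proof.
rewrite /curveD5 !(hornerD, hornerN, hornerM, hornerC, horner_exp, hornerX, hornerMn).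
by rewrite /W; ring.
Qed.

(** Since a^2 + 1 never vanishes, the real points of the curve form the graph of
    kslope, and k' = kslope (k); so the assertion reduces to k being a local
    homeomorphism, with inverse alpha up to a period. *)
Lemma kcurve_param s0 : kfun s0 != None ->
  local_parametrization (@kval R) (@kder R)
    (fun a b => (curveD5 R).[b%:P].[a] = 0) s0.
Proof.
move=> ks0.
have E (a b : R) : ((curveD5 R).[b%:P].[a] = 0) <-> b = kslope a.
  have T0 := onePsqr_gt0 a; have T0' : a ^+ 2 + 1 != 0 by rewrite gt_eqF.
  rewrite curveD5E; split=> [/eqP|->].
    rewrite subr_eq0 => /eqP h; apply: exp5_inj => /=.
    rewrite /kslope exprMn exprVn -exprM mulnC exprM root5K -h.
    by rewrite mulrC mulKf// expf_neq0.
  rewrite /kslope exprMn exprVn -exprM mulnC exprM root5K mulrCA mulfV ?expf_neq0//.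
  by rewrite mulr1 subrr.
have ck : {for s0, continuous (@kval R)} by have := kval_continuous ks0 => /nbhs_singleton.
have nk := kfun_near_finite ks0.
split.
- by apply: filterS nk => s ks; apply/E; exact: kderE.
- split=> //.
  have c : {for s0, continuous (kslope \o @kval R)}.
    by apply: continuous_comp => //; exact: continuous_kslope.
  suff : kder s @[s --> s0] --> kder s0 by [].
  rewrite kderE//; move: c; apply: cvg_trans; apply: near_eq_cvg.
  by apply: filterS nk => s ks; rewrite kderE.
- have [e e0 H] := kval_near_inj ks0; exists e => // s t se te kst _.
  exact: H.
- move=> e e0.
  have [m] := kfunP s0; case E0: (kfun s0) ks0 => [x0|]// _ s0E.
  pose F x := alpha (Some x) + m%:~R * P.
  have cF : {for x0, continuous F}.
    apply: cvgD; last exact: cvg_cst.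
    under eq_fun do rewrite alpha_Some.
    rewrite alpha_Some; apply: cvgB; [exact: continuous_Phi|exact: cvg_cst].
  have /cvgrPdist_lt/(_ _ e0)/nbhs_ballP[d /= d0 D] := cF.
  exists d => // a b /E bE; rewrite /kval E0 /= => ad _; exists (F a).
  have Fk : kfun (F a) = Some a by rewrite /F kfun_mod.
  split.
  + by rewrite distrC s0E; apply: D; rewrite /ball/= distrC.
  + by rewrite Fk.
  + by rewrite kderE ?Fk// bE /kval Fk.
Qed.

(** The slope y / x in terms of x / y.  The substitution t -> 1 / t maps the integrand
    of alpha to its opposite, so alpha changes sign up to a constant. *)
Definition inv_slope X : option R :=
  match X with
  | None => Some 0
  | Some x => if x == 0 then None else Some x^-1
  end.

Lemma alpha_integrandV x : x != 0 -> alpha_integrand x^-1 = x ^+ 2 * alpha_integrand x.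
Proof.
move=> x0; rewrite /alpha_integrand.
have -> : W x^-1 1 = - (W x 1 / x ^+ 5) by rewrite /W; field.
rewrite root5N root5M -[(x ^+ 5)^-1]exprVn exp5K.
have [Wx|Wx] := eqVneq (W x 1) 0; first by rewrite Wx root50 !(mul0r, oppr0, expr0n, invr0, mulr0).
have : root5 (W x 1) != 0 by rewrite root5_eq0.
by move: (root5 _) => r r0; field; rewrite r0.
Qed.

Lemma W_inv x : x != 0 -> W x 1 != 0 -> W x^-1 1 != 0.
Proof.
move=> x0 Wx; have -> : W x^-1 1 = - (W x 1 / x ^+ 5) by rewrite /W; field.
by rewrite oppr_eq0 mulf_neq0// invr_eq0 expf_neq0.
Qed.

(** The sum has derivative 0 except at the zeros of W.  The interval has to avoid 0,
    where the substitution is singular; the constants on the two half-lines differ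
    by a period. *)
Lemma PhiV_const (a b : R) : a <= b -> (forall x, a <= x <= b -> x != 0) ->
  Phi a + Phi a^-1 = Phi b + Phi b^-1.
Proof.
move=> ab n0; have [s sP] := W_roots R.
apply: (@const_off_seq R s (fun x => Phi x + Phi x^-1) a b ab).
  move=> x xab; apply: cvgD; first exact: continuous_Phi.
  apply: (@continuous_comp _ _ _ (fun x : R => x^-1) (@Phi R)); last exact: continuous_Phi.
  by apply: inv_continuous; exact: n0.
move=> x /andP[ax xb] xs.
have x0 : x != 0 by apply: n0; rewrite !ltW.
have Wx : W x 1 != 0 by apply: contraNneq xs => /sP.
have d1 := is_derive_Phi Wx; have d2 := is_derive_Phi (W_inv x0 Wx).
have di : is_derive x (1 : R) (fun x : R => x^-1) (- x ^- 2).
  have := @is_deriveV R id x 1 1 x0 (is_derive_id _ _); rewrite /GRing.scale/= mulr1; exact.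
have d3 := is_derive1_comp (g := fun x : R => x^-1) d2 di.
have [H1 H2] := is_deriveD d1 d3; split; [exact: H1|apply: (etrans H2)].
by rewrite alpha_integrandV//; field.
Qed.

Lemma PhiV_pos x : 0 < x -> Phi x + Phi x^-1 = 2 * Phi 1.
Proof.
move=> x0; have -> : 2 * Phi 1 = Phi (1 : R) + Phi (1 : R)^-1 by rewrite invr1; ring.
have [x1|x1] := leP x 1.
  by apply: PhiV_const => // y /andP[xy _]; rewrite gt_eqF// (lt_le_trans x0).
apply/esym/PhiV_const; first exact: ltW.
by move=> y /andP[xy _]; rewrite gt_eqF// (lt_le_trans _ xy).
Qed.

(** The constant on the positive half-line, evaluated at 1 and at the limit at infinity. *)
Lemma alpha_None_0 : alpha None = Phi 1 - Phi (0 : R).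
Proof.
have c : (Phi (1 + n%:R) + Phi (1 + n%:R)^-1) @[n --> \oo] --> Phi 1 + alpha None + Phi (0 : R).
  apply: cvgD; first exact: cvg_Phi_pinfty.
  have : (@harmonic R) n @[n --> \oo] --> (0 : R) := @cvg_harmonic R.
  move=> h; have : Phi (harmonic n) @[n --> \oo] --> Phi (0 : R).
    by apply: cvg_comp; [exact: h|exact: continuous_Phi].
  apply: cvg_trans; apply: near_eq_cvg; near=> n.
  by rewrite /harmonic/= [1 + _]addrC natr1.
have c2 : (Phi (1 + n%:R) + Phi (1 + n%:R)^-1) @[n --> \oo] --> 2 * Phi (1 : R).
  have : (fun _ : nat => 2 * Phi (1 : R)) n @[n --> \oo] --> 2 * Phi (1 : R) by exact: cvg_cst.
  apply: cvg_trans; apply: near_eq_cvg; near=> n; by rewrite /= PhiV_pos ?ltr_pwDl.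
have E : Phi 1 + alpha None + Phi 0 = 2 * Phi (1 : R) := cvg_unique (@Rhausdorff R) c c2.
have -> : alpha None = (Phi 1 + alpha None + Phi 0) - Phi 1 - Phi (0 : R) by ring.
rewrite E; ring.
Unshelve. all: by end_near. Qed.

Lemma PhiV_neg x : x < 0 -> Phi x + Phi x^-1 = 2 * Phi 1 - P.
Proof.
move=> x0.
have E y : y < 0 -> Phi y + Phi y^-1 = Phi x + Phi x^-1.
  move=> y0; have [xy|xy] := leP x y.
    by apply/esym/PhiV_const => // z /andP[_ zy]; rewrite lt_eqF// (le_lt_trans zy).
  by apply/PhiV_const; [exact: ltW|move=> z /andP[_ zy]; rewrite lt_eqF// (le_lt_trans zy)].
have c : (Phi (- (1 + n%:R)) + Phi (- (1 + n%:R)^-1)) @[n --> \oo] --> Phi 1 + alpha None - P + Phi (0 : R).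
  apply: cvgD.
    have := @cvg_Phi_ninfty R; rewrite -(cvg_shiftS (fun n => Phi (- n%:R))).
    by apply: cvg_trans; apply: near_eq_cvg; near=> n; rewrite /= -natr1 addrC.
  have : (@harmonic R) n @[n --> \oo] --> (0 : R) := @cvg_harmonic R.
  move=> /cvgN h; have : Phi (- harmonic n) @[n --> \oo] --> Phi (- 0 : R).
    by apply: cvg_comp; [exact: h|exact: continuous_Phi].
  rewrite oppr0; apply: cvg_trans; apply: near_eq_cvg; near=> n.
  by rewrite /harmonic/= [1 + _]addrC natr1.
have c2 : (Phi (- (1 + n%:R)) + Phi (- (1 + n%:R)^-1)) @[n --> \oo] --> Phi x + Phi x^-1.
  have : (fun _ : nat => Phi x + Phi x^-1) n @[n --> \oo] --> Phi x + Phi x^-1 by exact: cvg_cst.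
  apply: cvg_trans; apply: near_eq_cvg; near=> n.
  by rewrite /= -invrN E ?oppr_lt0 ?ltr_pwDl.
rewrite -(cvg_unique (@Rhausdorff R) c c2) alpha_None_0; ring.
Unshelve. all: by end_near. Qed.

Lemma alpha_inv_slope X : exists m : int, alpha (inv_slope X) = - alpha X + m%:~R * P.
Proof.
have h0 : alpha (Some 0) = - alpha (None : option R).
  by rewrite alpha_Some alpha_None_0; ring.
case: X => [x|] /=; last by exists 0; rewrite h0; ring.
case: eqVneq => [->|x0]; first by exists 0; rewrite h0; ring.
rewrite !alpha_Some; move: x0; rewrite neq_lt => /orP[/PhiV_neg|/PhiV_pos] E.
  by exists (-1); rewrite (_ : Phi x^-1 = 2 * Phi 1 - P - Phi x); [ring|rewrite -E; ring].
by exists 0; rewrite (_ : Phi x^-1 = 2 * Phi 1 - Phi x); [ring|rewrite -E; ring].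
Qed.

End AlphaInverse.

(** * Integral curves and their uniqueness *)
Section Plane.
Variable R : realType.
Implicit Types (x y t s a b : R) (p q : 'cV[R]_2) (c : R -> 'cV[R]_2).

Lemma pt0 x y : pt x y 0 0 = x. Proof. by rewrite mxE. Qed.
Lemma pt1 x y : pt x y 1 0 = y. Proof. by rewrite mxE. Qed.

Lemma col2P p q : p 0 0 = q 0 0 -> p 1 0 = q 1 0 -> p = q.
Proof.
move=> h0 h1; apply/colP => i; have [->|->] : i = 0 \/ i = 1; last 2 first; [exact: h0|exact: h1|].
by case: i => -[|[|//]] hi; [left|right]; apply/val_inj.
Qed.

Lemma ptE p : pt (p 0 0) (p 1 0) = p.
Proof. by apply: col2P; rewrite ?pt0 ?pt1. Qed.

Lemma pt_eq0 x y : (pt x y == 0) = (x == 0) && (y == 0).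
Proof.
apply/eqP/andP => [h|[/eqP-> /eqP->]]; last by apply: col2P; rewrite ?pt0 ?pt1 mxE.
by move: (pt0 x y) (pt1 x y); rewrite h !mxE => <- <-.
Qed.

Lemma is_derive_col2 c t p : is_derive t (1 : R) c p <->
  is_derive t (1 : R) (fun t => c t 0 0) (p 0 0) /\
  is_derive t (1 : R) (fun t => c t 1 0) (p 1 0).
Proof.
split=> [[d <-]|[[d0 e0] [d1 e1]]].
  have h := (derivable_mxP c t 1).1 d.
  by split; split; [exact: h|rewrite derive_mx// mxE|exact: h|rewrite derive_mx// mxE].
have d : derivable c t 1.
  apply/derivable_mxP => i j; rewrite (ord1 j).
  have [->|->] : i = 0 \/ i = 1; last 2 first; [exact: d0|exact: d1|].
  by case: i => -[|[|//]] hi; [left|right]; apply/val_inj.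
by split=> //; rewrite derive_mx//; apply: col2P; rewrite !mxE.
Qed.

Lemma is_derive_const_itv (f : R -> R) a b :
  (forall t, a < t < b -> is_derive t (1 : R) f 0) ->
  forall s t, a < s < b -> a < t < b -> f s = f t.
Proof.
move=> df s t; wlog st : s t / s <= t.
  by move=> H sab tab; have [/H->//|/ltW/H->] := leP s t.
move=> /andP[as_ sb] /andP[at_ tb]; apply: (@const_off_seq R [::]) => // x /andP[sx xt].
  by apply: (@is_derive_continuous R f x 0); apply: df; rewrite (lt_le_trans as_)// (le_lt_trans xt).
by move=> _; apply: df; rewrite (lt_trans as_)// (lt_trans xt).
Qed.

Lemma locally_constant (T : Type) (f : R -> T) a b :
  (forall t, a < t < b -> \forall s \near t, f s = f t) ->
  forall s t, a < s < b -> a < t < b -> f s = f t.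
Proof.
move=> lf s t sab tab.
pose g u : R := if `[< f u = f s >] then 1 else 0.
have : g s = g t.
  apply: (@is_derive_const_itv g a b) => // u uab.
  have gu : \forall v \near u, cst (g u) v = g v.
    by apply: filterS (lf u uab) => v fv; rewrite /cst /g fv.
  exact: (near_eq_is_derive gu (is_derive_cst (g u) u 1)).
rewrite /g asboolT//; case: asboolP => // _ /eqP; by rewrite oner_eq0.
Qed.

Lemma is_derive_ext (f g : R -> R) t l : f =1 g ->
  is_derive t (1 : R) f l -> is_derive t (1 : R) g l.
Proof. by move=> /funext ->. Qed.

Definition Q1 x y := (x ^+ 4 + 4 * x ^+ 3 * y - 6 * x ^+ 2 * y ^+ 2 - 4 * x * y ^+ 3 + y ^+ 4)
        / (x ^+ 2 + y ^+ 2).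
Definition Q2 x y := (x ^+ 4 - 4 * x ^+ 3 * y - 6 * x ^+ 2 * y ^+ 2 + 4 * x * y ^+ 3 + y ^+ 4)
        / (x ^+ 2 + y ^+ 2).

Lemma QD5E p : QD5 p = pt (Q1 (p 0 0) (p 1 0)) (Q2 (p 0 0) (p 1 0)).
Proof. by []. Qed.

Lemma Q1_swap x y : Q1 y x = Q2 x y.
Proof. by rewrite /Q1 /Q2 [y ^+ 2 + _]addrC; congr (_ / _); ring. Qed.

Definition swap p : 'cV[R]_2 := pt (p 1 0) (p 0 0).

Lemma swapK : involutive swap.
Proof. by move=> p; apply: col2P; rewrite !mxE. Qed.

Lemma QD5_swap p : QD5 (swap p) = swap (QD5 p).
Proof. rewrite !QD5E /swap !pt0 !pt1.
by rewrite Q1_swap -[Q2 (p 1 0) _]Q1_swap. Qed.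

Lemma W_swap x y : W y x = - W x y.
Proof. by rewrite /W; ring. Qed.

Lemma integral_curve_swap a b c : integral_curve (@QD5 R) a b c ->
  integral_curve (@QD5 R) a b (fun t => swap (c t)).
Proof.
move=> ic t tab; have /is_derive_col2[d0 d1] := ic t tab.
apply/is_derive_col2; rewrite QD5_swap [swap (QD5 _)]/swap pt0 pt1; split.
  by apply: is_derive_ext d1 => z; rewrite [swap _]/swap pt0.
by apply: is_derive_ext d0 => z; rewrite [swap _]/swap pt1.
Qed.

Lemma sqrD_eq0 x y : (x ^+ 2 + y ^+ 2 == 0) = (x == 0) && (y == 0).
Proof. by rewrite paddr_eq0 ?sqr_ge0// !sqrf_eq0. Qed.

Lemma Q00 : Q1 0 0 = 0 /\ Q2 0 0 = 0.
Proof. by rewrite /Q1 /Q2 !expr0n !addr0 !invr0 !mulr0. Qed.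

Lemma is_derive_W2 (x y : R -> R) (t dx dy : R) :
  is_derive t (1 : R) x dx -> is_derive t (1 : R) y dy ->
  is_derive t (1 : R) (fun t => W (x t) (y t))
   (5 * ((x t ^+ 4 - 4 * x t ^+ 3 * y t - 6 * x t ^+ 2 * y t ^+ 2 + 4 * x t * y t ^+ 3 + y t ^+ 4) * dx
    - (x t ^+ 4 + 4 * x t ^+ 3 * y t - 6 * x t ^+ 2 * y t ^+ 2 - 4 * x t * y t ^+ 3 + y t ^+ 4) * dy)).
Proof.
move=> Dx Dy; rewrite /W; apply: is_derive_eq; rewrite /GRing.scale/=.
by ring.
Qed.

Lemma is_derive_W a b c t : integral_curve (@QD5 R) a b c -> a < t < b ->
  is_derive t (1 : R) (fun t => W (c t 0 0) (c t 1 0)) 0.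
Proof.
move=> ic tab; have /is_derive_col2[d0 d1] := ic t tab.
apply: is_derive_eq (is_derive_W2 d0 d1) _; rewrite QD5E pt0 pt1 /Q1 /Q2.
by ring.
Qed.

Lemma W_conserved a b c s t : integral_curve (@QD5 R) a b c -> a < s < b -> a < t < b ->
  W (c s 0 0) (c s 1 0) = W (c t 0 0) (c t 1 0).
Proof.
move=> ic; apply: (@is_derive_const_itv (fun t => W (c t 0 0) (c t 1 0))) => z zab.
exact: is_derive_W ic zab.
Qed.

End Plane.

Section Uniqueness.
Variable R : realType.

(** The function E(t) exp(- L t) is nonincreasing. *)
Lemma gronwall0 (E dE : R -> R) (L T : R) : 0 <= T ->
  (forall t, 0 <= t <= T -> is_derive t (1 : R) E (dE t)) ->
  (forall t, 0 <= t <= T -> dE t <= L * E t) -> E 0 = 0 -> E T <= 0.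
Proof.
rewrite le_eqVlt => /predU1P[<- _ _ ->//|T0] DE leE E0.
pose G t := E t * expR (- L * t).
pose dG t := (dE t - L * E t) * expR (- L * t).
have DG t : 0 <= t <= T -> is_derive t (1 : R) G (dG t).
  move=> /DE De.
  have De2 : is_derive t (1 : R) (fun t : R => expR (- L * t)) (expR (- L * t) * (- L)).
    apply: (@is_derive1_comp R (@expR R) (fun t => - L * t)).
    by apply: is_derive_eq; rewrite /GRing.scale/= mulr1.
  have [H1 H2] := is_deriveM De De2; split; [exact: H1|apply: (etrans H2)].
  by rewrite /dG /GRing.scale/=; ring.
have [||c] := @MVT R G dG 0 T T0.
- by move=> x; rewrite in_itv/= => /andP[x0 xT]; apply: DG; rewrite !ltW.
- apply: continuous_in_subspaceT => x; rewrite inE set_itvccE => xT.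
  exact: is_derive_continuous (DG x xT).
rewrite in_itv/= => /andP[c0 cT]; rewrite {2}/G E0 mul0r subr0 => GT.
have : G T <= 0.
  rewrite GT pmulr_lle0 ?subr_gt0// /dG pmulr_lle0 ?expR_gt0// subr_le0.
  by apply: leE; rewrite !ltW.
by rewrite /G pmulr_lle0// expR_gt0.
Qed.

Import complex.
Local Open Scope complex_scope.

(** The field in the complex coordinate; conj(z)^3 / z is conj(z)^4 / |z|^2, and it
    takes the value 0 at 0. *)
Definition QC (z : R[i]) : R[i] := (1 +i* 1) * z^* ^+ 3 / z.

Lemma QCE (x y : R) : QC (x +i* y) = Q1 x y +i* Q2 x y.
Proof.
have [/andP[/eqP-> /eqP->]|n0] := boolP ((x == 0) && (y == 0)).
  by have [-> ->] := Q00 R; rewrite /QC -[0 +i* 0]/(0 : R[i]) invr0 mulr0.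
have z0 : x +i* y != 0 by rewrite eq_complex.
apply: (mulIf z0); rewrite /QC divfK// !exprS expr0 mulr1.
apply/eqP; rewrite eq_complex /= /Q1 /Q2; apply/andP; split; apply/eqP; field;
  by rewrite sqrD_eq0.
Qed.

Local Notation N := (@ComplexField.Normc.normc R).

Lemma normcJ (z : R[i]) : N z^* = N z.
Proof. by case: z => a b /=; rewrite sqrrN. Qed.

Lemma normc_sqr (x y : R) : N (x +i* y) ^+ 2 = x ^+ 2 + y ^+ 2.
Proof. by rewrite /= sqr_sqrtr// addr_ge0// sqr_ge0. Qed.

Lemma normc_ge0 (z : R[i]) : 0 <= N z.
Proof. by case: z => a b /=; exact: sqrtr_ge0. Qed.

Lemma normcMR (z w : R[i]) : N (z * w) = N z * N w.
Proof. exact: ComplexField.Normc.normcM. Qed.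

Lemma normcVR (z : R[i]) : N z^-1 = (N z)^-1.
Proof. exact: ComplexField.Normc.normcV. Qed.

Lemma le_normcDR (z w : R[i]) : N (z + w) <= N z + N w.
Proof. exact: le_normcD. Qed.

Lemma normcNR (z : R[i]) : N (- z) = N z.
Proof. exact: normcN. Qed.

Lemma normcXR (z : R[i]) n : N (z ^+ n) = N z ^+ n.
Proof.
elim: n => [|n IH]; first exact: ComplexField.Normc.normc1.
by rewrite !exprS normcMR IH.
Qed.

Lemma normc_gt0 (z : R[i]) : z != 0 -> 0 < N z.
Proof.
move=> z0; rewrite lt_neqAle normc_ge0 andbT eq_sym.
by apply: contra z0 => /eqP/ComplexField.Normc.eq0_normc ->.
Qed.

(** The field is homogeneous of degree 2 and Lipschitz on the unit circle, so its
    local Lipschitz constant is proportional to the modulus, even near the origin,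
    where it is not smooth. *)
Lemma QC_lip (z w : R[i]) : N z <= N w ->
  N (QC z - QC w) <= N (1 +i* 1) * 4 * N w * N (z - w).
Proof.
move=> zw; have := normc_ge0 (z - w); have := normc_ge0 (1 +i* 1).
move=> k0 d0.
have -> : QC z - QC w = (1 +i* 1) * (z^* ^+ 3 / z - w^* ^+ 3 / w) by rewrite /QC; ring.
have -> : N (1 +i* 1) * 4 * N w * N (z - w) = N (1 +i* 1) * (4 * N w * N (z - w)) by ring.
rewrite normcMR; apply: ler_wpM2l => //.
have [w0|w0] := eqVneq w 0.
  rewrite w0 invr0 mulr0 subr0; move: zw; rewrite w0 ComplexField.Normc.normc0.
  move=> z0; have /ComplexField.Normc.eq0_normc -> : N z = 0.
    by apply: le_anti; rewrite z0 normc_ge0.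
  by rewrite !(invr0, mulr0, subr0, subrr, ComplexField.Normc.normc0, mul0r).
have nw := normc_gt0 w0.
have [z0|z0] := eqVneq z 0.
  rewrite z0 invr0 mulr0 !sub0r !normcNR normcMR normcVR normcXR normcJ.
  rewrite exprSr mulfK ?gt_eqF// -mulrA -expr2; have := sqr_ge0 (N w); lra.
have nz := normc_gt0 z0.
have -> : z^* ^+ 3 / z - w^* ^+ 3 / w =
  (z^* ^+ 3 * (w - z) + z * ((z^* - w^*) * (z^* ^+ 2 + z^* * w^* + w^* ^+ 2))) / (z * w).
  by field; rewrite z0 w0.
rewrite normcMR normcVR normcMR ler_pdivrMr ?mulr_gt0//.
apply: le_trans (le_normcDR _ _) _; rewrite [N (_ ^+ 3 * _)]normcMR normcXR normcJ.
rewrite [N (z * _)]normcMR [N ((z^* - w^*) * _)]normcMR.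
have -> : N (w - z) = N (z - w) by rewrite -normcNR opprB.
have -> : N (z^* - w^*) = N (z - w) by rewrite -(normcJ (z - w)) rmorphB.
have h : N (z^* ^+ 2 + z^* * w^* + w^* ^+ 2) <= 3 * N w ^+ 2.
  apply: le_trans (le_normcDR _ _) _.
  apply: (@le_trans _ _ (N z ^+ 2 + N z * N w + N w ^+ 2)).
    rewrite normcXR normcJ lerD2r; apply: le_trans (le_normcDR _ _) _.
    by rewrite normcXR normcMR !normcJ.
  have h1 : N z ^+ 2 <= N w ^+ 2 by rewrite ler_pXn2r// nnegrE normc_ge0.
  have h2 : N z * N w <= N w ^+ 2 by rewrite expr2 ler_pM2r.
  by lra.
have h3 : N z ^+ 3 <= N z * N w ^+ 2.
  by rewrite exprS ler_pM2l// ler_pXn2r// nnegrE normc_ge0.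
apply: (@le_trans _ _ (N z * N w ^+ 2 * N (z - w) + N z * (N (z - w) * (3 * N w ^+ 2)))).
  apply: lerD; first by rewrite ler_wpM2r// normc_ge0.
  by rewrite ler_pM2l// ler_wpM2l// normc_ge0.
by rewrite le_eqVlt; apply/orP; left; apply/eqP; ring.
Qed.

Lemma QC_lip2 (z w : R[i]) (M : R) : N z <= M -> N w <= M ->
  N (QC z - QC w) <= N (1 +i* 1) * 4 * M * N (z - w).
Proof.
move=> zM wM; wlog zw : z w zM wM / N z <= N w.
  move=> H; have [/H->//|/ltW/H] := leP (N z) (N w).
  by rewrite -(normcNR (z - w)) -(normcNR (QC _ - _)) !opprB; exact.
apply: le_trans (QC_lip zw) _; rewrite ler_wpM2r ?normc_ge0//.
by rewrite ler_wpM2l// mulr_ge0// normc_ge0.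
Qed.

Let sqn (p : 'cV[R]_2) := p 0 0 ^+ 2 + p 1 0 ^+ 2.

Lemma QD5_lip (p q : 'cV[R]_2) (M : R) : 0 <= M -> sqn p <= M -> sqn q <= M ->
  sqn (QD5 p - QD5 q) <= (N (1 +i* 1) * 4 * (1 + M)) ^+ 2 * sqn (p - q).
Proof.
move=> M0 pM qM.
have B (r : 'cV[R]_2) : sqn r <= M -> N (r 0 0 +i* r 1 0) <= 1 + M.
  rewrite /sqn -normc_sqr => h; have := sqr_ge0 (N (r 0 0 +i* r 1 0) - 1).
  by rewrite sqrrB1; have := normc_ge0 (r 0 0 +i* r 1 0); lra.
have L := QC_lip2 (B p pM) (B q qM).
have k0 : 0 <= N (1 +i* 1) * 4 * (1 + M).
  by rewrite mulr_ge0 ?addr_ge0// mulr_ge0// normc_ge0.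
rewrite !QCE in L.
rewrite /sqn !QD5E !mxE/= -[(Q1 _ _ - _) ^+ 2 + _]normc_sqr -[(p 0 0 - _) ^+ 2 + _]normc_sqr.
by rewrite -exprMn ler_pXn2r// nnegrE ?mulr_ge0 ?normc_ge0// addr_ge0.
Qed.

Lemma QD5_scale (l : R) (p : 'cV[R]_2) : QD5 (l *: p) = l ^+ 2 *: QD5 p.
Proof.
have [->|l0] := eqVneq l 0.
  rewrite scale0r expr0n/= scale0r QD5E !mxE; have [-> ->] := Q00 R.
  by apply/eqP; rewrite pt_eq0 eqxx.
have E x y : (l * x) ^+ 2 + (l * y) ^+ 2 = l ^+ 2 * (x ^+ 2 + y ^+ 2) by ring.
have [/andP[/eqP x0 /eqP y0]|n0] := boolP ((p 0 0 == 0) && (p 1 0 == 0)).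
  have -> : p = 0 by rewrite -(ptE p) x0 y0; apply/eqP; rewrite pt_eq0 eqxx.
  by rewrite scaler0 QD5E !mxE; have [-> ->] := Q00 R; apply: col2P; rewrite !mxE/= mulr0.
move: n0; rewrite -sqrD_eq0 => n0.
rewrite !QD5E; apply: col2P; rewrite !mxE/= /Q1 /Q2 E; move: (_ + _) n0 => r n0.
  by field; rewrite n0.
by field; rewrite n0.
Qed.

Lemma integral_curve_scale (l a b a' b' : R) c :
  (forall t, a' < t < b' -> a < l * t < b) -> integral_curve (@QD5 R) a b c ->
  integral_curve (@QD5 R) a' b' (fun t => l *: c (l * t)).
Proof.
move=> H ic t tab; have /is_derive_col2[d0 d1] := ic _ (H t tab).
have dl : is_derive t (1 : R) (fun t : R => l * t) l.
  by apply: is_derive_eq; rewrite /GRing.scale/= mulr1.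
have e0 := is_derive1_comp (g := fun t : R => l * t) d0 dl.
have e1 := is_derive1_comp (g := fun t : R => l * t) d1 dl.
apply/is_derive_col2; split.
  apply: (@is_derive_ext _ (fun z => l * c (l * z) 0 0)); first by move=> z; rewrite mxE.
  have [H1 H2] := is_deriveZ l e0; split; [exact: H1|apply: (etrans H2)].
  by rewrite QD5_scale [RHS]mxE /GRing.scale/=; ring.
apply: (@is_derive_ext _ (fun z => l * c (l * z) 1 0)); first by move=> z; rewrite mxE.
have [H1 H2] := is_deriveZ l e1; split; [exact: H1|apply: (etrans H2)].
by rewrite QD5_scale [RHS]mxE /GRing.scale/=; ring.
Qed.

Lemma integral_curve_shift (s a b : R) c : integral_curve (@QD5 R) a b c ->
  integral_curve (@QD5 R) (a - s) (b - s) (fun t => c (t + s)).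
Proof.
move=> ic t tab; have /ic/is_derive_col2[d0 d1] : a < t + s < b by move: tab => /andP[]; lra.
have dl : is_derive t (1 : R) (fun t : R => t + s) 1.
  by apply: is_derive_eq; rewrite addr0.
have e0 := is_derive1_comp (g := fun t : R => t + s) d0 dl.
have e1 := is_derive1_comp (g := fun t : R => t + s) d1 dl.
by apply/is_derive_col2; rewrite !mulr1 in e0 e1; split.
Qed.

Lemma integral_curve_sub (a b a' b' : R) c : a <= a' -> b' <= b ->
  integral_curve (@QD5 R) a b c -> integral_curve (@QD5 R) a' b' c.
Proof. by move=> aa bb ic t tab; apply: ic; move: tab => /andP[]; lra. Qed.

(** Both curves stay in a bounded region on [0, T], where the field has a Lipschitz
    constant; the squared distance then satisfies the Gronwall inequality. *)
Lemma unique_forward (a b T : R) c1 c2 : a < 0 -> T < b -> 0 <= T ->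
  integral_curve (@QD5 R) a b c1 -> integral_curve (@QD5 R) a b c2 ->
  c1 0 = c2 0 -> c1 T = c2 T.
Proof.
move=> a0 Tb T0 ic1 ic2 c0.
have ab t : 0 <= t <= T -> a < t < b by move=> /andP[]; lra.
pose f t := sqn (c1 t) + sqn (c2 t).
have cc c (i : 'I_2) t : integral_curve (@QD5 R) a b c -> 0 <= t <= T ->
    {for t, continuous (fun t => c t i 0)}.
  move=> ic /ab/ic/is_derive_col2[/is_derive_continuous d0 /is_derive_continuous d1].
  have [->|->] : i = 0 \/ i = 1; last 2 first; [exact: d0|exact: d1|].
  by case: i => -[|[|//]] hi; [left|right]; apply/val_inj.
have cf : {within `[0, T], continuous f}.
  apply: continuous_in_subspaceT => t; rewrite inE set_itvccE => tT.
  have csq c : integral_curve (@QD5 R) a b c -> {for t, continuous (fun t => sqn (c t))}.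
    move=> ic; apply: cvgD.
      apply: (@continuous_comp _ _ _ (fun t => c t 0 0) (fun x => x ^+ 2)); last exact: exprn_continuous.
      exact: cc.
    apply: (@continuous_comp _ _ _ (fun t => c t 1 0) (fun x => x ^+ 2)); last exact: exprn_continuous.
    exact: cc.
  by apply: cvgD; apply: csq.
have [m _ fM] := EVT_max T0 cf.
have f0 t : 0 <= sqn (c1 t) /\ 0 <= sqn (c2 t) by split; rewrite addr_ge0 ?sqr_ge0.
have fb t : 0 <= t <= T -> sqn (c1 t) <= f m /\ sqn (c2 t) <= f m.
  by move=> tT; have := fM t; rewrite in_itv/= => /(_ tT); have [] := f0 t; rewrite /f; split; lra.
have M0 : 0 <= f m by have [] := f0 m; rewrite /f; lra.
pose L := 1 + (N (1 +i* 1) * 4 * (1 + f m)) ^+ 2.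
pose E t := sqn (c1 t - c2 t).
pose dE t := 2 * ((c1 t - c2 t) 0 0 * (QD5 (c1 t) - QD5 (c2 t)) 0 0 +
   (c1 t - c2 t) 1 0 * (QD5 (c1 t) - QD5 (c2 t)) 1 0).
have : E T <= 0.
  apply: (@gronwall0 E dE L T T0); last by rewrite /E c0 subrr /sqn !mxE expr0n addr0.
    move=> t /ab tab; have /is_derive_col2[d10 d11] := ic1 t tab.
    have /is_derive_col2[d20 d21] := ic2 t tab.
    apply: (@is_derive_ext _ (fun t => (c1 t 0 0 - c2 t 0 0) ^+ 2 + (c1 t 1 0 - c2 t 1 0) ^+ 2)).
      by move=> z; rewrite /E /sqn !mxE.
    apply: is_derive_eq; rewrite /dE !mxE /GRing.scale/=; ring.
  move=> t tT; have [b1 b2] := fb t tT; have := QD5_lip M0 b1 b2.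
  rewrite /dE /E /L; set D := QD5 _ - QD5 _; set d := c1 t - c2 t.
  move: (_ ^+ 2) => K; rewrite /sqn => h.
  have s0 := sqr_ge0 (D 0 0 - d 0 0); have s1 := sqr_ge0 (D 1 0 - d 1 0).
  have -> : (1 + K) * (d 0 0 ^+ 2 + d 1 0 ^+ 2) =
    d 0 0 ^+ 2 + d 1 0 ^+ 2 + K * (d 0 0 ^+ 2 + d 1 0 ^+ 2) by ring.
  move: h s0 s1; rewrite !sqrrB; move: (K * _) => S.
  by move: (D 0 0) (D 1 0) (d 0 0) (d 1 0) => u v x y; lra.
have : 0 <= E T by rewrite addr_ge0 ?sqr_ge0.
move=> e0 e1; have /eqP : E T = 0 by apply: le_anti; rewrite e0 e1.
rewrite /E /sqn sqrD_eq0 => /andP[/eqP h0 /eqP h1]; apply: col2P; apply/eqP.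
  by rewrite -subr_eq0; move: h0; rewrite !mxE => ->.
by rewrite -subr_eq0; move: h1; rewrite !mxE => ->.
Qed.

Lemma integral_curve_unique (a1 b1 a2 b2 t : R) c1 c2 :
  a1 < 0 < b1 -> a2 < 0 < b2 -> a1 < t < b1 -> a2 < t < b2 ->
  integral_curve (@QD5 R) a1 b1 c1 -> integral_curve (@QD5 R) a2 b2 c2 ->
  c1 0 = c2 0 -> c1 t = c2 t.
Proof.
move=> /andP[a10 b10] /andP[a20 b20] /andP[a1t tb1] /andP[a2t tb2] ic1 ic2 c0.
pose a := Num.max a1 a2; pose b := Num.min b1 b2.
have a1a : a1 <= a by rewrite le_max lexx.
have a2a : a2 <= a by rewrite le_max lexx orbT.
have b1b : b <= b1 by rewrite ge_min lexx.
have b2b : b <= b2 by rewrite ge_min lexx orbT.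
have [a0 b0] : a < 0 /\ 0 < b by rewrite gt_max lt_min a10 a20 b10 b20.
have [at_ tb] : a < t /\ t < b by rewrite gt_max lt_min a1t a2t tb1 tb2.
have {}ic1 := integral_curve_sub a1a b1b ic1; have {}ic2 := integral_curve_sub a2a b2b ic2.
have [t0|t0] := leP 0 t; first exact: (unique_forward a0 tb t0 ic1 ic2).
(* Backward in time: the field is even, so - c (- t) is again an integral curve. *)
have H z : - b < z < - a -> a < -1 * z < b by rewrite mulN1r => /andP[]; lra.
have t0' : 0 <= - t by lra.
have nta : - t < - a by lra.
have nb : - b < 0 by lra.
have := unique_forward nb nta t0' (integral_curve_scale H ic1) (integral_curve_scale H ic2).
by rewrite /= !mulr0 c0 mulN1r opprK !scaleN1r => /(_ erefl)/oppr_inj.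
Qed.

End Uniqueness.

(** * Local existence and the flow *)
Section LocalFlow.
Variable R : realType.
Implicit Types (x y t s a b : R) (p q : 'cV[R]_2) (c : R -> 'cV[R]_2).
Notation P := (5 * Omega R).

Lemma W_homog u y : W (u * y) y = y ^+ 5 * W u 1.
Proof. by rewrite /W; ring. Qed.

Lemma W_slope x y : y != 0 -> W x y = y ^+ 5 * W (x / y) 1.
Proof. by move=> y0; rewrite -W_homog divfK. Qed.

Lemma root5W_slope x y : y != 0 -> root5 (W x y) = y * root5 (W (x / y) 1).
Proof. by move=> y0; rewrite W_slope// root5M exp5K. Qed.

Lemma is_derive_affine (m k t : R) : is_derive t (1 : R) (fun t : R => m - k * t) (- k).
Proof. by apply: is_derive_eq; rewrite /GRing.scale/=; ring. Qed.

Lemma QD50 : QD5 0 = 0 :> 'cV[R]_2.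
Proof. by rewrite -[X in QD5 X](scale0r (0 : 'cV[R]_2)) QD5_scale expr0n scale0r. Qed.

(** The field in the coordinates u = x / y and h = y. *)
Lemma chart_curve (u h : R -> R) a b :
  (forall t, a < t < b -> [/\ h t != 0,
     is_derive t (1 : R) u (- (h t * W (u t) 1 / (u t ^+ 2 + 1))) &
     is_derive t (1 : R) h (h t ^+ 2 * dW (u t) / (u t ^+ 2 + 1))]) ->
  integral_curve (@QD5 R) a b (fun t => pt (u t * h t) (h t)).
Proof.
move=> H t /H[h0 du dh]; have T0 := onePsqr_gt0 (u t).
have T0' : u t ^+ 2 + 1 != 0 by rewrite gt_eqF.
have E : (u t * h t) ^+ 2 + h t ^+ 2 = h t ^+ 2 * (u t ^+ 2 + 1) by ring.
apply/is_derive_col2; rewrite QD5E !pt0 !pt1; split.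
  apply: (@is_derive_ext _ (fun t => u t * h t)); first by move=> z; rewrite pt0.
  have [H1 H2] := is_deriveM du dh; split; [exact: H1|apply: (etrans H2)].
  by rewrite /GRing.scale/= /Q1 E /W /dW; field; rewrite h0 T0'.
apply: (@is_derive_ext _ h); first by move=> z; rewrite pt1.
by rewrite /Q2 E; apply: is_derive_eq dh _; rewrite /dW; field; rewrite h0 T0'.
Qed.

(** The slope moves by k along alpha(u) - s t, with s the fifth root of W(x, y), and
    the second coordinate is recovered from the conservation of W. *)
Definition chart_u x y t := kval (alpha (Some (x / y)) - root5 (W x y) * t).
Definition chart_h x y t := root5 (W x y) / root5 (W (chart_u x y t) 1).

Lemma chart_u0 x y : chart_u x y 0 = x / y.
Proof. by rewrite /chart_u mulr0 subr0 /kval alphaK. Qed.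

Lemma local_curve x y : y != 0 -> W x y != 0 -> exists2 e, 0 < e &
  integral_curve (@QD5 R) (- e) e
    (fun t => pt (chart_u x y t * chart_h x y t) (chart_h x y t)) /\
  chart_h x y 0 = y.
Proof.
move=> y0 Wxy; set sg := root5 (W x y); set a0 := alpha (Some (x / y)).
have sg0 : sg != 0 by rewrite root5_eq0.
have k0 : kfun a0 != None by rewrite alphaK.
have Wu : W (x / y) 1 != 0 by move: Wxy; rewrite W_slope// mulf_eq0 negb_or => /andP[].
have : \forall s \near a0, kfun s != None /\ W (kval s) 1 != 0.
  near=> s; split; first by near: s; exact: kfun_near_finite.
  near: s; have ck : {for a0, continuous (@kval R)}.
    by have := kval_continuous k0 => /nbhs_singleton.
  have cW : {for a0, continuous (fun s => W (kval s) 1)}.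
    apply: (@continuous_comp _ _ _ (@kval R) (fun u => W u 1)) => //.
    exact: continuous_W1.
  apply: (cW [set w | w != 0]); apply: open_nbhs_nbhs; split; first exact: open_neq.
  by rewrite /= /kval alphaK.
move=> /nbhs_ballP[d /= d0 D].
exists (d / `|sg|); first by rewrite divr_gt0// normr_gt0.
split; last by rewrite /chart_h chart_u0 root5W_slope// mulfK// root5_eq0.
apply: chart_curve => t /andP[t1 t2].
have [ks Ws] : kfun (a0 - sg * t) != None /\ W (kval (a0 - sg * t)) 1 != 0.
  apply: D; rewrite /ball/= opprB addrC subrK normrM mulrC -ltr_pdivlMr ?normr_gt0//.
  by rewrite ltr_norml t1 t2.
set r := root5 (W (chart_u x y t) 1).
have r0 : r != 0 by rewrite root5_eq0.
have rW : W (chart_u x y t) 1 = r ^+ 5 by rewrite root5K.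
have T0 := onePsqr_gt0 (chart_u x y t).
have T0' : chart_u x y t ^+ 2 + 1 != 0 by rewrite gt_eqF.
have dl := is_derive_affine a0 sg t.
have du : is_derive t (1 : R) (chart_u x y) (kslope (chart_u x y t) * - sg).
  exact: (is_derive1_comp (g := fun t : R => a0 - sg * t) (is_derive_kval ks) dl).
have dr : is_derive t (1 : R) (fun t => root5 (W (chart_u x y t) 1))
    ((5 * r ^+ 4)^-1 * (5 * dW (chart_u x y t) * (kslope (chart_u x y t) * - sg))).
  have dWu := is_derive1_comp (f := fun u => W u 1) (is_derive_W1 (chart_u x y t)) du.
  by have := is_derive1_comp (g := (fun u => W u 1) \o chart_u x y) (is_derive_root5 Ws) dWu.
split.
- by rewrite /chart_h mulf_neq0// invr_eq0.
- by apply: is_derive_eq du _; rewrite /kslope -/r rW /chart_h -/r -/sg; field; rewrite r0 T0'.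
- have dV := is_deriveV (f := fun t => root5 (W (chart_u x y t) 1)) r0 dr.
  have [H1 H2] := is_deriveZ sg dV; split; [exact: H1|apply: (etrans H2)].
  rewrite /GRing.scale/= /kslope -/r /chart_h -/r -/sg; field; by rewrite r0 T0'.
Unshelve. all: by end_near. Qed.

(** On the lines where W vanishes the slope is constant and the second coordinate
    satisfies the Riccati equation h' = c h^2. *)
Definition ray_h x y t := (y^-1 - dW (x / y) / ((x / y) ^+ 2 + 1) * t)^-1.

Lemma local_ray x y : y != 0 -> W x y = 0 -> exists2 e, 0 < e &
  integral_curve (@QD5 R) (- e) e
    (fun t => pt (x / y * ray_h x y t) (ray_h x y t)) /\
  ray_h x y 0 = y.
Proof.
move=> y0 Wxy; have Wu : W (x / y) 1 = 0.
  by move/eqP: Wxy; rewrite W_slope// mulf_eq0 expf_eq0/= (negbTE y0) => /eqP.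
rewrite /ray_h; have [k kE] : exists k, k = dW (x / y) / ((x / y) ^+ 2 + 1) by eexists.
rewrite -kE; have yk : 0 < `|y^-1| by rewrite normr_gt0 invr_eq0.
exists (`|y^-1| / (1 + `|k|)); first by rewrite divr_gt0// ltr_wpDr.
split; last by rewrite mulr0 subr0 invrK.
apply: (@chart_curve (fun=> x / y)) => t /andP[t1 t2].
have g0 : y^-1 - k * t != 0.
  rewrite subr_eq0; apply/eqP => E.
  have : `|t| < `|y^-1| / (1 + `|k|) by rewrite ltr_norml t1 t2.
  rewrite ltr_pdivlMr ?ltr_wpDr// E normrM.
  by move=> h; have := normr_ge0 t; lra.
have dg := is_derive_affine y^-1 k t.
split.
- by rewrite invr_eq0.
- by rewrite Wu mulr0 mul0r oppr0; exact: is_derive_cst.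
- have dV := is_deriveV (f := fun t => y^-1 - k * t) g0 dg; apply: is_derive_eq dV _.
  by rewrite /GRing.scale/= exprVn mulrNN -mulrA -kE.
Qed.

Lemma local_exists p : exists2 e, 0 < e &
  exists2 c, integral_curve (@QD5 R) (- e) e c & c 0 = p.
Proof.
have H q : q 1 0 != 0 -> exists2 e, 0 < e &
    exists2 c, integral_curve (@QD5 R) (- e) e c & c 0 = q.
  move=> y0; have [Wq|Wq] := eqVneq (W (q 0 0) (q 1 0)) 0.
    have [e e0 [ic h0]] := local_ray y0 Wq; exists e => //; eexists; first exact: ic.
    by rewrite /= h0 divfK// ptE.
  have [e e0 [ic h0]] := local_curve y0 Wq; exists e => //; eexists; first exact: ic.
  by rewrite /= h0 chart_u0 divfK// ptE.
have [y0|/H//] := eqVneq (p 1 0) 0.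
have [x0|x0] := eqVneq (p 0 0) 0.
  have -> : p = 0 by rewrite -(ptE p) x0 y0; apply/eqP; rewrite pt_eq0 eqxx.
  exists 1 => //; exists (cst 0) => // t _.
  rewrite [cst 0 t]/(0) QD50.
  exact: is_derive_cst.
have [|e e0 [c ic c0]] := H (swap p); first by rewrite /swap pt1.
exists e => //; exists (fun t => swap (c t)); first exact: integral_curve_swap.
by rewrite c0 swapK.
Qed.

(** The flow at time t as a relation, free of the scaling that phi carries. *)
Definition reach t p q := exists a b c,
  [/\ a < 0 < b, a < t < b, integral_curve (@QD5 R) a b c, c 0 = p & c t = q].

Lemma reach_fun t p q q' : reach t p q -> reach t p q' -> q = q'.
Proof.
move=> [a [b [c [ab tab ic c0 <-]]]] [a' [b' [c' [ab' tab' ic' c0' <-]]]].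
by apply: (integral_curve_unique ab ab' tab tab' ic ic'); rewrite c0.
Qed.

Lemma reach0 p q : reach 0 p q <-> q = p.
Proof.
split=> [[a [b [c [_ _ _ <- <-]]]]//|->].
have [e e0 [c ic c0]] := local_exists p.
by exists (- e), e, c; split=> //; rewrite oppr_lt0 e0.
Qed.

Lemma reach_scale (l s : R) p q : l != 0 -> reach (l * s) p q -> reach s (l *: p) (l *: q).
Proof.
move=> l0 [a [b [c [/andP[a0 b0] /andP[at_ tb] ic <- <-]]]].
have H a' b' : a' < 0 < b' -> a' < s < b' -> (forall t, a' < t < b' -> a < l * t < b) ->
    reach s (l *: c 0) (l *: c (l * s)).
  move=> h1 h2 h3; exists a', b', (fun t => l *: c (l * t)); split=> //.
    exact: integral_curve_scale h3 ic.
  by rewrite mulr0.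
move: l0; rewrite neq_lt => /orP[l0|l0].
  apply: (H (b / l) (a / l)).
  - by rewrite ltr_ndivrMr// mul0r b0 ltr_ndivlMr// mul0r.
  - by rewrite ltr_ndivrMr// ltr_ndivlMr// !(mulrC s) at_ tb.
  - by move=> t; rewrite ltr_ndivrMr// ltr_ndivlMr// !(mulrC t) andbC.
apply: (H (a / l) (b / l)).
- by rewrite ltr_pdivrMr// mul0r a0 ltr_pdivlMr// mul0r.
- by rewrite ltr_pdivrMr// ltr_pdivlMr// !(mulrC s) at_ tb.
- by move=> t; rewrite ltr_pdivrMr// ltr_pdivlMr// !(mulrC t).
Qed.

Lemma reach_swap t p q : reach t p q -> reach t (swap p) (swap q).
Proof.
move=> [a [b [c [ab tab ic <- <-]]]]; exists a, b, (fun t => swap (c t)); split=> //.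
exact: integral_curve_swap.
Qed.

Lemma phiD5P p q : phiD5 p = Some q <-> reach 1 p q.
Proof.
have T r : time_one (@QD5 R) p r <-> reach 1 p r.
  split=> [[a [b [c [a0 b1 ic c0 c1]]]]|[a [b [c [/andP[a0 _] /andP[_ b1] ic c0 c1]]]]].
    by exists a, b, c; split=> //; apply/andP; split; lra.
  by exists a, b, c.
rewrite /phiD5 /generated_flow; case: pselect => [h|nh].
  case: cid => /= r /T pr; split=> [[<-]//|pq]; congr Some; exact: reach_fun pr pq.
by split=> // /T pq; case: nh; exists q.
Qed.

(** The field is homogeneous of degree 2, so t^-1 phi(t p) is the position at time t
    of the curve that starts at p. *)
Lemma pflowP t p q : pflow (@phiD5 R) t p = Some q <-> reach t p q.
Proof.
rewrite /pflow; case: eqVneq => [->|t0].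
  by rewrite reach0; split=> [[]|->].
split.
  case E : (phiD5 (t *: p)) => [r|]//= [<-].
  have h := (phiD5P _ _).1 E; rewrite -[1](mulVf t0) in h.
  by have := reach_scale (invr_neq0 t0) h; rewrite scalerA mulVf// scale1r.
move=> pq; have /(reach_scale t0) : reach (t * 1) p q by rewrite mulr1.
by move=> /phiD5P ->/=; rewrite scalerA mulVf// scale1r.
Qed.

Lemma reach_sym t p q : reach t p q -> reach (- t) q p.
Proof.
move=> [a [b [c [/andP[a0 b0] /andP[at_ tb] ic <- <-]]]].
exists (a - t), (b - t), (fun z => c (z + t)); split.
- by apply/andP; split; lra.
- by apply/andP; split; lra.
- exact: integral_curve_shift.
- by rewrite add0r.
- by rewrite addNr.
Qed.

(** The two integral curves agree, by uniqueness, on the intersection of their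
    domains, so they glue to an integral curve on the union. *)
Lemma reach_trans t s p q r : reach t p q -> reach s q r -> reach (t + s) p r.
Proof.
move=> [a [b [c [/andP[a0 b0] /andP[at_ tb] ic c0 ct]]]] [a' [b' [c' [/andP[a0' b0'] /andP[as_ sb] ic' c0' cs]]]].
pose d z := if a < z < b then c z else c' (z - t).
have ic'' := integral_curve_shift (s := - t) ic'; rewrite !opprK in ic''.
have agree z : a < z < b -> a' + t < z < b' + t -> c z = c' (z - t).
  move=> /andP[z1 z2] /andP[z3 z4].
  have := @integral_curve_unique R (a - t) (b - t) a' b' (z - t) (fun z => c (z + t)) c'.
  rewrite /= subrK; apply; rewrite ?add0r ?c0' //; try by apply/andP; split; lra.
  exact: integral_curve_shift.
have icd : integral_curve (@QD5 R) (Num.min a (a' + t)) (Num.max b (b' + t)) d.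
  move=> z; rewrite gt_min lt_max => /andP[z1 z2].
  have [/andP[az zb]|nz] := boolP (a < z < b).
    have : \forall w \near z, c w = d w.
      have := near_in_itvoo (_ : z \in `]a, b[); rewrite in_itv/= az zb => /(_ isT).
      by apply: filterS => w; rewrite in_itv/= /d => ->.
    move=> cd; have -> : d z = c z by rewrite /d az zb.
    by apply: near_eq_is_derive cd _; apply: ic; rewrite az zb.
  have zz : a' + t < z < b' + t.
    move: z1 z2; rewrite negb_and -!leNgt in nz.
    by case/orP: nz => h; case/orP => h1; case/orP => h2; apply/andP; split; lra.
  have : \forall w \near z, c' (w - t) = d w.
    have := near_in_itvoo (_ : z \in `]a' + t, b' + t[); rewrite in_itv/= zz => /(_ isT).
    apply: filterS => w; rewrite in_itv/= /d => wz; case: ifP => // /agree-/(_ wz)//.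
  move=> cd; have -> : d z = c' (z - t) by rewrite /d (negbTE nz).
  by apply: near_eq_is_derive cd _; exact: ic''.
exists (Num.min a (a' + t)), (Num.max b (b' + t)), d; split.
- by rewrite gt_min lt_max a0 b0.
- by rewrite gt_min lt_max; apply/andP; split; apply/orP; right; lra.
- exact: icd.
- by rewrite /d a0 b0.
- have e : t + s - t = s by rewrite addrAC subrr add0r.
  rewrite /d; case: ifP => [h|_]; last by rewrite e.
  by rewrite agree// ?e//; apply/andP; split; lra.
Qed.

End LocalFlow.

(** * Orbits and the explicit formula *)
Section Orbits.
Variable R : realType.
Implicit Types (x y t s a b : R) (p q : 'cV[R]_2) (c : R -> 'cV[R]_2).
Notation P := (5 * Omega R).
Notation Wp p := (W (p 0 0) (p 1 0)).
Notation slp p := (slope (p 0 0) (p 1 0)).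

Lemma Wp0 : Wp (0 : 'cV[R]_2) = 0.
Proof. by rewrite !mxE /W !expr0n /=; ring. Qed.

Lemma Wp_neq0 p : Wp p != 0 -> p != 0.
Proof. by apply: contra => /eqP ->; rewrite Wp0. Qed.

Lemma slope_inv p : p != 0 -> slp p = inv_slope (slope (p 1 0) (p 0 0)).
Proof.
rewrite -(ptE p) pt_eq0 pt0 pt1 /slope negb_and => h.
case: (eqVneq (p 0 0) 0) h => [->|x0] /= h.
  by rewrite (negbTE h) mul0r.
case: (eqVneq (p 1 0) 0) h => [->|y0] _; first by rewrite mul0r eqxx.
by rewrite mulf_eq0 invr_eq0 (negbTE x0) (negbTE y0)/= invf_div.
Qed.

Lemma near_neq0 (T : topologicalType) (f : T -> R) (u : T) :
  {for u, continuous f} -> f u != 0 -> \forall v \near u, f v != 0.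
Proof.
move=> cf fu; have : nbhs (f u) [set z | z != 0].
  by apply: open_nbhs_nbhs; split; first exact: open_neq.
exact: cf.
Qed.

Lemma near_small (T : topologicalType) (f : T -> R) (u : T) (m k e : R) :
  {for u, continuous f} -> f u = m -> 0 < e -> \forall v \near u, `|(m - f v) / k| < e.
Proof.
move=> cf fu e0.
have cg : {for f u, continuous (fun z : R => (m - z) / k)}.
  by apply: cvgMl; apply: cvgB; [exact: cvg_cst|exact: cvg_id].
have B : nbhs ((m - f u) / k) [set z : R | `|z| < e].
  have := nbhsx_ballx ((m - f u) / k) e e0; rewrite fu subrr mul0r.
  by apply: filterS => z; rewrite /ball/= sub0r normrN.
exact: cf (cg _ B).
Qed.

Lemma near_oo a b t : a < t < b -> \forall z \near t, a < z < b.
Proof.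
move=> tab; have := near_in_itvoo (_ : t \in `]a, b[); rewrite in_itv/= tab => /(_ isT).
by apply: filterS => z; rewrite in_itv.
Qed.

Lemma continuous_coord (i : 'I_2) : continuous (fun p : 'cV[R]_2 => p i 0).
Proof. by move=> p; apply: differentiable_continuous; exact: differentiable_coord. Qed.

Lemma coord_near c a b t0 (i : 'I_2) : integral_curve (@QD5 R) a b c -> a < t0 < b ->
  {for t0, continuous (fun t => c t i 0)}.
Proof.
move=> ic /ic/is_derive_col2[/is_derive_continuous d0 /is_derive_continuous d1].
have [->|->] : i = 0 \/ i = 1; last 2 first; [exact: d0|exact: d1|].
by case: i => -[|[|//]] hi; [left|right]; apply/val_inj.
Qed.

(** In the chart y != 0, the derivative of Phi(x / y) along the field is
    - W(x, y)^(1/5).  The curve does not meet the zeros of W, where Phi is not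
    differentiable. *)
Lemma slope_evolution_local a b c t0 :
  integral_curve (@QD5 R) a b c -> a < t0 < b -> c t0 1 0 != 0 -> Wp (c t0) != 0 ->
  \forall t \near t0, alpha (slp (c t)) + root5 (Wp (c t0)) * t =
     alpha (slp (c t0)) + root5 (Wp (c t0)) * t0.
Proof.
move=> ic tab y0 W0; set sg := root5 _.
have := @filterI _ _ (nbhs_filter t0) _ _ (near_oo tab) (@near_neq0 _ (fun t => c t 1 0) t0 (coord_near (i := 1) ic tab) y0).
move=> /nbhs_ballP[d /= d0 D].
have D' t : t0 - d < t < t0 + d -> a < t < b /\ c t 1 0 != 0.
  by move=> h; apply: D; rewrite /ball/= ltr_distlC.
pose G t := Phi (c t 0 0 / c t 1 0) + sg * t.
have t0d : t0 - d < t0 < t0 + d by apply/andP; split; lra.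
have dG t : t0 - d < t < t0 + d -> is_derive t (1 : R) G 0.
  move=> /D'[tab' yt0]; have /is_derive_col2[dx dy] := ic t tab'.
  have We : Wp (c t) = Wp (c t0) by exact: W_conserved ic tab' tab.
  have Wu : W (c t 0 0 / c t 1 0) 1 != 0.
    by move: W0; rewrite -We W_slope// mulf_eq0 negb_or => /andP[].
  have dV := is_deriveV (f := fun t => c t 1 0) yt0 dy.
  have du := is_deriveM dx dV.
  have dP := is_derive1_comp (g := (fun t => c t 0 0) * (fun t => (c t 1 0)^-1)) (is_derive_Phi Wu) du.
  have dl : is_derive t (1 : R) (fun t : R => sg * t) sg.
    by apply: is_derive_eq; rewrite /GRing.scale/= mulr1.
  have [H1 H2] := is_deriveD dP dl; split; [exact: H1|apply: (etrans H2)].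
  have sgE : sg = c t 1 0 * root5 (W (c t 0 0 / c t 1 0) 1).
    by rewrite /sg -We root5W_slope.
  rewrite sgE /alpha_integrand QD5E pt0 pt1 /Q1 /Q2 /GRing.scale/=.
  have := root5K (W (c t 0 0 / c t 1 0) 1).
  have : root5 (W (c t 0 0 / c t 1 0) 1) != 0 by rewrite root5_eq0.
  have rho0 : c t 0 0 ^+ 2 + c t 1 0 ^+ 2 != 0 by rewrite sqrD_eq0 (negbTE yt0) andbF.
  move: (root5 _) rho0 yt0 => r; move: (c t 0 0) (c t 1 0) => x y rho0 y0' r0 rW.
  transitivity (((x ^+ 2 + y ^+ 2) * y ^+ 5 * r ^+ 5 - (x ^+ 2 + y ^+ 2) * W x y) / (y ^+ 4 * r ^+ 4 * (x ^+ 2 + y ^+ 2))).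
    by rewrite /W; field; rewrite rho0 y0' r0.
  by rewrite rW -mulrA -W_slope// subrr mul0r.
near=> t.
have td : t0 - d < t < t0 + d.
  by near: t; exact: near_oo.
have := is_derive_const_itv dG td t0d; rewrite /G /slope.
have [_ /negbTE->] := D' t td; rewrite (negbTE y0) !alpha_Some => E.
by rewrite addrAC E addrAC.
Unshelve. all: by end_near. Qed.

Lemma kfun_eq_mod s t : kfun s = kfun t -> exists m : int, s = t + m%:~R * P.
Proof.
move=> e; have [m ->] := kfunP s; have [n ->] := kfunP t.
by exists (m - n); rewrite e intrB; ring.
Qed.

(** k(alpha(u) + s t) is locally constant along the curve: at points with y != 0 by
    the computation in the chart, and at points with y = 0 by the same computation
    after exchanging the coordinates, which changes the signs of alpha(u) and s. *)
Lemma slope_evolution a b c s t :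
  integral_curve (@QD5 R) a b c -> a < s < b -> a < t < b -> Wp (c s) != 0 ->
  exists m : int, alpha (slp (c t)) + root5 (Wp (c s)) * t =
    alpha (slp (c s)) + root5 (Wp (c s)) * s + m%:~R * P.
Proof.
move=> ic sab tab Ws; apply: kfun_eq_mod.
have We z : a < z < b -> Wp (c z) = Wp (c s) by move=> zab; exact: W_conserved ic zab sab.
apply: (@locally_constant _ _ (fun t => kfun (alpha (slp (c t)) + root5 (Wp (c s)) * t)) a b _ t s tab sab).
move=> t0 t0ab /=; have [y0|y0] := eqVneq (c t0 1 0) 0; last first.
  have W0 : Wp (c t0) != 0 by rewrite We.
  have := slope_evolution_local ic t0ab y0 W0; rewrite We//.
  by apply: filterS => z ->.
have W0 : Wp (c t0) != 0 by rewrite We.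
have ic' := integral_curve_swap ic.
have x0 : swap (c t0) 1 0 != 0.
  rewrite /swap pt1; have := Wp_neq0 W0; rewrite -{1}(ptE (c t0)) pt_eq0 y0 eqxx andbT.
  exact.
have W0' : Wp (swap (c t0)) != 0 by rewrite /swap pt0 pt1 W_swap oppr_eq0.
have := slope_evolution_local ic' t0ab x0 W0'.
have ab0 : \forall z \near t0, a < z < b.
  exact: near_oo.
have key z : a < z < b -> exists m : int, alpha (slp (c z)) + root5 (Wp (c s)) * z =
   - (alpha (slp (swap (c z))) + root5 (Wp (swap (c t0))) * z) + m%:~R * P.
  move=> zab; have Wz : Wp (c z) != 0 by rewrite We.
  have -> : Wp (swap (c t0)) = - Wp (c s) by rewrite /swap pt0 pt1 W_swap We.
  rewrite /swap !pt0 !pt1 root5N.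
  rewrite slope_inv ?Wp_neq0//; have [m ->] := alpha_inv_slope (slope (c z 1 0) (c z 0 0)).
  by exists m; ring.
move=> H; near=> z.
have zab : a < z < b by near: z.
have [m ->] := key z zab; have [n ->] := key t0 t0ab.
rewrite !kfun_periodic; congr (kfun (- _)); near: z; exact: H.
Unshelve. all: by end_near. Qed.

Lemma reach_W t p q : reach t p q -> Wp q = Wp p.
Proof. by move=> [a [b [c [ab tab ic <- <-]]]]; exact: W_conserved ic tab ab. Qed.

Lemma reach_slope t p q : Wp p != 0 -> reach t p q ->
  exists m : int, alpha (slp q) = alpha (slp p) - root5 (Wp p) * t + m%:~R * P.
Proof.
move=> Wp0 [a [b [c [ab tab ic c0 ct]]]].
have [|m] := slope_evolution ic ab tab; first by rewrite c0.
rewrite c0 ct mulr0 addr0 => E; exists m; rewrite -[LHS](addrK (root5 (Wp p) * t)) E; ring.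
Qed.

Lemma continuous_slope p : p 1 0 != 0 ->
  {for p, continuous (fun q : 'cV[R]_2 => q 0 0 / q 1 0)}.
Proof.
move=> y0; apply: (@cvgM _ _ (nbhs p) (nbhs_filter p) (fun q : 'cV[R]_2 => q 0 0) (fun q : 'cV[R]_2 => (q 1 0)^-1)).
  exact: continuous_coord.
by apply: (@cvgV _ _ (nbhs p) (nbhs_filter p)) => //; exact: continuous_coord.
Qed.

Lemma alpha_slope_continuous p : p 1 0 != 0 ->
  {for p, continuous (fun q => Phi (q 0 0 / q 1 0))}.
Proof.
move=> y0; apply: (@continuous_comp _ _ _ (fun q : 'cV[R]_2 => q 0 0 / q 1 0) (@Phi R)); last exact: continuous_Phi.
exact: continuous_slope.
Qed.

(** If W != 0, the slope determines the point of the level set, and the explicit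
    integral curve takes all slopes close to that of q.  If W = 0, the zeros of W being
    isolated, q' lies on the line of q, along which the second coordinate moves at
    nonzero speed. *)
Lemma orbit_near_chart q : q 1 0 != 0 ->
  \forall q' \near q, Wp (q' : 'cV[R]_2) = Wp q -> exists t, reach t q q'.
Proof.
move=> y0.
have ny : \forall q' \near q, (q' : 'cV[R]_2) 1 0 != 0.
  exact: near_neq0 (@continuous_coord 1 q) y0.
have [Wq|Wq] := eqVneq (Wp q) 0.
  have Wu : W (q 0 0 / q 1 0) 1 = 0.
    by move/eqP: Wq; rewrite W_slope// mulf_eq0 expf_eq0/= (negbTE y0) => /eqP.
  have [e e0 [ic h0]] := local_ray y0 Wq.
  have [k kE] : exists k, k = dW (q 0 0 / q 1 0) / ((q 0 0 / q 1 0) ^+ 2 + 1) by eexists.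
  have k0 : k != 0 by rewrite kE mulf_neq0 ?dW_neq0// invr_eq0 gt_eqF// onePsqr_gt0.
  have [rs rP] := W_roots R.
  have cu : {for q, continuous (fun q : 'cV[R]_2 => q 0 0 / q 1 0)}.
    exact: continuous_slope.
  have nu : \forall q' \near q, (q' : 'cV[R]_2) 0 0 / q' 1 0 \in rs -> q' 0 0 / q' 1 0 = q 0 0 / q 1 0.
    exact: (cu _ (near_seq_eq rs _)).
  have nt : \forall q' \near q, `|((q 1 0)^-1 - ((q' : 'cV[R]_2) 1 0)^-1) / k| < e.
    apply: (@near_small _ (fun q' : 'cV[R]_2 => (q' 1 0)^-1)) => //.
    by apply: (@cvgV _ _ (nbhs q) (nbhs_filter q)) => //; exact: continuous_coord.
  near=> q'; move=> We.
  have y0' : q' 1 0 != 0 by near: q'.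
  have u' : q' 0 0 / q' 1 0 = q 0 0 / q 1 0.
    have : W (q' 0 0 / q' 1 0) 1 = 0.
      by move/eqP: We; rewrite Wq W_slope// mulf_eq0 expf_eq0/= (negbTE y0') => /eqP.
    by move=> /rP; near: q'.
  exists (((q 1 0)^-1 - (q' 1 0)^-1) / k).
  exists (- e), e; eexists; split; [|rewrite -ltr_norml; near: q'; exact: nt|exact: ic| |].
  - by rewrite oppr_lt0 e0.
  - by rewrite /= h0 divfK// ptE.
  - have -> : ray_h (q 0 0) (q 1 0) (((q 1 0)^-1 - (q' 1 0)^-1) / k) = q' 1 0.
      by rewrite /ray_h -kE mulrC divfK// opprB addrC subrK invrK.
    by rewrite -u' divfK// ptE.
have [e e0 [ic h0]] := local_curve y0 Wq.
set sg := root5 (Wp q); have sg0 : sg != 0 by rewrite root5_eq0.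
have nt : \forall q' \near q, `|(Phi (q 0 0 / q 1 0) - Phi ((q' : 'cV[R]_2) 0 0 / q' 1 0)) / sg| < e.
  apply: (@near_small _ (fun q' : 'cV[R]_2 => Phi (q' 0 0 / q' 1 0))) => //.
  exact: alpha_slope_continuous.
near=> q'; move=> We; have y0' : q' 1 0 != 0 by near: q'.
have te : `|(Phi (q 0 0 / q 1 0) - Phi (q' 0 0 / q' 1 0)) / sg| < e by near: q'; exact: nt.
set t := (Phi (q 0 0 / q 1 0) - Phi (q' 0 0 / q' 1 0)) / sg.
exists t, (- e), e; eexists; split; [|by rewrite -ltr_norml|exact: ic| |].
- by rewrite oppr_lt0 e0.
- by rewrite /= h0 chart_u0 divfK// ptE.
- have u' : chart_u (q 0 0) (q 1 0) t = q' 0 0 / q' 1 0.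
    rewrite /chart_u -/sg (_ : _ - _ = alpha (Some (q' 0 0 / q' 1 0))) /kval ?alphaK//.
    by rewrite !alpha_Some /t [sg * _]mulrC divfK//; ring.
  have Wu' : root5 (W (q' 0 0 / q' 1 0) 1) != 0.
    rewrite root5_eq0; apply: contraNneq Wq => Wu.
    by rewrite -We W_slope// Wu mulr0.
  have h' : chart_h (q 0 0) (q 1 0) t = q' 1 0.
    by rewrite /chart_h u' -We root5W_slope// mulfK.
  by rewrite u' h' divfK// ptE.
Unshelve. all: by end_near. Qed.

Lemma continuous_swap : continuous (@swap R).
Proof.
move=> p; apply/(@cvg_ballP _ _ _ (nbhs p) (nbhs_filter p)) => e e0.
apply: (@filterS _ (nbhs p) (nbhs_filter p) _ _ _ (nbhsx_ballx p e e0)) => q [_ B].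
split=> // i j; rewrite (ord1 j).
have [->|->] : i = 0 \/ i = 1; last 2 first.
- by rewrite /swap !pt0; exact: B.
- by rewrite /swap !pt1; exact: B.
- by case: i => -[|[|//]] hi; [left|right]; apply/val_inj.
Qed.

Lemma orbit_near q : q != 0 ->
  \forall q' \near q, Wp (q' : 'cV[R]_2) = Wp q -> exists t, reach t q q'.
Proof.
move=> q0; have [y0|/orbit_near_chart//] := eqVneq (q 1 0) 0.
have x0 : swap q 1 0 != 0.
  by rewrite /swap pt1; move: q0; rewrite -{1}(ptE q) pt_eq0 y0 eqxx andbT.
apply: (@filterS _ (nbhs q) (nbhs_filter q) _ _ _ (continuous_swap (orbit_near_chart x0))) => q' /=.
rewrite /swap !pt0 !pt1 !(W_swap (_ 0 0)) -!/(swap _) => H We.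
by have [|t /reach_swap] := H; [rewrite We|rewrite !swapK; exists t].
Qed.

Lemma integral_curve_continuous a b c t : integral_curve (@QD5 R) a b c -> a < t < b ->
  {for t, continuous c}.
Proof.
by move=> ic /ic[d _]; apply/differentiable_continuous/derivable1_diffP.
Qed.

Lemma pflow_curve_near p e c : 0 < e -> integral_curve (@QD5 R) (- e) e c -> c 0 = p ->
  \forall t \near 0, c t = pflow_curve (@phiD5 R) p t.
Proof.
move=> e0 ic c0; have h0 : - e < 0 < e by rewrite oppr_lt0 e0.
apply: (@filterS _ _ (nbhs_filter (0 : R)) _ _ _ (near_oo h0)) => t te.
have /pflowP : reach t p (c t) by exists (- e), e, c.
by rewrite /pflow_curve => ->.
Qed.

Lemma projective_flow_phiD5 : projective_flow setT (@phiD5 R).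
Proof.
move=> p _; have [e e0 [c ic c0]] := local_exists p.
have h0 : - e < 0 < e by rewrite oppr_lt0 e0.
have R0 t : `|t| < e -> reach t p (c t).
  by rewrite ltr_norml => te; exists (- e), e, c.
split.
  exists (e / 2); first by rewrite divr_gt0.
  move=> s t se te; exists (c s), (c (t + s)).
  have hs : reach s p (c s) by apply: R0; lra.
  have hts : reach (t + s) p (c (t + s)).
    by apply: R0; rewrite (splitr e); apply: le_lt_trans (ler_normD _ _) _; rewrite ltrD.
  split; apply/pflowP => //.
  by have := reach_trans (reach_sym hs) hts; rewrite addrC addrK.
have cc : c t @[t --> (0 : R)] --> p by rewrite -c0; exact: integral_curve_continuous ic h0.
have : c t @[t --> 0^'] --> p by apply: cvg_trans cc; apply: cvg_app; exact: nbhs_dnbhs.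
apply: cvg_trans; apply: near_eq_cvg; apply: nbhs_dnbhs.
by have := pflow_curve_near e0 ic c0; apply: filterS => t ->.
Qed.

Lemma has_vector_field_phiD5 : has_vector_field setT (@phiD5 R) (@QD5 R).
Proof.
move=> p _; have [e e0 [c ic c0]] := local_exists p.
have h0 : - e < 0 < e by rewrite oppr_lt0 e0.
have d := ic 0 h0; rewrite c0 in d.
exact: near_eq_is_derive (pflow_curve_near e0 ic c0) d.
Qed.

Lemma phiD5_swap p q : phiD5 p = Some q -> phiD5 (swap p) = Some (swap q).
Proof. by move=> /phiD5P/reach_swap/phiD5P. Qed.

Lemma phiD5_symmetric : exists gam : R -> R -> option R, forall x y : R,
  phiD5 (pt x y) =
  obind (fun a => omap (fun b => pt a b) (gam y x)) (gam x y).
Proof.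
exists (fun x y => omap (fun q : 'cV[R]_2 => q 0 0) (phiD5 (pt x y))) => x y.
have sw z w : swap (pt z w) = pt w z by rewrite /swap pt0 pt1.
case E : (phiD5 (pt x y)) => [q|]//=.
by have := phiD5_swap E; rewrite sw => -> /=; rewrite /swap pt0 ptE.
Qed.

Lemma reach_neq0 t p q : reach t p q -> p != 0 -> q != 0.
Proof.
move=> pq; apply: contra => /eqP q0; rewrite q0 in pq.
apply/eqP/(reach_fun (reach_sym pq)).
exists (- (1 + `|t|)), (1 + `|t|), (cst 0); split=> //.
- by have := normr_ge0 t => h; apply/andP; split; lra.
- by rewrite -ltr_norml normrN ltrDr.
- by move=> z _; rewrite [cst 0 z]/(0) QD50; exact: is_derive_cst.
Qed.

(** The orbit is the image of an interval, hence connected, and it stays in the level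
    set.  Conversely orbits are open in the level set, so the orbit of p meets a
    connected subset containing p in an open set whose complement, a union of
    traces of other orbits, is open as well. *)
Lemma orbit_component p : p != 0 ->
  flow_orbit (@phiD5 R) p =
  connected_component [set q : 'cV[R]_2 | q != 0 /\ Wp q = Wp p] p.
Proof.
move=> p0; set M := [set q | _].
have M0 t q : reach t p q -> M q.
  by move=> pq; split; [exact: reach_neq0 pq p0|exact: reach_W pq].
apply/seteqP; split.
  move=> q [t /pflowP pq]; have := pq => -[a [b [c [ab tab ic c0 ct]]]].
  pose A : set R := `[Num.min 0 t, Num.max 0 t]%classic.
  have Aab z : A z -> a < z < b.
    rewrite /A set_itvccE => /andP[z1 z2].
    case/andP: ab => a0 b0; case/andP: tab => at_ tb.
    by rewrite (lt_le_trans _ z1) ?lt_min ?a0//= (le_lt_trans z2)// gt_max b0.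
  exists (c @` A).
    split.
    - by exists 0 => //; rewrite /A set_itvccE ge_min le_max lexx.
    - by move=> _ [z /Aab zab <-]; apply: (M0 z); exists a, b, c.
    - apply: connected_continuous_connected; first exact: segment_connected.
      apply: continuous_in_subspaceT => z; rewrite inE => /Aab.
      exact: integral_curve_continuous.
  by exists t => //; rewrite /A set_itvccE ge_min le_max !lexx !orbT.
move=> q [K [Kp KM cK] Kq].
pose O : set 'cV[R]_2 := [set r | exists t, reach t p r].
suff KO : K `&` O = K.
  by move: Kq; rewrite -KO => -[_ [t pq]]; exists t; apply/pflowP.
apply: cK.
- by exists p; split=> //; exists 0; apply/reach0.
- exists (interior [set r : 'cV[R]_2 | Wp r = Wp p -> O r]); first exact: open_interior.
  apply/seteqP; split => r [Kr]; last by move=> /nbhs_singleton Or; split=> //; apply: Or; case: (KM r Kr).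
  move=> [t pr]; split=> //; have [r0 Wr] := KM r Kr.
  apply: (@filterS _ _ (nbhs_filter r) _ _ _ (orbit_near r0)) => r' H Wr'.
  by have [|s rr'] := H; [rewrite Wr'|exists (t + s); exact: reach_trans pr rr'].
- exists (~` interior [set r : 'cV[R]_2 | Wp r = Wp p -> ~ O r]).
    by apply: open_closedC; exact: open_interior.
  apply/seteqP; split => r [Kr].
    by move=> Or; split=> // /nbhs_singleton H; apply: H Or; case: (KM r Kr).
  move=> nI; split=> //; apply: contrapT => nO; apply: nI.
  have [r0 Wr] := KM r Kr.
  apply: (@filterS _ _ (nbhs_filter r) _ _ _ (orbit_near r0)) => r' H Wr' [t pr'].
  have [|s rr'] := H; first by rewrite Wr'.
  by apply: nO; exists (t - s); exact: reach_trans pr' (reach_sym rr').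
Qed.

(** If W(x, y) = 0, omega is alpha(x / y) and the denominator vanishes, or y = 0 and k
    is infinite; so W(x, y) != 0.  Then k(omega) is the slope of q, and W(q) = W(x, y)
    gives the second coordinate. *)
Lemma phiD5_formula x y (q : 'cV[R]_2) :
  let sigma := root5 (W x y) in
  let omega := alpha (slope x y) - sigma in
  pt x y != 0 -> phiD5 (pt x y) = Some q ->
  kfun omega != None -> kdenom omega != 0 ->
  q = pt (kval omega * sigma / kdenom omega) (sigma / kdenom omega).
Proof.
move=> sigma omega p0 /phiD5P pq ko; rewrite kdenomE// => d0.
have Wq : Wp q = W x y by have := reach_W pq; rewrite pt0 pt1.
have [W0|W0] := eqVneq (W x y) 0.
  exfalso; move: ko d0; rewrite /kval /omega /sigma W0 root50 subr0 alphaK /slope.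
  have [//|y0 _ /=] := eqVneq y 0.
  by rewrite root5_eq0; move: W0; rewrite W_slope// => /eqP; rewrite mulf_eq0 expf_eq0/= (negbTE y0)/= => /eqP ->; rewrite eqxx.
have [|m] := reach_slope _ pq; first by rewrite pt0 pt1.
rewrite pt0 pt1 mulr1 -/sigma -/omega => E.
have kq : kfun omega = slp q.
  by rewrite -(alphaK (slp q)) E kfun_periodic.
move: ko d0; rewrite /kval kq /slope; have [//|y0 _ /= d0] := eqVneq (q 1 0) 0.
rewrite -{1}(ptE q) /sigma -Wq root5W_slope// mulrA.
by congr pt; rewrite ?mulfK// divfK.
Qed.

Lemma abelian_flow_phiD5 : abelian_flow setT (@phiD5 R).
Proof.
split; first exact: projective_flow_phiD5.
move=> p _.
pose X : mpoly.mpoly 2 R := mpoly.mpolyX R (mpoly.mnm1 0).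
pose Y : mpoly.mpoly 2 R := mpoly.mpolyX R (mpoly.mnm1 1).
pose F : mpoly.mpoly 2 R := Wform X Y - mpoly.mpolyC 2 (Wp p).
have FE q : mpoly.meval (fun i => q i 0) F = Wp q - Wp p.
  rewrite /F mpoly.mevalB mpoly.mevalC; congr (_ - _).
  rewrite (@rmorph_Wform _ _ (mpoly.meval (fun i => q i 0))).
  transitivity (Wform (q 0 0) (q 1 0)); last by [].
  by congr (Wform _ _); exact: mpoly.mevalXU.
exists F; last by move=> q [t /pflowP/reach_W Wq]; rewrite FE Wq subrr.
rewrite ltnNge; apply/negP => /mpoly.msize1_polyC Fc.
have := FE (pt 1 0); have := FE 0; rewrite Fc !mpoly.mevalC Wp0 => -> /eqP.
rewrite pt0 pt1 (inj_eq (addIr _)) /W expr1n !(mulr0, expr0n)/= !(addr0, subr0) eq_sym.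
by rewrite ?addr0 oner_eq0.
Qed.

End Orbits.

Import complex.

(** * Rational fields with the rotational symmetry *)

Lemma poly0_seq (F : idomainType) (f : nat -> F) (p : {poly F}) :
  injective f -> (forall n, p.[f n] = 0) -> p = 0.
Proof.
move=> fi H; apply/eqP/negPn/negP => p0.
have := max_poly_roots (rs := [seq f n | n <- iota 0 (size p)]) p0.
rewrite size_map size_iota ltnn => h; apply: notF; apply: h.
  by apply/allP => _ /mapP[n _ ->]; apply/eqP.
by rewrite map_inj_uniq// iota_uniq.
Qed.

Lemma cross_quotients (F : fieldType) (A1 A2 B1 B2 N1 N2 D1 D2 c : F) :
  A1 * D1 = N1 * B1 -> A2 * D2 = N2 * B2 -> N2 * D1 = c * N1 * D2 ->
  D1 != 0 -> D2 != 0 -> A2 * B1 = c * A1 * B2.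
Proof.
move=> h1 h2 h3 d1 d2; apply: (mulfI (mulf_neq0 d1 d2)).
transitivity (A2 * D2 * D1 * B1); first by ring.
rewrite h2; transitivity (N2 * D1 * B1 * B2); first by ring.
rewrite h3; transitivity (c * D2 * (N1 * B1) * B2); first by ring.
by rewrite -h1; ring.
Qed.

Section Circle.
Variable R : realType.
Local Notation C := (R[i]).
Implicit Types (z : C) (t : R).

(** The square of the direction of z, a point of the unit circle. *)
Definition quot z : C := z / z^*.

Lemma conjC_eq0' z : (z^* == 0) = (z == 0).
Proof. exact: fmorph_eq0. Qed.

Lemma circle_poly0 (p : {poly C}) : (forall z, z != 0 -> p.[quot z] = 0) -> p = 0.
Proof.
move=> H; pose f (n : nat) := quot (n%:R +i* 1)%C.
have n0 (n : nat) : (n%:R +i* 1)%C != 0 :> C by rewrite eq_complex /= oner_eq0 andbF.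
apply: (@poly0_seq _ f) => [m n|n]; last exact: H.
rewrite /f /quot => /eqP; rewrite eqr_div ?conjC_eq0'// => /eqP.
move=> /eqP; rewrite eq_complex /= => /andP[_ /eqP h].
have {h} : (m%:R : R) = n%:R by move: h; move: (m%:R : R) (n%:R : R) => a b; lra.
by move/eqP; rewrite eqr_nat => /eqP.
Qed.

(** Polynomial identities need to be checked at nonzero real points only; this is how
    the domain of definition of a rational field is avoided. *)
Lemma line_poly0 (p : {poly C}) : (forall t, t != 0 -> p.[t%:C%C] = 0) -> p = 0.
Proof.
move=> H; apply: (@poly0_seq _ (fun n => (n.+1%:R : R)%:C%C)) => [m n|n].
  by case=> /eqP; rewrite eqr_nat => /eqP[].
by apply: H; rewrite pnatr_eq0.
Qed.

Lemma line_avoid (p : {poly C}) : p != 0 -> exists2 t, t != 0 & p.[t%:C%C] != 0.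
Proof.
move=> p0; apply: contrapT => H; move/eqP: p0; apply; apply: line_poly0 => t t0.
by apply/eqP/negPn/negP => pt; apply: H; exists t.
Qed.

Variables (zeta : C).
Hypotheses (zeta5 : zeta ^+ 5 = 1) (zeta1 : zeta != 1).
Local Notation xi := (zeta ^+ 2).

Lemma zeta_neq0 : zeta != 0.
Proof. by apply: contra_eq_neq zeta5 => ->; rewrite expr0n eq_sym oner_eq0. Qed.

Lemma zeta_conj : zeta * zeta^* = 1.
Proof.
rewrite -normCK; have : `|zeta| ^+ 5 = 1 by rewrite -normrX zeta5 normr1.
by move/eqP; rewrite pexpr_eq1// => /eqP ->; rewrite expr1n.
Qed.

(** The square of zeta is again a primitive fifth root of unity. *)
Lemma xi_exp_inj m n : (m < 5)%N -> (n < 5)%N -> xi ^+ m = xi ^+ n -> m = n.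
Proof.
move=> m5 n5 /eqP; rewrite -!exprM.
have [k pk] := prim_order_exists (isT : 0 < 5)%N zeta5.
have k1 : k != 1%N by apply: contra_neq zeta1 => k1; have := prim_expr_order pk; rewrite k1 expr1.
move=> /(prime_nt_dvdP (isT : prime 5) k1) k5; rewrite k5 in pk.
by rewrite (eq_prim_root_expr pk); lia.
Qed.

Definition rotp (p : {poly C}) : {poly C} := \poly_(i < size p) (xi ^+ i * p`_i).

Lemma coef_rotp p i : (rotp p)`_i = xi ^+ i * p`_i.
Proof. by rewrite coef_poly; case: ltnP => // h; rewrite nth_default// mulr0. Qed.

Lemma horner_rotp p u : (rotp p).[u] = p.[xi * u].
Proof.
rewrite horner_poly horner_coef; apply: eq_bigr => i _.
by rewrite [(xi * u) ^+ i]exprMn mulrCA mulrA.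
Qed.

Lemma rotp_eq0 p : rotp p = 0 -> p = 0.
Proof.
move=> h; apply/polyP => i; have := congr1 (fun q : {poly C} => q`_i) h.
rewrite coef_rotp !coef0 => /eqP.
by rewrite mulf_eq0 (negbTE (expf_neq0 i (expf_neq0 2 zeta_neq0))) => /eqP.
Qed.

(** The equation says that A / B is multiplied by zeta^3 = xi^4 under the rotation
    u -> xi u.  If B has a constant term, comparing the lowest terms shows that A
    starts at u^4, which the sizes allow only for k = 2; then B also has the term
    u^2, by reality, and comparing the terms of degree 6 gives A = 0.  If B has no
    constant term, it has by reality no term of degree k either, so B = 0 or k = 2
    and B is a multiple of u; then A u^(-1) gets the factor xi^4, so that A, of
    degree at most 4, is constant. *)
Lemma rotation_rigidity k (A B : {poly C}) : (k <= 2)%N ->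
  (size A <= k + 3)%N -> (size B <= k + 1)%N ->
  rotp A * B = zeta ^+ 3 *: (A * rotp B) ->
  (forall m, (m <= k)%N -> (B`_m)^* = B`_(k - m)) ->
  [\/ B = 0, A = 0 | [/\ k = 2, A = (A`_0)%:P & B = B`_1 *: 'X /\ B`_1 != 0]].
Proof.
move=> k2 sA sB E real.
have z3 : zeta ^+ 3 = xi ^+ 4.
  by rewrite -exprM -[LHS]mul1r -zeta5 -exprD.
have AE i : (k + 3 <= i)%N -> A`_i = 0 by move=> h; rewrite nth_default// (leq_trans sA).
have BE i : (k + 1 <= i)%N -> B`_i = 0 by move=> h; rewrite nth_default// (leq_trans sB).
have cE n : \sum_(j < n.+1) xi ^+ j * A`_j * B`_(n - j) =
    \sum_(j < n.+1) xi ^+ 4 * (A`_j * (xi ^+ (n - j) * B`_(n - j))).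
  have := congr1 (fun q : {poly C} => q`_n) E; rewrite /= coefZ !coefM z3 => e.
  rewrite -mulr_sumr -[RHS]/(xi ^+ 4 * _).
  transitivity (\sum_(j < n.+1) (rotp A)`_j * B`_(n - j)).
    by apply: eq_bigr => j _; rewrite coef_rotp.
  rewrite e; congr (_ * _); apply: eq_bigr => j _; by rewrite coef_rotp.
have xi_neq m n : (m < 5)%N -> (n < 5)%N -> m != n -> xi ^+ m - xi ^+ n != 0.
  by move=> m5 n5; rewrite subr_eq0; apply: contra_neq; exact: xi_exp_inj.
have [B0|B0] := eqVneq B`_0 0; last first.
  have A4 n : (n < 4)%N -> A`_n = 0.
    elim/ltn_ind: n => n IH n4; have := cE n.
    rewrite !big_ord_recr /= !big1 ?add0r; first last.
    - by move=> i _; rewrite IH ?mulr0 ?mul0r// (ltn_trans _ n4).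
    - by move=> i _; rewrite IH ?mulr0 ?mul0r ?mulr0// (ltn_trans _ n4).
    rewrite subnn expr0 mul1r => /eqP; rewrite -mulrA -subr_eq0 -mulrBl.
    rewrite !mulf_eq0 (negbTE B0) orbF (negbTE (xi_neq _ _ _ _ _)) /=; first by move/eqP.
    - exact: ltn_trans n4 _.
    - by [].
    - by rewrite neq_ltn n4.
  apply: Or32; apply/polyP => n; rewrite coef0.
  have [/A4//|] := ltnP n 4; rewrite leq_eqVlt => /orP[/eqP <-|n4]; last first.
    by apply: AE; apply: leq_trans n4; rewrite addn3 !ltnS.
  have [k1|k2'] := leqP k 1; first by apply: AE; rewrite addn3 !ltnS.
  have {k2 k2'} k2 : k = 2 by apply/eqP; rewrite eqn_leq k2.
  have B2 : B`_2 != 0 by have := real 0%N (leq0n _); rewrite k2 => <-; rewrite conjC_eq0'.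
  have A5 : A`_5 = 0 by apply: AE; rewrite k2.
  have A6 : A`_6 = 0 by apply: AE; rewrite k2.
  have := cE 6; rewrite !big_ord_recr !big_ord0 /= (A4 0%N isT) (A4 1%N isT) (A4 2%N isT) (A4 3%N isT) A5 A6.
  rewrite !(mulr0, mul0r, add0r, addr0) => /eqP.
  have -> : xi ^+ 4 * A`_4 * B`_2 = A`_4 * B`_2 * xi ^+ 4 by ring.
  have -> : xi ^+ 4 * (A`_4 * (xi ^+ 2 * B`_2)) = A`_4 * B`_2 * xi ^+ 1.
    have -> : xi ^+ 1 = xi ^+ 4 * xi ^+ 2 by rewrite -!exprM -exprD (_ : 2 * 4 + 2 * 2 = 10 + 2)%N// exprD (exprM _ 5 2) zeta5 expr1n mul1r.
    by ring.
  rewrite -subr_eq0 -mulrBr !mulf_eq0 (negbTE B2) orbF.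
  by rewrite (negbTE (xi_neq 4 1 _ _ _))// orbF => /eqP.
have [k1|k2'] := leqP k 1.
  apply: Or31; apply/polyP => -[|[|n]]; rewrite coef0//.
    move: k1; rewrite leq_eqVlt => /orP[/eqP k1|]; last by rewrite ltnS leqn0 => /eqP k0; rewrite BE ?k0.
    by have := real 0%N (leq0n _); rewrite k1 => <-; rewrite B0 rmorph0.
  by apply: BE; rewrite addn1 !ltnS (leq_trans k1).
have {k2 k2'} k2 : k = 2 by apply/eqP; rewrite eqn_leq k2.
have B2 : B`_2 = 0 by have := real 0%N (leq0n _); rewrite k2 => <-; rewrite B0 rmorph0.
have BX : B = B`_1 *: 'X.
  apply/polyP => -[|[|[|n]]]; rewrite coefZ coefX ?mulr0 ?mulr1//.
  by rewrite BE// k2.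
have [B1|B1] := eqVneq B`_1 0; first by apply: Or31; rewrite BX B1 scale0r.
apply: Or33; split=> //; apply/polyP => n; rewrite coefC.
case: n => [|n]//=.
have [n4|n4] := ltnP n 4; last by apply: AE; rewrite k2.
have := congr1 (fun q : {poly C} => q`_n.+2) E.
have -> : rotp B = (xi * B`_1) *: 'X.
  apply/polyP => -[|[|[|i]]]; rewrite coef_rotp coefZ coefX ?B0 ?B2 ?mulr0 ?mulr1 ?expr1//.
  by rewrite BE ?mulr0// k2.
rewrite {1}BX coefZ -!scalerAr !coefZ !coefMX /= coef_rotp z3 => /eqP.
have -> : xi ^+ 4 * (xi * B`_1 * A`_n.+1) = B`_1 * (A`_n.+1 * xi ^+ 0).
  have -> : xi ^+ 0 = xi ^+ 4 * xi by rewrite expr0 -exprSr -exprM -[RHS]/(zeta ^+ (5 * 2)) exprM zeta5 expr1n.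
  by ring.
rewrite [xi ^+ n.+1 * _]mulrC -subr_eq0 -!mulrBr !mulf_eq0 (negbTE B1) /=.
by rewrite (negbTE (xi_neq n.+1 0%N _ _ _))// orbF => /eqP.
Qed.

Lemma conj_scale t z : (t%:C%C * z)^* = t%:C%C * z^*.
Proof. by case: z => x y; apply/eqP; rewrite eq_complex /=; apply/andP; split; apply/eqP; ring. Qed.

Lemma quot_scale t z : t != 0 -> quot (t%:C%C * z) = quot z.
Proof.
move=> t0; rewrite /quot conj_scale.
by rewrite -mulf_div divff ?mul1r// eq_complex /= negb_and t0.
Qed.

Lemma quot_rot z : quot (zeta * z) = xi * quot z.
Proof.
have zc0 : zeta^* != 0 by rewrite conjC_eq0' zeta_neq0.
rewrite /quot rmorphM -mulf_div; congr (_ * _).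
by apply: (mulIf zc0); rewrite divfK// expr2 -mulrA zeta_conj mulr1.
Qed.

Lemma quot_conj z : z != 0 -> (quot z)^* = (quot z)^-1.
Proof.
move=> z0; have E : (z / z^* )^* = z^* / (z^* )^* := fmorph_div _ _ _.
by rewrite /quot E conjCK invf_div.
Qed.

Lemma conj_form k z x : (z^* ^+ k * x)^* = z ^+ k * x^*.
Proof.
have E : (z^* ^+ k * x)^* = (z^* )^* ^+ k * x^* by rewrite rmorphM rmorphXn.
by rewrite E conjCK.
Qed.

(** N and d are the numerator, as a complex number, and the denominator of a rational
    field.  A real form of degree k in (x, y) is conj(z)^k times a polynomial of
    degree at most k in z / conj(z), so PA k and PB k encode the homogeneous parts
    of N and d.  The last three hypotheses express the homogeneity of degree 2 and
    the invariance under the rotation and under the reflection z -> i conj(z). *)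
Section Rigidity.
Variables (N d : C -> C) (M : nat) (PA PB : nat -> {poly C}).
Local Notation a k z := (z^* ^+ k * (PA k).[quot z]).
Local Notation b k z := (z^* ^+ k * (PB k).[quot z]).
Hypothesis sPA : forall k, (size (PA k) <= k + 1)%N.
Hypothesis sPB : forall k, (size (PB k) <= k + 1)%N.
Hypothesis M4 : (4 < M)%N.
Hypothesis NE : forall z, z != 0 -> N z = \sum_(k < M) a k z.
Hypothesis dE : forall z, z != 0 -> d z = \sum_(k < 3) b k z.
Hypothesis b_real : forall k z, z != 0 -> (b k z)^* = b k z.
Hypothesis N_hom : forall t z, t != 0 -> z != 0 -> d z != 0 -> d (t%:C%C * z) != 0 ->
  N (t%:C%C * z) * d z = t%:C%C ^+ 2 * N z * d (t%:C%C * z).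
Hypothesis N_rot : forall z, z != 0 -> d z != 0 -> d (zeta * z) != 0 ->
  N (zeta * z) * d z = zeta * N z * d (zeta * z).
Hypothesis N_refl : forall z, z != 0 -> d z != 0 -> d ('i * z^* ) != 0 ->
  N ('i * z^* ) * d z = 'i * (N z)^* * d ('i * z^* ).

Lemma form_scale (P : nat -> {poly C}) k t z : t != 0 ->
  (t%:C%C * z)^* ^+ k * (P k).[quot (t%:C%C * z)] = t%:C%C ^+ k * (z^* ^+ k * (P k).[quot z]).
Proof.
move=> t0; rewrite quot_scale// conj_scale.
by rewrite exprMn mulrA.
Qed.

Lemma realc_neq0 t : t != 0 -> t%:C%C != 0 :> C.
Proof. by move=> t0; rewrite eq_complex /= negb_and t0. Qed.

(** The denominator as a polynomial in the parameter of the line through z. *)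
Definition dline z : {poly C} := \poly_(k < 3) b k z.

Lemma dlineE z t : z != 0 -> t != 0 -> (dline z).[t%:C%C] = d (t%:C%C * z).
Proof.
move=> z0 t0; rewrite dE ?mulf_neq0 ?realc_neq0// horner_poly.
by apply: eq_bigr => k _; rewrite form_scale// mulrC.
Qed.

Lemma dline_neq0 k z : (k < 3)%N -> b k z != 0 -> dline z != 0.
Proof.
move=> k3; apply: contra_neq => h; have := congr1 (fun p : {poly C} => p`_k) h.
by rewrite coef_poly k3 coef0.
Qed.

Lemma d_neq0 z : z != 0 -> d z != 0 -> exists2 k, (k < 3)%N & b k z != 0.
Proof.
move=> z0 dz; apply: contrapT => H; move/eqP: dz; apply; rewrite dE// big1// => k _.
by apply/eqP/negPn/negP => bk; apply: H; exists k.
Qed.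

(** The zeros of d on the lines through z and z' are finite in number, so one can move
    off them by a common real factor. *)
Lemma common_scale k z z' : (k < 3)%N -> z != 0 -> z' != 0 -> b k z != 0 -> b k z' != 0 ->
  exists t, [/\ t != 0, d (t%:C%C * z) != 0 & d (t%:C%C * z') != 0].
Proof.
move=> k3 z0 z0' bz bz'.
have [t t0] := line_avoid (mulf_neq0 (dline_neq0 k3 bz) (dline_neq0 k3 bz')).
rewrite hornerM !dlineE// mulf_eq0 negb_or => /andP[h1 h2].
by exists t.
Qed.

(** On the line through z, N / d is t^2 times its value at z; comparing the
    coefficients of t^(k + 2) in N(t z) d(z) = t^2 N(z) d(t z) replaces N and d by
    homogeneous parts. *)
Lemma graded k z : (k < 3)%N -> z != 0 -> d z != 0 ->
  a k.+2 z * d z = N z * b k z.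
Proof.
move=> k3 z0 dz; have [j j3 bj] := d_neq0 z0 dz.
pose T1 := \poly_(i < M) (a i z * d z); pose T2 := N z *: ('X^2 * dline z).
have T12 : T1 = T2.
  apply/eqP; rewrite -subr_eq0; apply/eqP.
  apply: (mulIf (dline_neq0 j3 bj)); rewrite mul0r; apply: line_poly0 => t t0.
  rewrite hornerM dlineE//; have [->|dt] := eqVneq (d (t%:C%C * z)) 0; first by rewrite mulr0.
  rewrite hornerD hornerN hornerZ hornerM hornerXn dlineE//.
  suff -> : T1.[t%:C%C] = N (t%:C%C * z) * d z.
    by rewrite N_hom//; ring.
  rewrite horner_poly NE ?mulf_neq0 ?realc_neq0// mulr_suml.
  by apply: eq_bigr => i _; rewrite form_scale//; ring.
have := congr1 (fun p : {poly C} => p`_k.+2) T12.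
rewrite coef_poly coefZ coefXnM /= !subSS subn0 coef_poly k3.
by rewrite (leq_ltn_trans _ M4)// !ltnS.
Qed.

(** On the unit circle, conjugation reverses the order of the coefficients. *)
Lemma PB_coef_conj k m : (m <= k)%N -> ((PB k)`_m)^* = (PB k)`_(k - m).
Proof.
have sk : (size (PB k) <= k.+1)%N by rewrite -addn1.
move=> mk; pose P := \poly_(i < k.+1) ((PB k)`_(k - i))^*.
suff PE : PB k = P by rewrite [in RHS]PE coef_poly ltnS leq_subr subKn.
apply/eqP; rewrite -subr_eq0; apply/eqP/circle_poly0 => z z0.
rewrite hornerD hornerN; apply/eqP; rewrite subr_eq0; apply/eqP.
have zc : z^* != 0 by rewrite conjC_eq0'.
have u0 : quot z != 0 by rewrite mulf_neq0 ?invr_neq0.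
apply: (mulfI (expf_neq0 k zc)); rewrite -b_real//.
rewrite conj_form (@horner_coef_wide _ k.+1 (PB k))//.
rewrite rmorph_sum horner_poly [in RHS](reindex_inj rev_ord_inj) !mulr_sumr.
apply: eq_bigr => i _.
have E : ((PB k)`_i * quot z ^+ i)^* = ((PB k)`_i)^* * (quot z)^* ^+ i by rewrite rmorphM rmorphXn.
rewrite [X in _ * X = _]E quot_conj// (_ : nat_of_ord (rev_ord i) = k - i)%N//.
have ik : (i <= k)%N by rewrite -ltnS.
have -> : z ^+ k = z^* ^+ k * quot z ^+ k by rewrite -exprMn mulrC /quot divfK.
rewrite subKn//.
rewrite -{2}(subnK ik) exprD exprVn; field.
by rewrite expf_neq0.
Qed.

Lemma forms_dichotomy k : (k < 3)%N ->
  [\/ PB k = 0, PA k.+2 = 0 |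
   [/\ k = 2, PA k.+2 = ((PA k.+2)`_0)%:P & PB k = (PB k)`_1 *: 'X /\ (PB k)`_1 != 0]].
Proof.
move=> k3; have [B0|B0] := eqVneq (PB k) 0; first exact: Or31.
apply: rotation_rigidity.
- by rewrite -ltnS.
- by apply: leq_trans (sPA _) _; rewrite addn1 addn3.
- exact: sPB.
- apply/eqP; rewrite -subr_eq0; apply/eqP.
  have B0' : rotp (PB k) != 0 by apply: contra_neq B0; exact: rotp_eq0.
  apply: (mulIf (mulf_neq0 B0 B0')); rewrite mul0r; apply: circle_poly0 => z z0.
  rewrite !hornerM hornerD hornerN hornerZ !hornerM !horner_rotp -quot_rot.
  have zc : z^* != 0 by rewrite conjC_eq0'.
  have z0' : zeta * z != 0 by rewrite mulf_neq0 ?zeta_neq0.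
  have zc' : (zeta * z)^* != 0 by rewrite conjC_eq0'.
  have [->|h1] := eqVneq (PB k).[quot z] 0; first by rewrite mul0r mulr0.
  have [->|h2] := eqVneq (PB k).[quot (zeta * z)] 0; first by rewrite !mulr0.
  have [||t [t0 d1 d2]] := @common_scale k z (zeta * z) k3 z0 z0'.
    by rewrite mulf_neq0 ?expf_neq0.
    by rewrite mulf_neq0 ?expf_neq0.
  have tz0 : t%:C%C * z != 0 by rewrite mulf_neq0 ?realc_neq0.
  have tz0' : t%:C%C * (zeta * z) != 0 by rewrite mulf_neq0 ?realc_neq0.
  have swapE : t%:C%C * (zeta * z) = zeta * (t%:C%C * z) by ring.
  rewrite swapE in d2 tz0'.
  have g1 := graded k3 tz0 d1; have g2 := graded k3 tz0' d2; have g3 := N_rot tz0 d1 d2.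
  have q1 : quot (t%:C%C * z) = quot z by exact: quot_scale.
  have q2 : quot (zeta * (t%:C%C * z)) = quot (zeta * z) by rewrite -swapE; exact: quot_scale.
  rewrite q1 in g1; rewrite q2 in g2.
  have cE : (zeta * (t%:C%C * z))^* = zeta^* * (t%:C%C * z)^* := rmorphM _ _ _.
  rewrite cE in g2.
  have Z0 : (t%:C%C * z)^* != 0 by rewrite conjC_eq0'.
  have := cross_quotients g1 g2 g3 d1 d2.
  set Z := (t%:C%C * z)^* in Z0 *.
  set pA := (PA k.+2).[quot z]; set pA' := (PA k.+2).[quot (zeta * z)].
  set pB := (PB k).[quot z]; set pB' := (PB k).[quot (zeta * z)] => key.
  have zc0 : zeta^* != 0 by rewrite conjC_eq0' zeta_neq0.
  have W0 : (zeta^* * Z) ^+ k * Z ^+ k * (zeta^* * Z) ^+ 2 != 0.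
    by rewrite !mulf_neq0 ?expf_neq0 ?mulf_neq0.
  suff -> : pA' * pB - zeta ^+ 3 * (pA * pB') = 0 by rewrite mul0r.
  apply: (mulfI W0); rewrite mulr0 mulrBr.
  have -> : (zeta^* * Z) ^+ k * Z ^+ k * (zeta^* * Z) ^+ 2 * (pA' * pB) =
      (zeta^* * Z) ^+ k.+2 * pA' * (Z ^+ k * pB) by rewrite -[k.+2]addn2 exprD; ring.
  rewrite key -[k.+2]addn2 exprD.
  have -> : (zeta^* * Z) ^+ k * Z ^+ k * (zeta^* * Z) ^+ 2 * (zeta ^+ 3 * (pA * pB')) =
    (zeta * zeta^* ) ^+ 2 * ((zeta^* * Z) ^+ k * Z ^+ k * Z ^+ 2 * zeta * pA * pB') by ring.
  by rewrite zeta_conj; ring.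
- exact: PB_coef_conj.
Qed.

(** In the last case of the dichotomy, N / d is kap conj(z)^3 / z, and the reflection
    gives kap = i conj(kap), so that kap is a real multiple of 1 + i.  If this case
    occurs for no k, then N vanishes wherever d does not. *)
Lemma rigidity : exists c : R, forall z, z != 0 -> d z != 0 ->
  N z = c%:C%C * (1 +i* 1)%C * (z^* ^+ 3 / z) * d z.
Proof.
have [[k k3 [k2 Ak [Bk b1]]]|nex] := pselect (exists2 k, (k < 3)%N &
    [/\ k = 2, PA k.+2 = ((PA k.+2)`_0)%:P & PB k = (PB k)`_1 *: 'X /\ (PB k)`_1 != 0]); last first.
  exists 0 => z z0 dz; rewrite (_ : 0%:C%C = 0)// !mul0r.
  have [k k3 bk] := d_neq0 z0 dz.
  have := graded k3 z0 dz; have [B0|->|h] := forms_dichotomy k3.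
  - by move: bk; rewrite B0 horner0 mulr0 eqxx.
  - rewrite horner0 mulr0 mul0r => /esym/eqP; rewrite mulf_eq0 (negbTE bk) orbF.
    by move/eqP.
  - by exfalso; apply: nex; exists k.
rewrite k2 in k3 Ak Bk b1; move: Ak Bk b1.
set a0 := (PA 4)`_0; set b1 := (PB 2)`_1 => Ak Bk b10.
have NE' z : z != 0 -> d z != 0 -> N z = a0 / b1 * (z^* ^+ 3 / z) * d z.
  move=> z0 dz; have zc : z^* != 0 by rewrite conjC_eq0'.
  have := graded k3 z0 dz; rewrite Ak Bk hornerC hornerZ hornerX /quot => h.
  apply: (mulIf (mulf_neq0 b10 (mulf_neq0 z0 zc))).
  have -> : N z * (b1 * (z * z^* )) = N z * (z^* ^+ 2 * (b1 * (z / z^* ))) by field.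
  by rewrite -h; field; rewrite b10 z0.
pose kap := a0 / b1.
suff [c cE] : exists c : R, kap = c%:C%C * (1 +i* 1)%C.
  by exists c => z z0 dz; rewrite NE'// -/kap cE.
have one0 : 1 != 0 :> C := oner_neq0 _.
have i0 : 'i != 0 :> C by rewrite neq0Ci.
have [||t [t0 d1 d2]] := @common_scale 2 1 'i k3 one0 i0.
- by rewrite Bk hornerZ hornerX /quot rmorph1 divr1 mulr1 expr1n mul1r.
- by rewrite Bk hornerZ hornerX !mulf_neq0 ?expf_neq0 ?invr_neq0 ?conjC_eq0'.
have t1 : t%:C%C != 0 :> C := realc_neq0 t0.
have iE : t%:C%C * 'i = 'i * (t%:C%C * 1)^* by rewrite conj_scale rmorph1; ring.
have tr : (t%:C%C)^* = t%:C%C :> C by rewrite -[in LHS](mulr1 t%:C%C) conj_scale rmorph1 mulr1.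
have dr : (d (t%:C%C * 1))^* = d (t%:C%C * 1).
  rewrite dE ?mulr1// rmorph_sum; apply: eq_bigr => j _; exact: b_real.
have ti0 : t%:C%C * 'i != 0 :> C by rewrite mulf_neq0.
have n1 : N (t%:C%C * 1) = kap * t%:C%C ^+ 2 * d (t%:C%C * 1).
  rewrite NE' ?(mulr1 t%:C%C)//; last by rewrite mulr1 in d1.
  rewrite -[X in X^* ^+ _](mulr1 t%:C%C) conj_scale rmorph1 mulr1 -/kap; congr (_ * _ * _); field.
  exact: t1.
have n2 : N (t%:C%C * 'i) = kap * t%:C%C ^+ 2 * d (t%:C%C * 'i).
  rewrite NE'// conj_scale conjCi -/kap; congr (_ * _ * _).
  rewrite mulrN exprNn exprMn -[(-1) ^+ 3]signr_odd /= expr1.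
  have -> : 'i ^+ 3 = - 'i :> C by rewrite exprS sqrCi mulrN1.
  by field; rewrite ?t1 ?i0.
have t1' : t%:C%C * 1 != 0 :> C by rewrite mulr1.
have d2' : d ('i * (t%:C%C * 1)^* ) != 0 by rewrite -iE.
have := N_refl t1' d1 d2'; rewrite -iE n1 n2.
have -> : (kap * t%:C%C ^+ 2 * d (t%:C%C * 1))^* = kap^* * t%:C%C ^+ 2 * d (t%:C%C * 1).
  apply: (etrans (rmorphM _ _ _)); apply: (etrans (congr1 _ dr)); congr (_ * _).
  apply: (etrans (rmorphM _ _ _)); congr (_ * _).
  by apply: (etrans (rmorphXn _ _ _)); congr (_ ^+ 2).
move=> h.
have {h} : kap = 'i * kap^*.
  apply: (mulIf (mulf_neq0 (mulf_neq0 (expf_neq0 2 t1) d2) d1)).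
  transitivity (kap * t%:C%C ^+ 2 * d (t%:C%C * 'i) * d (t%:C%C * 1)); first by ring.
  by rewrite h; ring.
clear n1 n2; clearbody kap; case: kap => x y /eqP; rewrite -complexiE eq_complex /= => /andP[/eqP hx _]; exists x.
by apply/eqP; rewrite eq_complex /=; apply/andP; split; apply/eqP; lra.
Qed.

End Rigidity.

End Circle.

(** * The dihedral group in complex notation *)

Section Dihedral.
Variable R : realType.
Local Notation C := (R[i]).
Implicit Types (p : 'cV[R]_2) (a b z : C) (M : 'M[R]_2).

Definition toC p : C := (p 0 0 +i* p 1 0)%C.

Lemma toC_inj : injective toC.
Proof. by move=> p q [h0 h1]; exact: col2P. Qed.

Lemma toC_pt (x y : R) : toC (pt x y) = (x +i* y)%C.
Proof. by rewrite /toC pt0 pt1. Qed.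

Lemma toC_scale (t : R) p : toC (t *: p) = t%:C%C * toC p.
Proof. by apply/eqP; rewrite eq_complex /= !mxE; apply/andP; split; apply/eqP; ring. Qed.

Lemma toC_eq0 p : (toC p == 0) = (p == 0).
Proof.
apply/eqP/eqP => [h|->]; last by rewrite /toC !mxE.
by apply: toC_inj; rewrite h /toC !mxE.
Qed.

(** The matrix of z -> a z + b conj(z), the general form of a real linear map. *)
Definition mat a b : 'M[R]_2 := \matrix_(i, j)
  if i == 0 then (if j == 0 then Re a + Re b else Im b - Im a)
  else (if j == 0 then Im a + Im b else Re a - Re b).

Lemma toC_mat a b p : toC (mat a b *m p) = a * toC p + b * (toC p)^*.
Proof.
case: a b => a1 a2 [b1 b2]; apply/eqP; rewrite eq_complex /= !mxE !big_ord_recl !big_ord0 /= !mxE /=.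
have -> : lift ord0 ord0 = 1 :> 'I_2 by apply/val_inj.
by apply/andP; split; apply/eqP; ring.
Qed.

Lemma mat_surj M : exists a b, M = mat a b.
Proof.
exists ((M 0 0 + M 1 1) / 2 +i* ((M 1 0 - M 0 1) / 2))%C,
  ((M 0 0 - M 1 1) / 2 +i* ((M 1 0 + M 0 1) / 2))%C.
apply/matrixP => -[[|[|//]] i2] [[|[|//]] j2]; rewrite mxE /=.
- rewrite (_ : Ordinal i2 = 0); last exact/val_inj.
  rewrite (_ : Ordinal j2 = 0); last exact/val_inj. lra.
- rewrite (_ : Ordinal i2 = 0); last exact/val_inj.
  rewrite (_ : Ordinal j2 = 1); last exact/val_inj. lra.
- rewrite (_ : Ordinal i2 = 1); last exact/val_inj.
  rewrite (_ : Ordinal j2 = 0); last exact/val_inj. lra.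
- rewrite (_ : Ordinal i2 = 1); last exact/val_inj.
  rewrite (_ : Ordinal j2 = 1); last exact/val_inj. lra.
Qed.

Lemma mat_inj a b a' b' : mat a b = mat a' b' -> a = a' /\ b = b'.
Proof.
move=> h; have H p := congr1 (fun M => toC (M *m p)) h.
have h1 := H (pt 1 0); have h2 := H (pt 0 1).
rewrite /= !toC_mat !toC_pt in h1 h2; move: h1 h2; clear.
case: a b a' b' => [a1 a2] [b1 b2] [a1' a2'] [b1' b2'] /=.
move=> /eqP + /eqP; rewrite !eq_complex /= => /andP[/eqP h1 /eqP h2] /andP[/eqP h3 /eqP h4].
by split; apply/eqP; rewrite eq_complex /=; apply/andP; split; apply/eqP; lra.
Qed.

Lemma mx_toC M M' : (forall p, toC (M *m p) = toC (M' *m p)) -> M = M'.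
Proof.
move=> h; apply/matrixP => i j.
have : M *m (delta_mx j 0 : 'cV[R]_2) = M' *m (delta_mx j 0 : 'cV[R]_2).
  by apply: toC_inj; exact: h.
by rewrite -!colE => /matrixP/(_ i 0); rewrite !mxE.
Qed.

Lemma mat_mul a b a' b' : mat a b *m mat a' b' = mat (a * a' + b * b'^*) (a * b' + b * a'^*).
Proof.
apply: mx_toC => p; rewrite -mulmxA !toC_mat.
have -> : (a' * toC p + b' * (toC p)^* )^* = a'^* * (toC p)^* + b'^* * toC p.
  apply: (etrans (rmorphD _ _ _)); congr (_ + _); apply: (etrans (rmorphM _ _ _)) => //.
  by congr (_ * _); exact: conjCK.
by ring.
Qed.

Lemma mat1 : mat 1 0 = 1%:M.
Proof. by apply: mx_toC => p; rewrite toC_mat mul1mx mul1r mul0r addr0. Qed.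

Definition zeta : C := (cos (2 * pi / 5) +i* sin (2 * pi / 5))%C.

Lemma rotation5E : rotation5 R = mat zeta 0.
Proof.
apply/matrixP => -[[|[|//]] i2] [[|[|//]] j2]; rewrite !mxE /= ?addr0 ?subr0 ?add0r ?sub0r//.
Qed.

Lemma swap2E : swap2 R = mat 0 'i.
Proof.
rewrite -complexiE; apply/matrixP => -[[|[|//]] i2] [[|[|//]] j2]; rewrite !mxE /=; lra.
Qed.

Lemma de_moivre (x : R) n : (cos x +i* sin x)%C ^+ n = (cos (x *+ n) +i* sin (x *+ n))%C.
Proof.
elim: n => [|n IH]; first by rewrite expr0 mulr0n cos0 sin0.
rewrite exprS IH mulrS cosD sinD; apply/eqP; rewrite eq_complex /=.
by apply/andP; split; apply/eqP; ring.
Qed.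

Lemma zeta5 : zeta ^+ 5 = 1.
Proof.
have E : (2 * pi / 5) *+ 5 = pi *+ 2 :> R by move: (@pi R) => x; lra.
by rewrite /zeta de_moivre E cos2pi sin2pi.
Qed.

Lemma zeta_neq1 : zeta != 1.
Proof.
rewrite eq_complex /= negb_and; apply/orP; right; rewrite gt_eqF//; apply: sin_gt0_pi.
have := pi_gt0 R; move: pi => x x0; apply/andP; split; lra.
Qed.

Lemma zeta_prim : 5.-primitive_root zeta.
Proof.
have [k pk] := prim_order_exists (isT : 0 < 5)%N zeta5.
have k1 : k != 1%N.
  by apply: contra_neq zeta_neq1 => k1; have := prim_expr_order pk; rewrite k1 expr1.
by move=> /(prime_nt_dvdP (isT : prime 5) k1) k5; rewrite k5 in pk.
Qed.

Lemma unit_conj a : a ^+ 5 * a^* ^+ 5 = 1 -> a * a^* = 1.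
Proof.
rewrite -exprMn -normCK => /eqP.
rewrite -exprM pexpr_eq1// => /eqP ->; by rewrite expr1n.
Qed.

Lemma root1_conj a : a ^+ 5 = 1 -> a * a^* = 1.
Proof.
move=> h; apply: unit_conj; rewrite h mul1r.
by apply: (etrans (esym (rmorphXn _ _ _))); rewrite h; exact: rmorph1.
Qed.

Lemma rooti_conj b : b ^+ 5 = 'i -> b * b^* = 1.
Proof.
move=> h; apply: unit_conj; rewrite h.
have -> : b^* ^+ 5 = - 'i.
  by apply: (etrans (esym (rmorphXn _ _ _))); rewrite h; exact: conjCi.
by rewrite mulrN -expr2 sqrCi opprK.
Qed.

(** The ten maps z -> a z with a^5 = 1 and z -> b conj(z) with b^5 = i; the generating
    reflection, the exchange of the coordinates, is z -> i conj(z). *)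
Definition D5mx : set 'M[R]_2 :=
  [set mat a 0 | a in [set a : C | a ^+ 5 = 1]] `|` [set mat 0 b | b in [set b : C | b ^+ 5 = 'i]].

Lemma conjMe a b : (a * b)^* = a^* * b^*. Proof. exact: rmorphM. Qed.
Lemma conjDe a b : (a + b)^* = a^* + b^*. Proof. exact: rmorphD. Qed.
Lemma conjXe a n : (a ^+ n)^* = a^* ^+ n. Proof. exact: rmorphXn. Qed.
Lemma conjVe a : (a^-1)^* = a^*^-1. Proof. exact: fmorphV. Qed.

Lemma D5mx_group : matrix_group D5mx.
Proof.
have inv M M' : M' *m M = 1%:M -> M \in unitmx /\ invmx M = M'.
  move=> h; have [h1 h2] := mulmx1_unit h; split=> //.
  by rewrite -[LHS]mul1mx -h -mulmxA mulmxV// mulmx1.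
have ia a : a ^+ 5 = 1 -> mat a^* 0 *m mat a 0 = 1%:M.
  by move=> /root1_conj h; rewrite mat_mul !mul0r !addr0 mulr0 [_ * a]mulrC h mat1.
have ib b : b ^+ 5 = 'i -> mat 0 b *m mat 0 b = 1%:M.
  by move=> /rooti_conj h; rewrite mat_mul !mul0r !add0r h rmorph0 mulr0 mat1.
split.
- by move=> M [] [a ha <-]; [have [] := inv _ _ (ia _ ha) | have [] := inv _ _ (ib _ ha)].
- by left; exists 1; rewrite ?mat1//= expr1n.
- move=> M M' [] [a /= ha <-] [] [a' /= ha' <-]; rewrite mat_mul.
  + left; exists (a * a'); first by rewrite /= exprMn ha ha' mulr1.
    by rewrite !mul0r mulr0 !addr0.
  + right; exists (a * a'); first by rewrite /= exprMn ha ha' mul1r.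
    by rewrite !mul0r mulr0 !addr0.
  + right; exists (a * a'^* ); first by rewrite /= exprMn ha -conjXe ha' rmorph1 mulr1.
    by rewrite !mul0r rmorph0 mulr0 !add0r.
  + left; exists (a * a'^* ).
      by rewrite /= exprMn ha -conjXe ha' conjCi mulrN -expr2 sqrCi opprK.
    by rewrite !mul0r rmorph0 mulr0 !add0r.
- move=> M [] [a ha <-].
    have [_ ->] := inv _ _ (ia _ ha); left; exists a^*; rewrite //= -conjXe ha.
    exact: rmorph1.
  by have [_ ->] := inv _ _ (ib _ ha); right; exists a.
Qed.

Lemma root1P a : a ^+ 5 = 1 -> exists k : 'I_5, a = zeta ^+ k.
Proof. by move=> /(prim_rootP zeta_prim)[k ->]; exists k. Qed.

Lemma rootiP b : b ^+ 5 = 'i -> exists k : 'I_5, b = zeta ^+ k * 'i.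
Proof.
move=> h; have [|k kE] := @root1P (b / 'i).
  have i5 : 'i ^+ 5 = 'i :> C by rewrite (exprD _ 4 1) expr1 (exprM _ 2 2) sqrCi -signr_odd expr0 mul1r.
  by rewrite expr_div_n h i5 mulfV// neq0Ci.
by exists k; rewrite -kE divfK// neq0Ci.
Qed.

Lemma D5E : @D5 R = D5mx.
Proof.
apply/seteqP; split.
  apply: smallest_sub; first exact: D5mx_group.
  move=> M [->|->].
    by rewrite rotation5E; left; exists zeta => //=; exact: zeta5.
  rewrite swap2E; right; exists 'i => //=.
  by rewrite (exprD _ 4 1) expr1 (exprM _ 2 2) sqrCi -signr_odd expr0 mul1r.
move=> M HM G [[_ G1 GM _] sub].
have Gz k : G (mat (zeta ^+ k) 0).
  elim: k => [|k IH]; first by rewrite expr0 mat1.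
  rewrite exprS (_ : mat _ 0 = mat zeta 0 *m mat (zeta ^+ k) 0).
    by apply: GM => //; rewrite -rotation5E; apply: sub; left.
  by rewrite mat_mul !mul0r mulr0 !addr0.
case: HM => [] [a /= ha <-].
  by have [k ->] := root1P ha.
have [k ->] := rootiP ha.
rewrite (_ : mat 0 _ = mat (zeta ^+ k) 0 *m mat 0 'i).
  by apply: GM => //; rewrite -swap2E; apply: sub; right.
by rewrite mat_mul !mul0r mulr0 !addr0.
Qed.

Lemma card_D5 : @D5 R #= `I_10.
Proof.
rewrite D5E; pose f (n : nat) := if (n < 5)%N then mat (zeta ^+ n) 0 else mat 0 (zeta ^+ (n - 5) * 'i).
have -> : D5mx = f @` `I_10.
  apply/seteqP; split=> M.
    case=> [] [a /= ha <-].
      have [k ->] := root1P ha; exists k => /=; first exact: leq_trans (ltn_ord k) _.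
      by rewrite /f ltn_ord.
    have [k ->] := rootiP ha; exists (k + 5)%N => /=; first by have := ltn_ord k; lia.
    by rewrite /f ltnNge leq_addl addnK.
  move=> [n /= n10 <-]; rewrite /f; case: ltnP => n5.
    left; exists (zeta ^+ n) => //=; by rewrite -exprM mulnC exprM zeta5 expr1n.
  right; exists (zeta ^+ (n - 5) * 'i) => //=.
  rewrite exprMn -exprM mulnC exprM zeta5 expr1n mul1r.
  by rewrite (exprD _ 4 1) expr1 (exprM _ 2 2) sqrCi -signr_odd expr0 mul1r.
apply: inj_card_eq => m n; rewrite !inE => m10 n10; rewrite /f.
have zn0 k : zeta ^+ k != 0 by rewrite expf_neq0// (zeta_neq0 zeta5).
have inj i j : (i < 5)%N -> (j < 5)%N -> zeta ^+ i = zeta ^+ j -> i = j.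
  by move=> i5 j5 /eqP; rewrite (eq_prim_root_expr zeta_prim) !modn_small// => /eqP.
case: ltnP => m5; case: ltnP => n5 /mat_inj[e1 e2].
- exact: inj.
- by move: (zn0 m); rewrite e1 eqxx.
- by move: (zn0 n); rewrite -e1 eqxx.
- have m10' : (m < 10)%N := m10; have n10' : (n < 10)%N := n10.
  have m5' : (m - 5 < 5)%N by lia.
  have n5' : (n - 5 < 5)%N by lia.
  by have := inj _ _ m5' n5' (mulIf (neq0Ci _) e2); lia.
Qed.

Definition Qz z : C := (1 +i* 1)%C * z^* ^+ 3 / z.

Lemma toC_QD5 p : toC (QD5 p) = Qz (toC p).
Proof. by rewrite QD5E toC_pt -QCE. Qed.

Lemma conj1i : ((1 +i* 1)%C : C)^* = (1 -i* 1)%C.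
Proof. by []. Qed.

Lemma Qz_conj z : (Qz z)^* = (1 -i* 1)%C * z ^+ 3 / z^*.
Proof.
apply: (etrans (conjMe _ _)); rewrite conjVe; congr (_ / _).
apply: (etrans (conjMe _ _)); rewrite conj1i; congr (_ * _).
by apply: (etrans (conjXe _ _)); rewrite conjCK.
Qed.

(** With |a| = 1, conj(a)^3 / a = a^(-4) = a. *)
Lemma Qz_rot a z : a ^+ 5 = 1 -> Qz (a * z) = a * Qz z.
Proof.
move=> a5; have h := root1_conj a5.
have a0 : a != 0 by apply: contra_eq_neq a5 => ->; rewrite expr0n eq_sym oner_eq0.
have aE : a^* ^+ 3 / a = a.
  apply: (mulIf a0); rewrite divfK//; apply: (mulIf (expf_neq0 3 a0)).
  rewrite -exprMn [a^* * a]mulrC h expr1n -a5; ring.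
rewrite /Qz conjMe exprMn invfM.
transitivity ((a^* ^+ 3 / a) * ((1 +i* 1)%C * z^* ^+ 3 / z)); first by ring.
by rewrite aE.
Qed.

(** With |b| = 1, the field is multiplied by conj(b)^3 / b = b^(-4), while
    b conj(Qz z) has the factor b conj(1 + i); the ratio is b^5 (1 - i) / (1 + i) =
    b^5 / i. *)
Lemma Qz_refl b z : b ^+ 5 = 'i -> Qz (b * z^* ) = b * (Qz z)^*.
Proof.
move=> b5; have h := rooti_conj b5.
have b0 : b != 0 by apply: contra_eq_neq b5 => ->; rewrite expr0n eq_sym neq0Ci.
have bE : (1 +i* 1)%C * (b^* ^+ 3 / b) = b * (1 -i* 1)%C.
  apply: (mulIf b0); rewrite -mulrA divfK//; apply: (mulIf (expf_neq0 3 b0)).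
  rewrite -mulrA -exprMn [b^* * b]mulrC h expr1n mulr1.
  have -> : b * (1 -i* 1)%C * b * b ^+ 3 = b ^+ 5 * (1 -i* 1)%C by ring.
  by rewrite b5 -complexiE; apply/eqP; rewrite eq_complex /=; apply/andP; split; apply/eqP; ring.
rewrite Qz_conj /Qz conjMe conjCK exprMn invfM.
transitivity ((1 +i* 1)%C * (b^* ^+ 3 / b) * (z ^+ 3 / z^* )); first by ring.
by rewrite bE; ring.
Qed.

Lemma symmetriesP M : M \in unitmx ->
  (forall p, invmx M *m QD5 (M *m p) = QD5 p) <-> (forall p, QD5 (M *m p) = M *m QD5 p).
Proof.
move=> Mu; split=> h p; first by rewrite -[in RHS]h mulKVmx.
by rewrite h mulKmx.
Qed.

(** On the line y = 1, where z = x + i and conj(z) = x - i, commuting with the field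
    becomes, after multiplication by the denominators, an identity between
    polynomials in x.  At the complex point x = - i, where z = 0, it says
    that a b is 0 up to a nonzero factor. *)
Lemma commute_QD5 a b : mat a b \in unitmx ->
  (forall p, QD5 (mat a b *m p) = mat a b *m QD5 p) -> a = 0 \/ b = 0.
Proof.
move=> u H.
pose Z : {poly C} := 'X + 'i%:P; pose W' : {poly C} := 'X - 'i%:P.
pose E := (1 +i* 1)%C%:P * (a^*%:P * W' + b^*%:P * Z) ^+ 3 * Z * W' -
  (a%:P * Z + b%:P * W') * ((a * (1 +i* 1)%C)%:P * W' ^+ 4 + (b * (1 -i* 1)%C)%:P * Z ^+ 4).
have E0 : E = 0.
  apply: line_poly0 => t _.
  have zE : toC (pt t 1) = t%:C%C + 'i.
    rewrite toC_pt -complexiE; apply/eqP; rewrite eq_complex /=.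
    by apply/andP; split; apply/eqP; ring.
  have zcE : (toC (pt t 1))^* = t%:C%C - 'i.
    rewrite toC_pt -complexiE; apply/eqP; rewrite eq_complex /=.
    by apply/andP; split; apply/eqP; ring.
  have p0 : pt t 1 != 0 by rewrite pt_eq0 oner_eq0 andbF.
  have z0 : toC (pt t 1) != 0 by rewrite toC_eq0.
  have m0 : toC (mat a b *m pt t 1) != 0.
    rewrite toC_eq0; apply: contra_neq p0 => h.
    by rewrite -[LHS](mulKmx u) h mulmx0.
  have := congr1 toC (H (pt t 1)); rewrite toC_QD5 !toC_mat toC_QD5 Qz_conj.
  move: z0 m0; rewrite toC_mat !(hornerD, hornerN, hornerM, horner_exp, hornerC, hornerX) -zcE -zE.
  move: (toC _) => z z0 m0; have zc0 : z^* != 0 by rewrite conjC_eq0'.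
  have mc : (a * z + b * z^* )^* = a^* * z^* + b^* * z.
    apply: (etrans (conjDe _ _)); rewrite conjMe; congr (_ + _).
    by apply: (etrans (conjMe _ _)); rewrite conjCK.
  rewrite /Qz mc => /(congr1 (fun x => x * (a * z + b * z^* ) * z * z^* )).
  rewrite divfK// => ->; field; exact/andP.
have := congr1 (fun p : {poly C} => p.[- 'i]) E0.
rewrite /= !(hornerD, hornerN, hornerM, horner_exp, hornerC, hornerX) addNr.
have -> : - 'i - 'i = - (2 * 'i) :> C by ring.
rewrite !(mulr0, mul0r, expr0n, addr0, sub0r, add0r) => /eqP.
rewrite oppr_eq0 !mulf_eq0 !oppr_eq0 !mulf_eq0 pnatr_eq0 (negbTE (neq0Ci _)) /= !orbF.
have i0 : (1 +i* 1)%C != 0 :> C by rewrite eq_complex /= oner_eq0.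
by rewrite (negbTE i0) orbF => /orP[/eqP|/eqP]; [right|left].
Qed.

(** As a b = 0, the equation at the point z = 1 gives |a| = 1 and a^5 = 1, or |b| = 1
    and b^5 = i. *)
Lemma symmetries_QD5 : symmetries (@QD5 R) = @D5 R.
Proof.
rewrite D5E; have [gu _ _ _] := D5mx_group; apply/seteqP; split=> M.
  move=> [Mu /(symmetriesP Mu)]; have [a [b ME]] := mat_surj M; rewrite ME in Mu * => H.
  have H1 := congr1 toC (H (pt 1 0)); rewrite toC_QD5 !toC_mat toC_QD5 Qz_conj toC_pt in H1.
  have c1 : ((1 +i* 0)%C : C) = 1 by [].
  rewrite c1 /Qz !rmorph1 !expr1n !divr1 !mulr1 in H1.
  have nz : toC (mat a b *m pt 1 0) != 0.
    rewrite toC_eq0; apply/negP => /eqP h.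
    have : pt 1 0 != 0 :> 'cV[R]_2 by rewrite pt_eq0 oner_eq0.
    by rewrite -[pt 1 0](mulKmx Mu) h mulmx0 eqxx.
  rewrite toC_mat toC_pt c1 rmorph1 !mulr1 in nz.
  move: H1 => /(congr1 (fun x => x * (a + b))); rewrite divfK// => H1.
  have n11 : `|(1 +i* 1)%C : C| = `|(1 -i* 1)%C : C| by rewrite -conj1i norm_conjC.
  have i0 : (1 +i* 1)%C != 0 :> C by rewrite eq_complex /= oner_eq0.
  have i0' : (1 -i* 1)%C != 0 :> C by rewrite eq_complex /= oner_eq0.
  have unit c : c != 0 -> `|c| ^+ 3 = `|c| ^+ 2 -> c * c^* = 1.
    move=> cn0 h; rewrite -normCK; suff -> : `|c| = 1 by rewrite expr1n.
    have n0 : `|c| ^+ 2 != 0 by rewrite expf_neq0// normr_eq0.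
    by apply: (mulIf n0); rewrite mul1r -exprS.
  have [a0|b0] := commute_QD5 Mu H.
    rewrite a0 !mul0r !add0r in H1 nz; right; exists b; last by rewrite a0.
    have bb : b * b^* = 1.
      apply: unit => //; have := congr1 (fun x => `|x|) H1.
      rewrite normrM normrX !normrM norm_conjC -n11 => h.
      apply: (mulfI (_ : `|(1 +i* 1)%C : C| != 0)); first by rewrite normr_eq0.
      by rewrite h; ring.
    apply: (mulIf i0') => /=; have -> : 'i * (1 -i* 1)%C = (1 +i* 1)%C :> C.
      by rewrite -complexiE; apply/eqP; rewrite eq_complex /=; apply/andP; split; apply/eqP; ring.
    transitivity (b * (1 -i* 1)%C * b * b ^+ 3); first by ring.
    by rewrite -H1 -mulrA -exprMn [b^* * b]mulrC bb expr1n mulr1.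
  rewrite b0 !mul0r !addr0 in H1 nz; left; exists a; last by rewrite b0.
  have aa : a * a^* = 1.
    apply: unit => //; have := congr1 (fun x => `|x|) H1.
    rewrite normrM normrX !normrM norm_conjC => h.
    apply: (mulfI (_ : `|(1 +i* 1)%C : C| != 0)); first by rewrite normr_eq0.
    by rewrite h; ring.
  apply: (mulIf i0) => /=; rewrite mul1r.
  transitivity (a * (1 +i* 1)%C * a * a ^+ 3); first by ring.
  by rewrite -H1 -mulrA -exprMn [a^* * a]mulrC aa expr1n mulr1.
move=> HM; have Mu := gu _ HM; split=> //; apply/(symmetriesP Mu) => p; apply: toC_inj.
case: HM => [] [a /= ha <-]; rewrite toC_QD5 !toC_mat toC_QD5.
  by rewrite !mul0r !addr0; exact: Qz_rot.
by rewrite !mul0r !add0r; exact: Qz_refl.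
Qed.

End Dihedral.

(** * Real polynomials in the coordinate z *)

Section Forms.
Variable R : realType.
Local Notation C := (R[i]).
Local Notation mpoly2 := (mpoly.mpoly 2 R).
Implicit Types (z : C) (q : 'cV[R]_2) (p : mpoly2).

Definition mev p q : R := mpoly.meval (fun i => q i 0) p.

Definition ofC z : 'cV[R]_2 := pt (Re z) (Im z).

Lemma ofCK z : toC (ofC z) = z.
Proof. by rewrite toC_pt; case: z. Qed.

Lemma toCK q : ofC (toC q) = q.
Proof. by rewrite /ofC /toC /= ptE. Qed.

Lemma addC_conj z : z + z^* = (Re z)%:C%C + (Re z)%:C%C.
Proof. by case: z => x y; apply/eqP; rewrite eq_complex /=; apply/andP; split; apply/eqP; ring. Qed.

Lemma subC_conj z : z - z^* = 'i * ((Im z)%:C%C + (Im z)%:C%C).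
Proof.
rewrite -complexiE; case: z => x y; apply/eqP; rewrite eq_complex /=.
by apply/andP; split; apply/eqP; ring.
Qed.

(** x^a y^b, with x = conj(z) (u + 1) / 2 and y = conj(z) (u - 1) / (2 i) for
    u = z / conj(z), divided by conj(z)^(a + b). *)
Definition monomial_form (a b : nat) : {poly C} :=
  (2^-1 *: ('X + 1%:P)) ^+ a * ((2 * 'i)^-1 *: ('X - 1%:P)) ^+ b.

Lemma monomial_formE a b z : z != 0 ->
  z^* ^+ (a + b) * (monomial_form a b).[quot z] = ((Re z) ^+ a * (Im z) ^+ b)%:C%C.
Proof.
move=> z0; have zc : z^* != 0 by rewrite conjC_eq0'.
have i0 : 'i != 0 :> C := neq0Ci _.
rewrite /monomial_form !(hornerM, horner_exp, hornerZ, hornerD, hornerN, hornerX, hornerC).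
have -> : (Re z ^+ a * Im z ^+ b)%:C%C = (Re z)%:C%C ^+ a * (Im z)%:C%C ^+ b.
  by apply: (etrans (rmorphM _ _ _)); congr (_ * _); exact: rmorphXn.
rewrite exprD mulrACA -!exprMn; congr (_ ^+ _ * _ ^+ _).
- have -> : z^* * (2^-1 * (quot z + 1)) = (z + z^* ) / 2 by rewrite /quot; field.
  by rewrite addC_conj; field.
- have -> : z^* * ((2 * 'i)^-1 * (quot z - 1)) = (z - z^* ) / (2 * 'i).
    by rewrite /quot; field; rewrite i0.
  by rewrite subC_conj; field; rewrite i0.
Qed.

Lemma size_monomial_form a b : (size (monomial_form a b) <= a + b + 1)%N.
Proof.
have sl (c e : C) n : (size ((c *: ('X + e%:P)) ^+ n) <= n.+1)%N.
  have s2 : (size (c *: ('X + e%:P)) <= 2)%N.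
    by rewrite (leq_trans (size_scale_leq _ _))// size_XaddC.
  apply: leq_trans (size_poly_exp_leq _ _) _; rewrite ltnS.
  by move: s2; move: (size _) => [|[|[|k]]]//= _; rewrite ?mul0n ?mul1n.
have h1 := sl 2^-1 1 a; have := sl (2 * 'i)^-1 (- 1) b; rewrite polyCN => h2.
rewrite /monomial_form; apply: leq_trans (size_polyMleq _ _) _.
move: h1 h2; set m := size _; set n := size _ => h1 h2; lia.
Qed.

Definition form p (k : nat) : {poly C} := \sum_(m <- mpoly.msupp p)
  if mpoly.mdeg m == k then (mpoly.mcoeff m p)%:C%C *: monomial_form (m ord0) (m 1) else 0.

Lemma size_form p k : (size (form p k) <= k + 1)%N.
Proof.
rewrite /form; elim/big_ind: _ => [|f g hf hg|m _]; first by rewrite size_poly0.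
  by rewrite (leq_trans (size_polyD _ _))// geq_max hf.
case: eqP => [<-|_]; last by rewrite size_poly0.
apply: leq_trans (size_scale_leq _ _) _; apply: leq_trans (size_monomial_form _ _) _.
rewrite mpoly.mdegE big_ord_recl big_ord1; apply: eq_leq; congr (_ + m _ + _)%N.
exact/val_inj.
Qed.

Lemma formE p k z : z != 0 ->
  z^* ^+ k * (form p k).[quot z] = (\sum_(m <- mpoly.msupp p)
   if mpoly.mdeg m == k then mpoly.mcoeff m p * (Re z ^+ m ord0 * Im z ^+ m 1) else 0)%:C%C.
Proof.
move=> z0; rewrite /form horner_sum mulr_sumr rmorph_sum /=; apply: eq_bigr => m _.
case: eqP => [<-|_]; last by rewrite horner0 mulr0.
rewrite hornerZ mulrCA.
apply: (etrans _ (esym (rmorphM _ _ _))); congr (_ * _).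
apply: (etrans _ (monomial_formE _ _ z0)); congr (_ ^+ _ * _).
rewrite mpoly.mdegE big_ord_recl big_ord1; congr (_ + m _)%N.
exact/val_inj.
Qed.

Lemma mev_form p M z : (mpoly.msize p <= M)%N -> z != 0 ->
  (mev p (ofC z))%:C%C = \sum_(k < M) z^* ^+ k * (form p k).[quot z].
Proof.
move=> pM z0; under eq_bigr => k _ do rewrite formE//.
rewrite -rmorph_sum; congr (_%:C%C); rewrite exchange_big /mev mpoly.mevalE /=.
rewrite !big_seq; apply: eq_bigr => m mp.
have mM : (mpoly.mdeg m < M)%N by apply: leq_trans pM; exact: mpoly.msize_mdeg_lt.
rewrite (bigD1 (Ordinal mM))//= eqxx [X in _ + X]big1 ?addr0; last first.
  by move=> i; rewrite -val_eqE /= eq_sym => /negbTE ->.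
congr (_ * _); rewrite big_ord_recl big_ord1 /ofC pt0; congr (_ * _ ^+ m _).
  by rewrite mxE.
exact/val_inj.
Qed.

Lemma form_real p k z : z != 0 ->
  (z^* ^+ k * (form p k).[quot z])^* = z^* ^+ k * (form p k).[quot z].
Proof. by move=> z0; rewrite formE//; apply/eqP; rewrite eq_complex /= oppr0 !eqxx. Qed.

End Forms.

(** * The superflow property *)
Section Superflow.
Variable R : realType.
Local Notation C := (R[i]).
Local Notation mpoly2 := (mpoly.mpoly 2 R).
Let x_ : mpoly2 := mpoly.mpolyX R (mpoly.mnm1 ord0).
Let y_ : mpoly2 := mpoly.mpolyX R (mpoly.mnm1 1).

Definition denD5 : mpoly2 := x_ ^+ 2 + y_ ^+ 2.
Definition numD5 (i : 'I_2) : mpoly2 :=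
  if i == ord0 then x_ ^+ 4 + 4 * x_ ^+ 3 * y_ - 6 * x_ ^+ 2 * y_ ^+ 2 - 4 * x_ * y_ ^+ 3 + y_ ^+ 4
  else x_ ^+ 4 - 4 * x_ ^+ 3 * y_ - 6 * x_ ^+ 2 * y_ ^+ 2 + 4 * x_ * y_ ^+ 3 + y_ ^+ 4.

Lemma mev_x (q : 'cV[R]_2) : mpoly.meval (fun i => q i 0) x_ = q 0 0 :> R.
Proof. exact: mpoly.mevalXU. Qed.

Lemma mev_y (q : 'cV[R]_2) : mpoly.meval (fun i => q i 0) y_ = q 1 0 :> R.
Proof. exact: mpoly.mevalXU. Qed.

Lemma mev_den (q : 'cV[R]_2) : mpoly.meval (fun i => q i 0) denD5 = q 0 0 ^+ 2 + q 1 0 ^+ 2 :> R.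
Proof.
have quadratic (B E : comNzRingType) (f : {rmorphism B -> E}) (x y : B) :
  f (x ^+ 2 + y ^+ 2) = f x ^+ 2 + f y ^+ 2 by rewrite rmorphD !rmorphXn.
by rewrite -(mev_x q) -(mev_y q); exact: (quadratic _ _ (mpoly.meval _)).
Qed.

Lemma denD5_neq0 : denD5 != 0.
Proof.
apply/eqP => h; have := mev_den (pt 1 0); rewrite h rmorph0 pt0 pt1 expr1n expr0n addr0.
by move/eqP; rewrite eq_sym oner_eq0.
Qed.

Lemma msize_denD5 : (mpoly.msize denD5 <= 3)%N.
Proof.
apply: leq_trans (mpoly.msizeD_le _ _) _.
by rewrite geq_max /x_ /y_ !mpoly.mpolyXn !mpoly.msizeX !mpoly.mdegMn !mpoly.mdeg1.
Qed.

Definition ratD5 : ratvf R 2 := RatVF numD5 denD5_neq0.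

Lemma reval_ratD5 q : reval ratD5 q = QD5 q.
Proof.
have quartic (B E : comNzRingType) (f : {rmorphism B -> E}) (x y : B) :
  (f (x ^+ 4 + 4 * x ^+ 3 * y - 6 * x ^+ 2 * y ^+ 2 - 4 * x * y ^+ 3 + y ^+ 4) =
   f x ^+ 4 + 4 * f x ^+ 3 * f y - 6 * f x ^+ 2 * f y ^+ 2 - 4 * f x * f y ^+ 3 + f y ^+ 4) *
  (f (x ^+ 4 - 4 * x ^+ 3 * y - 6 * x ^+ 2 * y ^+ 2 + 4 * x * y ^+ 3 + y ^+ 4) =
   f x ^+ 4 - 4 * f x ^+ 3 * f y - 6 * f x ^+ 2 * f y ^+ 2 + 4 * f x * f y ^+ 3 + f y ^+ 4).
  by split; rewrite !(rmorphXn, rmorph_nat, rmorphB, rmorphM, rmorphD).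
have [h0 h1] := quartic _ _ (mpoly.meval (fun i => q i 0)) x_ y_.
apply: col2P; rewrite mxE /= mev_den QD5E ?pt0 ?pt1 /numD5 /=.
  by rewrite /Q1; congr (_ / _); rewrite -(mev_x q) -(mev_y q); exact: h0.
by rewrite /Q2; congr (_ / _); rewrite -(mev_x q) -(mev_y q); exact: h1.
Qed.

Lemma rdom_ratD5 q : rdom ratD5 q <-> q != 0.
Proof.
have -> : (q == 0) = ((q 0 0 == 0) && (q 1 0 == 0)) by rewrite -{1}(ptE q) pt_eq0.
by rewrite /rdom /= mev_den sqrD_eq0.
Qed.

(** A common divisor divides 16 x^4 and 16 y^4, both of which are combinations of the
    numerators and the denominator; so it is constant. *)
Lemma ratD5_reduced : rreduced ratD5.
Proof.
move=> d [e0 /= dE] nE; have [e1 n1] := nE ord0; have [e2 n2] := nE 1.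
have lead (i : 'I_2) (j : 'I_2) : j != i -> (exists e, (mpoly.mpolyX R (mpoly.mnm1 i) : mpoly2) ^+ 4 *+ 16 = d * e) ->
    mpoly.mlead d j = 0%N.
  move=> ji [e E].
  have n0 : (mpoly.mpolyX R (mpoly.mnm1 i) : mpoly2) ^+ 4 *+ 16 != 0.
    apply/eqP => h; have := congr1 (mpoly.meval (fun _ => 1 : R)) h.
    rewrite rmorphMn rmorphXn /= mpoly.mevalXU expr1n rmorph0 => /eqP.
    by rewrite pnatr_eq0.
  have := n0; rewrite E mulf_eq0 negb_or => /andP[d0 e0'].
  have := mpoly.mleadM d0 e0'; rewrite -E -scaler_nat mpoly.mleadZ ?pnatr_eq0//.
  rewrite mpoly.mleadX; last by apply: contra_neq n0 => ->; rewrite expr0n mul0rn.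
  rewrite mpoly.mleadXm => /(congr1 (fun m : mpoly.multinom 2 => m j)).
  rewrite mpoly.mnmDE mpoly.mulmnE mpoly.mnm1E eq_sym (negbTE ji) mul0n => /esym/eqP.
  by rewrite addn_eq0 => /andP[/eqP].
have E1 : x_ ^+ 4 *+ 16 = d * (e1 + e2 - e0 * (2 * (y_ ^+ 2 - 7 * x_ ^+ 2))).
  transitivity (numD5 ord0 + numD5 1 - denD5 * (2 * (y_ ^+ 2 - 7 * x_ ^+ 2))).
    by rewrite /numD5 /= /denD5; ring.
  by rewrite n1 n2 dE; ring.
have E2 : y_ ^+ 4 *+ 16 = d * (e1 + e2 - e0 * (2 * (x_ ^+ 2 - 7 * y_ ^+ 2))).
  transitivity (numD5 ord0 + numD5 1 - denD5 * (2 * (x_ ^+ 2 - 7 * y_ ^+ 2))).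
    by rewrite /numD5 /= /denD5; ring.
  by rewrite n1 n2 dE; ring.
have d0 : d != 0 by apply: contra_neq denD5_neq0 => d0; rewrite dE d0 mul0r.
rewrite -mpoly.mlead_deg// mpoly.mdegE big_ord_recl big_ord1.
rewrite (lead 1 ord0)//; last by exists (e1 + e2 - e0 * (2 * (x_ ^+ 2 - 7 * y_ ^+ 2))).
rewrite (lead ord0 (lift ord0 ord0))//.
by exists (e1 + e2 - e0 * (2 * (y_ ^+ 2 - 7 * x_ ^+ 2))).
Qed.

(** The homogeneous parts of the numerator and the denominator, written in the
    coordinate z, satisfy the hypotheses of the rigidity lemma. *)
Lemma superflow_minimal (r : ratvf R 2) : two_homogeneous r -> invariant_under (@D5 R) r ->
  (mpoly.msize (rden r) <= 3)%N -> scalar_multiple r ratD5.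
Proof.
move=> hom inv sd.
pose n0 := rnum r ord0; pose n1 := rnum r 1; pose dd := rden r.
pose M := maxn (maxn (mpoly.msize n0) (mpoly.msize n1)) 5.
pose N z : C := (mev n0 (ofC z))%:C%C + 'i * (mev n1 (ofC z))%:C%C.
pose d z : C := (mev dd (ofC z))%:C%C.
have revE q : toC (reval r q) = N (toC q) / d (toC q).
  rewrite /N /d toCK /reval /toC !mxE /mev -/n0 -/n1 -/dd.
  move: (mpoly.meval _ n0) (mpoly.meval _ n1) (mpoly.meval _ dd) => a b e.
  rewrite -fmorphV -complexiE; apply/eqP; rewrite eq_complex /=.
  by apply/andP; split; apply/eqP; ring.
have domE q : rdom r q <-> d (toC q) != 0.
  by rewrite /d toCK eq_complex /= eqxx andbT.
have step g z : (@D5 R) g -> d z != 0 -> d (toC (g *m ofC z)) != 0 ->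
    toC (reval r (g *m ofC z)) = toC (g *m reval r (ofC z)).
  move=> Dg d1 d2; have gu : g \in unitmx by move: Dg; rewrite D5E; case: (D5mx_group R) => + _ _ _; apply.
  congr toC; rewrite -[in RHS](inv g (ofC z) Dg) ?mulKVmx//; apply/domE => //.
  by rewrite ofCK.
have [c cE] : exists c : R, forall z, z != 0 -> d z != 0 ->
    N z = c%:C%C * (1 +i* 1)%C * (z^* ^+ 3 / z) * d z.
  apply: (@rigidity R _ (zeta5 R) (zeta_neq1 R) N d M
    (fun k => form n0 k + 'i *: form n1 k) (form dd)).
  - move=> k; rewrite (leq_trans (size_polyD _ _))// geq_max size_form/=.
    by rewrite (leq_trans (size_scale_leq _ _))// size_form.
  - by move=> k; exact: size_form.
  - by rewrite /M leq_maxr.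
  - move=> z z0; rewrite /N (@mev_form _ n0 M)//; last by rewrite /M !leq_max leqnn.
    rewrite (@mev_form _ n1 M)//; last by rewrite /M !leq_max leqnn orbT.
    rewrite mulr_sumr -big_split; apply: eq_bigr => k _ /=.
    by rewrite hornerD hornerZ; ring.
  - by move=> z z0; rewrite /d (@mev_form _ dd 3).
  - by move=> k z z0; exact: form_real.
  - move=> t z t0 z0 d1 d2.
    have := congr1 (@toC R) (hom t (ofC z) t0 _ _).
    rewrite toC_scale !revE toC_scale !ofCK => h.
    have {}h : N (t%:C%C * z) / d (t%:C%C * z) = (t ^+ 2)%:C%C * (N z / d z).
      by apply: h; apply/domE; rewrite ?toC_scale ofCK.
    have h' := congr1 (fun x => x * (d (t%:C%C * z) * d z)) h.
    move: h'; rewrite /= mulrA divfK// => ->; rewrite rmorphXn; field.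
    exact: d1.
  - move=> z z0 d1 d2.
    have := step (mat (zeta R) 0) z; rewrite !revE !toC_mat ofCK mul0r !addr0 revE ofCK => h.
    have {}h : N (zeta R * z) / d (zeta R * z) = zeta R * (N z / d z).
      rewrite h//; first by rewrite mul0r addr0.
      by rewrite D5E; left; exists (zeta R) => //=; exact: zeta5.
    have h' := congr1 (fun x => x * (d (zeta R * z) * d z)) h.
    by move: h'; rewrite /= mulrA divfK// => ->; field; exact: d1.
  - move=> z z0 d1 d2.
    have := step (mat 0 'i) z; rewrite !revE !toC_mat ofCK mul0r !add0r revE ofCK => h.
    have {}h : N ('i * z^* ) / d ('i * z^* ) = 'i * (N z / d z)^*.
      rewrite h//; first by rewrite mul0r add0r.
      rewrite -swap2E; move=> G [[_ _ _ _] sub]; apply: sub; by right.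
    have dr : (d z)^* = d z by apply/eqP; rewrite eq_complex /= oppr0 !eqxx.
    have E : (N z / d z)^* = (N z)^* / d z.
      by apply: (etrans (conjMe _ _)); rewrite conjVe dr.
    rewrite E in h; have h' := congr1 (fun x => x * (d ('i * z^* ) * d z)) h.
    by move: h'; rewrite /= mulrA divfK// => ->; field; exact: d1.
exists c => q /rdom_ratD5 q0 /domE dq; apply: toC_inj.
rewrite toC_scale revE reval_ratD5 toC_QD5 cE//; last by rewrite toC_eq0.
by rewrite mulfK// /Qz; ring.
Qed.

End Superflow.

Lemma superflow_phiD5 (R : realType) : superflow (@D5 R) (@phiD5 R).
Proof.
split; first by rewrite D5E; exact: D5mx_group.
split; first by exists 10%N; exact: card_D5.
exists (ratD5 R); split.
- by move=> p _; exact: projective_flow_phiD5.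
- by move=> p _; rewrite reval_ratD5; exact: has_vector_field_phiD5.
- split; first exact: ratD5_reduced.
    by move=> t p _ _ _; rewrite !reval_ratD5 QD5_scale.
  exists (pt 1 0); first by apply/rdom_ratD5; rewrite pt_eq0 oner_eq0.
  rewrite reval_ratD5 QD5E pt0 pt1 pt_eq0 /Q1 /Q2 negb_and; apply/orP; left.
  by rewrite !expr1n !expr0n /= !(mulr0, addr0, subr0) divr1 oner_neq0.
- move=> g p Dg _ _; rewrite !reval_ratD5.
  by move: Dg; rewrite -symmetries_QD5 => -[_]; apply.
- move=> r' _ hom inv; have [|h] := ltnP (mpoly.msize (rden (ratD5 R))) (mpoly.msize (rden r')).
    by right.
  by left; apply: superflow_minimal => //; apply: leq_trans h (msize_denD5 R).
Qed.

Theorem theorem3p3 (R : realType) :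
  (projective_flow setT (@phiD5 R) /\ has_vector_field setT (@phiD5 R) (@QD5 R) /\
   exists gam : R -> R -> option R, forall x y : R,
     phiD5 (pt x y) =
     obind (fun a => omap (fun b => pt a b) (gam y x)) (gam x y))
  /\
  (abelian_flow setT (@phiD5 R) /\
   forall p : 'cV[R]_2, p != 0 ->
     flow_orbit (@phiD5 R) p =
     connected_component
       [set q : 'cV[R]_2 | q != 0 /\ W (q 0 0) (q 1 0) = W (p 0 0) (p 1 0)] p)
  /\
  ((forall X : option R, kfun (alpha X) = X) /\
   (forall s : R, exists m : int, alpha (kfun s) = s + m%:~R * (5 * Omega R)) /\
   (forall s : R, kfun (s + 5 * Omega R) = kfun s))
  /\
  ((forall s : R, kfun s != None -> kdenom s = root5 (W (kval s) 1)) /\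
   forall (x y : R) (q : 'cV[R]_2),
     let sigma := root5 (W x y) in
     let omega := alpha (slope x y) - sigma in
     pt x y != 0 -> phiD5 (pt x y) = Some q ->
     kfun omega != None -> kdenom omega != 0 ->
     q = pt (kval omega * sigma / kdenom omega) (sigma / kdenom omega))
  /\
  (kfun 0 = Some (1 : R) /\
   (forall s0 : R, kfun s0 != None ->
      (\forall s \near s0, kfun s != None /\ derivable (@kval R) s 1) /\
      local_parametrization (@kval R) (@kder R)
        (fun a b => (curveD5 R).[b%:P].[a] = 0) s0) /\
   has_genus (curveD5 R[i]) 6)
  /\
  (superflow (@D5 R) (@phiD5 R) /\
   symmetries (@QD5 R) = @D5 R /\
   @D5 R #= `I_10).
Proof.
split; first by split; [exact: projective_flow_phiD5 | split;
  [exact: has_vector_field_phiD5 | exact: phiD5_symmetric]].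
split; first by split; [exact: abelian_flow_phiD5 | exact: orbit_component].
split.
  split; first exact: alphaK.
  split; last by move=> s; rewrite -[5 * Omega R]mul1r; exact: (kfun_periodic s 1).
  move=> s; have [m sE] := kfunP s; exists (- m).
  by rewrite {2}sE rmorphN mulNr addrK.
split; first by split; [exact: kdenomE | exact: phiD5_formula].
split; last by split; [exact: superflow_phiD5 | split; [exact: symmetries_QD5 | exact: card_D5]].
split.
  rewrite -[RHS]alphaK; congr kfun.
  by rewrite alpha_Some subrr.
split; last by apply: genus_curveD5 => n; rewrite pnatr_eq0.
move=> s0 s0f; split; last exact: kcurve_param.
have := kfun_near_finite s0f; apply: filterS => s sf; split=> //.
have := is_derive_kval sf.
by case.
Qed.
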